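(* Let $q\in[0,1]$, and let $\alpha\in(0,1]$ and $\beta\in(0,1)$ be constants. For each $n$ let $m=\alpha n$ and $k=\beta n$ (rounded to integers), and let $A$ be an $m\times n$ random matrix with i.i.d. standard normal entries. Set $c_\nu=\sqrt{2}\,\mathrm{erfinv}(1-\beta)$ (so that $P(|h|\ge c_\nu)=\beta$ for $h$ standard normal). Let $h$ be a standard normal random variable and for $\nu\ge0,\gamma\ge0$ define \[ I^{(1)}_{str}(\nu,\gamma)=\mathbb{E}\Big[\mathbf{1}_{\{|h|\ge c_\nu\}}\max_{w\in\mathbb{R}}\big(|h||w|+\nu|w|^q-\gamma w^2\big)\Big],\qquad I^{(2)}_{str}(\nu,\gamma)=\mathbb{E}\Big[\mathbf{1}_{\{|h|\le c_\nu\}}\max_{w\in\mathbb{R}}\big(|h||w|-\nu|w|^q-\gamma w^2\big)\Big]. \] Suppose \[ \min_{\gamma\ge0,\ \nu\ge0}\Big(I^{(1)}_{str}(\nu,\gamma)+I^{(2)}_{str}(\nu,\gamma)+\gamma\Big)<\sqrt{\alpha}. \] Then with overwhelming probability the following holds: for every $k$-sparse vector $\tilde x\in\mathbb{R}^n$ (at most $k$ nonzero entries), setting $y=A\tilde x$, the (unique) solution of $\min\{\|x\|_q^q : Ax=y\}$ is $\tilde x$.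
   Context: For $q\in(0,1]$, $\|x\|_q^q=\sum_i|x_i|^q$; for $q=0$ one uses the convention $|t|^0=1$ if $t\neq0$ and $0^0=0$. ''With overwhelming probability'' means with probability at least $1-\epsilon_n$, where $\epsilon_n$ decays exponentially in $n$ as $n\to\infty$. *)

(* Defs.v *)
From HB Require Import structures.
From mathcomp Require Import all_boot all_order all_algebra.
From mathcomp Require Import all_classical all_reals all_analysis.
Set Implicit Arguments. Unset Strict Implicit. Unset Printing Implicit Defensive.
Import Order.TTheory GRing.Theory Num.Theory.
Local Open Scope classical_set_scope.
Local Open Scope ring_scope.

Section defs.
Context {R : realType}.

(* |t|^q with the convention |t|^0 = 1 for t <> 0 and 0^0 = 0 *)
Definition absq (q t : R) : R := if t == 0 then 0 else powR `|t| q.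

Definition lqq (q : R) (n : nat) (x : 'cV[R]_n) : R := \sum_(i < n) absq q (x i ord0).

Definition nnz (n : nat) (x : 'cV[R]_n) : nat := #|[set i : 'I_n | x i ord0 != 0]|.

Definition wmax (q : R) (s nu gamma h : R) : \bar R :=
  ereal_sup (range (fun w : R => (`|h| * `|w| + s * nu * absq q w - gamma * w ^+ 2)%:E)).

Definition I1str (q c nu gamma : R) : \bar R :=
  (\int[lebesgue_measure]_(h in [set h : R | (c <= `|h|)%R])
     ((normal_pdf 0 1 h)%:E * wmax q 1 nu gamma h))%E.

Definition I2str (q c nu gamma : R) : \bar R :=
  (\int[lebesgue_measure]_(h in [set h : R | (`|h| <= c)%R])
     ((normal_pdf 0 1 h)%:E * wmax q (-1) nu gamma h))%E.

Definition strong_recovery (q : R) (m n k : nat) (M : 'M[R]_(m, n)) : Prop :=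
  forall xt : 'cV[R]_n, (nnz xt <= k)%N ->
    forall x : 'cV[R]_n, M *m x = M *m xt -> x != xt -> lqq q xt < lqq q x.

Definition gauss_iid d (T : measurableType d) (P : probability T R) (m n : nat)
    (A : 'I_m -> 'I_n -> T -> R) : Prop :=
  (forall i j, measurable_fun setT (A i j)) /\
  (forall i j B, measurable B -> P (A i j @^-1` B) = normal_prob 0 1 B) /\
  (forall B : 'I_m -> 'I_n -> set R, (forall i j, measurable (B i j)) ->
     P [set w | forall i j, B i j (A i j w)] =
     (\prod_(i < m) \prod_(j < n) P (A i j @^-1` B i j))%E).

End defs.

(* Main.v *)
Require Import Defs.
From HB Require Import structures.
From mathcomp Require Import all_boot all_order all_algebra.
From mathcomp Require Import all_classical all_reals all_analysis.
From mathcomp Require Import measurable_realfun ring lra.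
Set Implicit Arguments. Unset Strict Implicit. Unset Printing Implicit Defensive.
Import Order.TTheory GRing.Theory Num.Theory.
Import numFieldNormedType.Exports.
Local Open Scope classical_set_scope.
Local Open Scope ring_scope.

(* Recovery fails for some k-sparse vector only if the kernel of A meets the set
   of unit vectors u with sum_(i notin S) |u_i|^q <= sum_(i in S) |u_i|^q for some
   S of size at most k.  A finite net t of this set, of exponentially fine mesh,
   together with a Markov bound on the entries of A reduces the claim to showing
   that |A t_k| < 1 for some k has exponentially small probability.

   This is Gordon's escape through a mesh.  Consider
   (sum_k exp (- s (sqrt (1 + |A t_k + g|^2) + h . t_k)))^p with p = 2^-j, so that
   the power is an iterated square root and no supremum is needed.  Adding a small
   independent noise to A, or the same amount to the Gaussian vectors (g, h),
   changes the expectation by second-order terms whose difference has the sign of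
   - (1 - n.n') (1 - t.t'), where n and n' are vectors of length at most 1.  Noises
   add up by stability of the Gaussian law, so that the small steps compose and
   P (exists k, |A t_k| < 1) is at most, up to constants,
   exp (2 sigma) E exp (- sigma |g|) E exp (sigma max_k (- h . t_k)).

   The width h . u is bounded by weak duality with multipliers nu and gamma.  The
   choice of the k best coordinates is decoupled by paying for the excess of each
   coordinate over its value at the threshold c.  This turns the bound into a sum
   of i.i.d. terms whose mean is, per coordinate, I1str + I2str; the gap in the
   hypothesis then gives an exponential rate for sigma = e sqrt n with e small. *)

(** Interpolation, the usual road to Gordon's inequality, would need derivatives under integrals and
    integration by parts. A small noise step needs only a Taylor expansion of one explicit function
    with an integrable error, and the first two moments of the normal law. The price is that steps
    are iterated from whatever state the earlier noises have reached, so the constant of the cubic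
    error must be the same at all states. This dictates the function: the 1 under the square root
    bounds the derivatives of the norm, and each step is measured relative to the current value,
    which leaves means under weights of total mass 1.

    The size of the net never enters the bound, since [p] is chosen after the net, so small that
    [#|K|^p <= e]. No union bound is paid, and the mesh can be fine enough for a crude Markov bound
    on the entries.

    The threshold 1 in |A t_k| < 1 is arbitrary: it costs the factor exp (2 sigma), whose exponent
    is of order sqrt n, while all the exponents that compete are of order n. *)

Section gauss.
Context {R : realType}.
Local Notation mu := (@lebesgue_measure R).
Local Notation gam := (@normal_prob R 0 1).

Local Open Scope ereal_scope.

(** The Radon-Nikodym derivative of the normal law and [normal_pdf] have the same integral over
    every measurable set, hence agree almost everywhere. *)
Lemma ge0_integral_normal (f : R -> \bar R) (m s : R) :
  measurable_fun [set: R] f -> (forall x, 0 <= f x) ->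
  \int[normal_prob m s]_x f x = \int[mu]_x (f x * (normal_pdf m s x)%:E).
Proof.
move=> mf f0; have dom := @normal_prob_dominates R m s.
rewrite -(Radon_Nikodym_SigmaFinite.change_of_variables dom)//.
apply: ae_eq_integral => //.
- apply: emeasurable_funM => //.
  exact: measurable_int (Radon_Nikodym_SigmaFinite.f_integrable dom).
- apply: emeasurable_funM => //; apply/measurable_EFinP.
  exact: measurable_normal_pdf.
- apply: ae_eqe_mul2l; apply: integral_ae_eq => //.
  + exact: Radon_Nikodym_SigmaFinite.f_integrable.
  + by apply/measurable_EFinP; exact: measurable_normal_pdf.
  + by move=> E _ mE; rewrite -Radon_Nikodym_SigmaFinite.f_integral.
Qed.

(** The image of Lebesgue measure under the affine map, rescaled by [a], gives half-open intervals
    their length, so by uniqueness it is Lebesgue measure. *)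
Lemma ge0_integral_affine (f : R -> \bar R) (a b : R) : (0 < a)%R ->
  measurable_fun [set: R] f -> (forall x, 0 <= f x) ->
  \int[mu]_x f x = \int[mu]_x (a%:E * f (a * x + b)%R).
Proof.
move=> a0 mf f0.
pose phi : measurableTypeR R -> measurableTypeR R := fun x => (a * (x : R) + b)%R.
have mphi : measurable_fun [set: measurableTypeR R] phi.
  apply: measurable_funD => //; exact: measurable_funM.
have a0' : (0 <= a)%R by exact: ltW.
pose nu := mscale (NngNum a0')
  (measure_function_pushforward__canonical__measure_function_Measure mu mphi).
have E A : measurable A -> mu A = nu A.
  move=> mA; apply: lebesgue_measure_unique => // _ [[u v]] _ <-.
  rewrite /nu /mscale/= /pushforward.
  have pE : phi @^-1` `]u, v] = `]((u - b) / a)%R, ((v - b) / a)%R]%classic.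
    apply/seteqP; split=> x /=; rewrite !in_itv/= /phi => /andP[h1 h2]; apply/andP; split.
    - by rewrite ltr_pdivrMr// mulrC ltrBlDr.
    - by rewrite ler_pdivlMr// mulrC lerBrDr.
    - by move: h1; rewrite ltr_pdivrMr// mulrC ltrBlDr.
    - by move: h2; rewrite ler_pdivlMr// mulrC lerBrDr.
  rewrite [X in _ = _ * mu X]pE !lebesgue_measure_itv/= !lte_fin ltr_pM2r ?invr_gt0// ltrD2r.
  case: ifP => uv; rewrite ?mule0//.
  rewrite -EFinB -EFinM; congr EFin.
  by rewrite -mulrBl opprB addrA subrK mulrCA divff ?mulr1// gt_eqF.
have -> : \int[mu]_x f x = \int[nu]_x f x.
  by apply: eq_measure_integral => A mA _; exact: E.
rewrite ge0_integral_mscale// ge0_integral_pushforward//= -ge0_integralZl//.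
- by rewrite preimage_setT; exact: measurableT.
- by rewrite preimage_setT; exact: measurableT_comp mf mphi.
Qed.

(* Completing the square turns the convolution of two standard normal densities
   into a centred normal density times a conditional one. *)
Lemma normal_pdf_conv (u y : R) :
  (normal_pdf 0 1 (u - y) * normal_pdf 0 1 y =
   (Num.sqrt 2)^-1 * normal_pdf 0 1 ((Num.sqrt 2)^-1 * u) *
   normal_pdf (u / 2) (Num.sqrt 2)^-1 y)%R.
Proof.
have s2 : (0 < Num.sqrt 2 :> R)%R by rewrite sqrtr_gt0.
have s2s : (Num.sqrt 2 ^+ 2 = 2 :> R)%R by rewrite sqr_sqrtr.
rewrite !normal_pdfE ?oner_eq0 ?invr_eq0 ?gt_eqF// /normal_peak /normal_fun.
have p0 : (0 <= pi :> R)%R by exact: pi_ge0.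
have -> : (Num.sqrt (1 ^+ 2 * pi *+ 2) = Num.sqrt 2 * Num.sqrt pi :> R)%R.
  by rewrite expr1n mul1r -mulr_natl sqrtrM.
have -> : (Num.sqrt ((Num.sqrt 2)^-1 ^+ 2 * pi *+ 2) = Num.sqrt pi :> R)%R.
  by rewrite exprVn s2s -mulr_natl mulrA divff ?mul1r.
rewrite !expr1n !subr0 exprMn !exprVn s2s.
have E : (expR (- (u - y) ^+ 2 / (1 *+ 2)) * expR (- y ^+ 2 / (1 *+ 2)) =
  expR (- (2^-1 * u ^+ 2) / (1 *+ 2)) * expR (- (y - u / 2) ^+ 2 / (2^-1 *+ 2)) :> R)%R.
  by rewrite -!expRD; congr expR; field.
by rewrite mulrACA E !invfM; ring.
Qed.

(** After the substitution u = x + y and an exchange of integrals, [normal_pdf_conv] leaves a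
    conditional density in y of total mass one; a rescaling by sqrt 2 finishes. *)
Lemma normal_stable (f : R -> \bar R) :
  measurable_fun [set: R] f -> (forall x, 0 <= f x) ->
  \int[gam]_y \int[gam]_x f (x + y)%R = \int[gam]_z f (Num.sqrt 2 * z)%R.
Proof.
move=> mf f0.
have s2 : (0 < Num.sqrt 2 :> R)%R by rewrite sqrtr_gt0.
have mpdf m s : measurable_fun [set: measurableTypeR R] (EFin \o @normal_pdf R m s).
  by apply/measurable_EFinP; exact: measurable_normal_pdf.
have pdf0 m s x : 0 <= (@normal_pdf R m s x)%:E by rewrite lee_fin normal_pdf_ge0.
pose h (p : measurableTypeR R * measurableTypeR R) :=
  f p.2 * ((normal_pdf 0 1 (p.2 - p.1 : R))%:E * (normal_pdf 0 1 (p.1 : R))%:E).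
have mh : measurable_fun setT h.
  apply: emeasurable_funM.
    exact: (measurableT_comp (mf : measurable_fun [set: measurableTypeR R] f) measurable_snd).
  apply: emeasurable_funM.
    apply: (measurableT_comp (mpdf 0%R 1%R)).
    exact: (measurable_funB measurable_snd measurable_fst).
  exact: (measurableT_comp (mpdf 0%R 1%R) measurable_fst).
have mpa m s a b : measurable_fun [set: R] (fun x => (normal_pdf m s (a * x + b))%:E).
  apply: (measurableT_comp (mpdf m s)).
  by apply: measurable_funD => //; exact: measurable_funM.
have h0 p : 0 <= h p by rewrite !mule_ge0.
have mfy (y : R) : measurable_fun [set: R] (fun x => f (x + y)%R).
  by apply: measurableT_comp => //; exact: measurable_funD.
transitivity (\int[mu]_y \int[mu]_u h (y, u)).
  have E (y : R) : (\int[gam]_x f (x + y)%R) * (normal_pdf 0 1 y)%:E = \int[mu]_u h (y, u).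
    rewrite ge0_integral_normal// (@ge0_integral_affine _ 1 (- y))//; last 2 first.
    - apply: emeasurable_funM => //; exact: mpdf.
    - by move=> x; rewrite mule_ge0.
    transitivity ((\int[mu]_u (f u * (normal_pdf 0 1 (1 * u - y))%:E)) *
        (normal_pdf 0 1 y)%:E).
      congr (_ * _); apply: eq_integral => x _.
      by rewrite mul1e subrK mul1r.
    rewrite -ge0_integralZr//; last 2 first.
    - by apply: emeasurable_funM => //; exact: mpa.
    - by move=> x _; rewrite mule_ge0.
    by apply: eq_integral => x _; rewrite mul1r -muleA.
  rewrite ge0_integral_normal.
  - by apply: eq_integral => y _; exact: E.
  - apply: (measurable_fun_fubini_tonelli_F (m2 := gam)
      (fun p : measurableTypeR R * measurableTypeR R => f ((p.2 : R) + (p.1 : R))%R)) => //.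
    apply: (measurableT_comp (mf : measurable_fun [set: measurableTypeR R] f)).
    exact: (measurable_funD measurable_snd measurable_fst).
  - by move=> y; exact: integral_ge0.
rewrite (fubini_tonelli h mh h0)//=.
rewrite ge0_integral_normal; last 2 first.
- by apply: measurableT_comp => //; exact: measurable_funM.
- by [].
rewrite (@ge0_integral_affine _ (Num.sqrt 2)^-1 0) ?invr_gt0//; last 2 first.
- apply: emeasurable_funM => //; last exact: mpdf.
  by apply: measurableT_comp => //; exact: measurable_funM.
- by move=> x; rewrite mule_ge0.
apply: eq_integral => u _; rewrite /h/= addr0 mulrA divff ?gt_eqF// mul1r.
under eq_integral do rewrite -EFinM normal_pdf_conv EFinM muleA.
rewrite ge0_integralZl//; last 2 first.
- exact: mpdf.
- by rewrite mule_ge0// lee_fin mulr_ge0 ?invr_ge0 ?normal_pdf_ge0.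
by rewrite integral_normal_pdf mule1 EFinM muleCA.
Qed.

End gauss.

(** * Expectations of real-valued random variables *)

Section expectation.
Context {R : realType} d (T : measurableType d) (P : probability T R).
Implicit Types f g : T -> R.

Definition itg f := P.-integrable [set: T] (EFin \o f).
Definition Ex f : R := (\int[P]_x f x)%R.

Lemma itg_meas f : itg f -> measurable_fun [set: T] f.
Proof. by move=> /(measurable_int P) /measurable_EFinP. Qed.

Lemma itg_cst k : itg (fun=> k).
Proof. exact: finite_measure_integrable_cst. Qed.

Lemma itgD f g : itg f -> itg g -> itg (fun x => f x + g x).
Proof. by move=> h1 h2; have := integrableD measurableT h1 h2. Qed.

Lemma itgZ k f : itg f -> itg (fun x => k * f x).
Proof. by move=> h; have := integrableZl measurableT k h. Qed.

Lemma itgB f g : itg f -> itg g -> itg (fun x => f x - g x).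
Proof. by move=> h1 h2; have := integrableB measurableT h1 h2. Qed.

Lemma itg_le f g : measurable_fun [set: T] f -> itg g ->
  (forall x, `|f x| <= g x) -> itg f.
Proof.
move=> mf ig fg; apply: (le_integrable _ _ _ ig) => //.
- exact/measurable_EFinP.
- by move=> x _ /=; rewrite lee_fin (le_trans (fg x))// ler_norm.
Qed.

Lemma itg_norm f : itg f -> itg (fun x => `|f x|).
Proof. exact: integrable_norm. Qed.

Lemma itg_sum (I : finType) (f : I -> T -> R) :
  (forall i, itg (f i)) -> itg (fun x => \sum_i f i x).
Proof.
move=> h; rewrite /itg.
rewrite (_ : _ \o _ = fun x => (\sum_(i <- index_enum I) (f i x)%:E)%E).
  by apply: integrable_sum => // i _; exact: h.
by apply/funext => x /=; rewrite sumEFin.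
Qed.

Lemma ExE f : itg f -> (Ex f)%:E = (\int[P]_x (f x)%:E)%E.
Proof. by move=> h; rewrite /Ex /Rintegral fineK//; exact: integrable_fin_num. Qed.

Lemma ExD f g : itg f -> itg g -> Ex (fun x => f x + g x) = Ex f + Ex g.
Proof. by move=> ? ?; exact: RintegralD. Qed.

Lemma ExB f g : itg f -> itg g -> Ex (fun x => f x - g x) = Ex f - Ex g.
Proof. by move=> ? ?; exact: RintegralB. Qed.

Lemma ExZ k f : itg f -> Ex (fun x => k * f x) = k * Ex f.
Proof. by move=> ?; exact: RintegralZl. Qed.

Lemma Ex_cst k : Ex (fun=> k) = k.
Proof. by rewrite /Ex Rintegral_cst// [X in fine X](probability_setT P) mulr1. Qed.

Lemma Ex_le f g : itg f -> itg g -> (forall x, f x <= g x) -> Ex f <= Ex g.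
Proof. by move=> ? ? ?; exact: le_Rintegral. Qed.

Lemma Ex_ge0 f : (forall x, 0 <= f x) -> 0 <= Ex f.
Proof. by move=> h; apply: Rintegral_ge0 => x _; exact: h. Qed.

Lemma Ex_sum (I : finType) (f : I -> T -> R) :
  (forall i, itg (f i)) -> Ex (fun x => \sum_i f i x) = \sum_i Ex (f i).
Proof.
move=> h; apply: EFin_inj; rewrite ExE; last exact: itg_sum.
under eq_integral do rewrite -sumEFin.
rewrite integral_sum//.
by rewrite -sumEFin; apply: eq_bigr => i _; rewrite ExE.
Qed.

(* The first-order coefficient of the moment generating function at the origin
   is the mean. *)
Lemma Ex_mgf f (v C t0 : R) : 0 < t0 -> itg f ->
  (forall t, `|t| <= t0 -> itg (fun x => expR (t * f x))) ->
  (forall t, `|t| <= t0 -> Ex (fun x => expR (t * f x)) <= 1 + t * v + C * t ^+ 2) ->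
  Ex f = v.
Proof.
move=> t00 itf ite h.
have C0 t : `|t| <= t0 -> t * (Ex f - v) <= C * t ^+ 2.
  move=> tt; have := h _ tt; have : 1 + t * Ex f <= Ex (fun x => expR (t * f x)).
    rewrite -{1}(Ex_cst 1) -ExZ// -ExD//; [|exact: itg_cst|exact: itgZ].
    apply: Ex_le; [|exact: ite|by move=> x; exact: expR_ge1Dx].
    by apply: itgD; [exact: itg_cst|exact: itgZ].
  by lra.
have D t : 0 < t -> t <= t0 -> `|Ex f - v| <= C * t.
  move=> t1 t2; rewrite ler_norml; apply/andP; split.
    have := C0 (- t); rewrite normrN (ger0_norm (ltW t1)) => /(_ t2).
    by move=> h1; rewrite -(ler_pM2l t1); lra.
  have := C0 t; rewrite (ger0_norm (ltW t1)) => /(_ t2).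
  by move=> h1; rewrite -(ler_pM2l t1); lra.
apply/eqP; rewrite -subr_eq0 -normr_le0; apply/ler_addgt0Pl => e e0; rewrite addr0.
have C1 : 0 < `|C| + 1 by rewrite ltr_wpDl.
pose t := Num.min t0 (e / (`|C| + 1)).
have t1 : 0 < t by rewrite lt_min t00 divr_gt0.
apply: (le_trans (D _ t1 _)); first by rewrite ge_min lexx.
apply: (@le_trans _ _ ((`|C| + 1) * t)).
  by rewrite ler_pM2r// (le_trans (ler_norm _))// lerDl.
by rewrite mulrC -ler_pdivlMr// ge_min lexx orbT.
Qed.

End expectation.

(** * Exponential inequalities and moments of the normal law *)

Section expR_bounds.
Context {R : realType}.
Implicit Types x y : R.

Lemma expR_sub1_le_mul x : expR x - 1 <= x * expR x.
Proof.
have := expR_ge1Dx (- x); rewrite expRN => h.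
have := ler_wpM2l (expR_ge0 x) h; rewrite mulfV ?gt_eqF ?expR_gt0//; lra.
Qed.

Lemma expR_sub1_le x : `|expR x - 1| <= `|x| * expR `|x|.
Proof.
have [x0|x0] := leP 0 x.
  have h : 0 <= expR x - 1 by rewrite subr_ge0 -expR0 ler_expR.
  by rewrite (ger0_norm x0) (ger0_norm h) expR_sub1_le_mul.
have := expR_ge1Dx x; have := @expR_ge1Dx R `|x|.
have e1 : expR x - 1 <= 0 by rewrite subr_le0 -expR0 ler_expR ltW.
rewrite (ltr0_norm x0) (ler0_norm e1); nra.
Qed.

Lemma expR_le1Dsqr y : expR y <= 1 + y + y ^+ 2 * expR `|y|.
Proof.
have : y * (expR y - 1) <= `|y| * (`|y| * expR `|y|).
  by apply: le_trans (ler_norm _) _; rewrite normrM ler_wpM2l ?expR_sub1_le.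
have := expR_sub1_le_mul y; rewrite mulrA -expr2 real_normK ?num_real//; lra.
Qed.

End expR_bounds.

Section gauss_moments.
Context {R : realType}.
Local Notation gam := (@normal_prob R 0 1).
Implicit Types X : R -> R.

(** Common core of the two explicit moment generating functions below: in both cases completing the
    square turns the tilted density into [k] times another normal density, which has mass one. *)
Lemma gauss_exp_fact X (k m s : R) : s != 0 -> 0 <= k ->
  measurable_fun [set: R] X ->
  (forall x, expR (X x) * normal_pdf 0 1 x = k * normal_pdf m s x) ->
  itg gam (fun x : R => expR (X x)) /\ Ex gam (fun x : R => expR (X x)) = k.
Proof.
move=> s0 k0 mX h.
have mE : measurable_fun [set: R] (EFin \o (fun x : R => expR (X x))).
  by apply/measurable_EFinP; exact: measurableT_comp.
have E : (\int[gam]_x (expR (X x))%:E = k%:E)%E.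
  rewrite ge0_integral_normal//.
  under eq_integral do rewrite -EFinM h EFinM.
  rewrite ge0_integralZl//.
  - by rewrite integral_normal_pdf mule1.
  - by apply/measurable_EFinP; exact: measurable_normal_pdf.
  - by move=> x _; rewrite lee_fin normal_pdf_ge0.
have I : itg gam (fun x : R => expR (X x)).
  apply/integrableP; split; first exact: mE.
  under eq_integral do rewrite /= ger0_norm ?expR_ge0//.
  by rewrite E ltry.
by split => //; apply: EFin_inj; rewrite ExE.
Qed.

Lemma gauss_exp_sqr (a : R) : a < 2^-1 ->
  itg gam (fun x : R => expR (a * x ^+ 2)) /\
  Ex gam (fun x : R => expR (a * x ^+ 2)) = (Num.sqrt (1 - 2 * a))^-1.
Proof.
move=> a2; have b0 : 0 < 1 - 2 * a by lra.
have s0 : 0 < Num.sqrt (1 - 2 * a) by rewrite sqrtr_gt0.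
apply: (@gauss_exp_fact (fun x => a * x ^+ 2) _ 0 (Num.sqrt (1 - 2 * a))^-1).
- by rewrite invr_eq0 gt_eqF.
- by rewrite invr_ge0 ltW.
- by apply: measurable_funM => //; exact: measurable_funX.
- move=> x; rewrite !normal_pdfE ?oner_eq0 ?invr_eq0 ?gt_eqF// /normal_peak /normal_fun.
  have ss : Num.sqrt (1 - 2 * a) ^+ 2 = 1 - 2 * a by rewrite sqr_sqrtr// ltW.
  rewrite expr1n mul1r subr0.
  have -> : Num.sqrt ((Num.sqrt (1 - 2 * a))^-1 ^+ 2 * pi *+ 2) =
      (Num.sqrt (1 - 2 * a))^-1 * Num.sqrt (pi *+ 2) :> R.
    rewrite -mulrnAr sqrtrM ?sqr_ge0// sqrtr_sqr ger0_norm// invr_ge0 ltW//.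
  rewrite exprVn ss mulrCA -expRD invfM invrK -[in RHS]mulrA mulKf ?gt_eqF//.
  by congr (_ * expR _); field; rewrite ?gt_eqF.
Qed.

Lemma gauss_exp_lin (t : R) :
  itg gam (fun x : R => expR (t * x)) /\
  Ex gam (fun x : R => expR (t * x)) = expR (t ^+ 2 / 2).
Proof.
apply: (@gauss_exp_fact (fun x => t * x) _ t 1).
- exact: oner_neq0.
- exact: expR_ge0.
- exact: measurable_funM.
- move=> x; rewrite !normal_pdfE ?oner_eq0// /normal_peak /normal_fun.
  rewrite mulrCA [RHS]mulrCA -!expRD; by congr (_ * expR _); field.
Qed.

Lemma gauss_itg X (C : R) : measurable_fun [set: R] X ->
  (forall x, `|X x| <= C * expR (x ^+ 2 / 4)) -> itg gam X.
Proof.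
move=> mX h; apply: (@itg_le _ _ _ gam X (fun x : R => C * expR (4^-1 * x ^+ 2))).
- exact: mX.
- by apply: itgZ; apply: (proj1 (@gauss_exp_sqr 4^-1 _)); lra.
- by move=> x; rewrite mulrC; have := h x; rewrite mulrC [_ / 4]mulrC.
Qed.

Lemma expR_ge_sqr (y : R) : 0 <= y -> y ^+ 2 <= 4 * expR y.
Proof.

move=> y0; have := @expR_ge1Dx R (y / 2) => h.
have -> : expR y = expR (y / 2) ^+ 2 by rewrite expr2 -expRD; congr expR; field.
have h0 : 0 <= y / 2 by lra.
have : (y / 2) ^+ 2 <= expR (y / 2) ^+ 2 by rewrite lerXn2r ?nnegrE ?expR_ge0//; lra.
lra.
Qed.

Lemma gauss_itg_quad X (C : R) : measurable_fun [set: R] X ->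
  (forall x, `|X x| <= C * (1 + x ^+ 2)) -> itg gam X.
Proof.
move=> mX h.
have C0 : 0 <= C by have := h 0; rewrite expr0n addr0 mulr1; exact: le_trans.
apply: (@gauss_itg _ (C * 5)) => // x; apply: le_trans (h x) _.
rewrite -mulrA ler_wpM2l//.
have := @expR_ge1Dx R (x ^+ 2 / 4); have := sqr_ge0 x; lra.
Qed.

Lemma gauss_mean : itg gam (fun x : R => x) /\ Ex gam (fun x : R => x) = 0.
Proof.
have I : itg gam (fun x : R => x).
  apply: (@gauss_itg_quad _ 1) => // x; rewrite mul1r.
  have := sqr_ge0 x; have := sqr_ge0 (`|x| - 1); rewrite sqrrB1 real_normK ?num_real//; lra.
split=> //; apply: (@Ex_mgf _ _ _ _ _ _ 1 1) => // t t1.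
  exact: (gauss_exp_lin t).1.
rewrite (gauss_exp_lin t).2 mulr0 addr0 mul1r.
have t2 : t ^+ 2 <= 1 by rewrite -real_normK ?num_real// expr_le1.
have t20 := sqr_ge0 t.
(* With y = t^2 / 2 <= 1/2, the bound exp (- y) >= 1 - y gives exp y <= 1 / (1 - y) <= 1 + 2 y. *)
have := expR_ge1Dx (- (t ^+ 2 / 2)); rewrite expRN => h.
have e0 := expR_gt0 (t ^+ 2 / 2).
have : (1 - t ^+ 2 / 2) * expR (t ^+ 2 / 2) <= 1.
  rewrite -ler_pdivlMr// mul1r; lra.
nra.
Qed.

Lemma gauss_var : itg gam (fun x : R => x ^+ 2) /\ Ex gam (fun x : R => x ^+ 2) = 1.
Proof.
have I : itg gam (fun x : R => x ^+ 2).
  apply: (@gauss_itg_quad _ 1) => [|x]; first exact: measurable_funX.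
  by rewrite mul1r ger0_norm ?sqr_ge0// lerDr.
split=> //; apply: (@Ex_mgf _ _ _ _ _ _ 4 4^-1) => // t t1.
  by apply: (gauss_exp_sqr _).1; move: t1; rewrite ler_norml; lra.
have {t1} /andP[t1 t2] : - 4^-1 <= t <= 4^-1 by rewrite -ler_norml.
rewrite (gauss_exp_sqr _).2; last by lra.
rewrite mulr1; have b0 : 0 < 1 - 2 * t by lra.
have h0 : 0 <= 1 + t + 4 * t ^+ 2 by have := sqr_ge0 t; lra.
have s0 : 0 < Num.sqrt (1 - 2 * t) by rewrite sqrtr_gt0.
rewrite -[leLHS]mul1r ler_pdivrMr// -(@ler_pXn2r _ 2) ?nnegrE ?ler01 ?mulr_ge0 ?sqrtr_ge0//.
rewrite expr1n exprMn (sqr_sqrtr (ltW b0)).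
have t3 : t ^+ 3 <= 16^-1.
  rewrite exprS expr2; have : t * t <= 4^-1 by nra.
  have : 0 <= t * t by rewrite -expr2 sqr_ge0.
  nra.
(* This product is (1 - 2 t) (1 + t + 4 t^2)^2 - 1; the second factor is positive because t <=
   1/4. *)
have : 0 <= t ^+ 2 * (5 - 10 * t - 32 * t ^+ 3).
  by apply: mulr_ge0; [exact: sqr_ge0|lra].
lra.
Qed.

(** The exponential is expanded to second order. The bound 1/8 leaves room for two factors exp ((1 +
    x^2) / 8), one from the remainder and one that absorbs the square (e X)^2; their product grows
    like exp (x^2 / 4), which is still integrable. The linear term is exactly the mean, which is
    what lets the gap in the hypothesis survive. *)
Lemma gauss_mgf_quad X (C : R) : 0 < C -> measurable_fun [set: R] X ->
  (forall x, `|X x| <= C * (1 + x ^+ 2)) ->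
  exists C' : R, 0 <= C' /\ forall e, 0 <= e -> e * C <= 8^-1 ->
    itg gam (fun x : R => expR (e * X x)) /\
    Ex gam (fun x : R => expR (e * X x)) <= expR (e * Ex gam X + C' * e ^+ 2).
Proof.
move=> C0 mX h.
have itX : itg gam X by exact: (gauss_itg_quad mX h).
pose Y (x : R) := expR (4^-1 * x ^+ 2).
have [iY _] : itg gam Y /\ _ := gauss_exp_sqr (ltac:(lra) : 4^-1 < 2^-1 :> R).
have [K [K0 KE]] : exists K, 0 <= K /\ K = C ^+ 2 * (64 * 4) * expR 4^-1.
  eexists; split; last reflexivity.
  by apply: mulr_ge0 (expR_ge0 _); apply: mulr_ge0 (sqr_ge0 _) _; lra.
exists (K * Ex gam Y); split.
  by apply: mulr_ge0 => //; apply: Ex_ge0 => x; exact: expR_ge0.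
move=> e e0 eC.
have pw x : expR (e * X x) <= 1 + e * X x + (K * e ^+ 2) * Y x.
  apply: (le_trans (expR_le1Dsqr _)); rewrite lerD2l.
  have x0 : 0 <= 1 + x ^+ 2 by rewrite addr_ge0 ?sqr_ge0.
  have ax : `|e * X x| <= e * C * (1 + x ^+ 2).
    by rewrite normrM (ger0_norm e0) -mulrA ler_wpM2l.
  have e1 : expR `|e * X x| <= expR ((1 + x ^+ 2) / 8).
    rewrite ler_expR (le_trans ax)// mulrC ler_wpM2l//.
  have e2 : (e * X x) ^+ 2 <= (e * C) ^+ 2 * (64 * 4 * expR ((1 + x ^+ 2) / 8)).
    rewrite -[leLHS]real_normK ?num_real//.
    have ax2 : `|e * X x| ^+ 2 <= (e * C * (1 + x ^+ 2)) ^+ 2.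
      by rewrite lerXn2r ?nnegrE// mulr_ge0// mulr_ge0// ltW.
    apply: (le_trans ax2); rewrite exprMn ler_wpM2l ?sqr_ge0//.
    have y0 : 0 <= (1 + x ^+ 2) / 8 by lra.
    by have := expR_ge_sqr y0; lra.
  apply: (le_trans (ler_pM (sqr_ge0 _) (expR_ge0 _) e2 e1)).
  have EE : expR ((1 + x ^+ 2) / 8) * expR ((1 + x ^+ 2) / 8) =
      expR 4^-1 * expR (4^-1 * x ^+ 2).
    by rewrite -!expRD; congr expR; field.
  rewrite KE /Y le_eqVlt; apply/orP; left; apply/eqP.
  move: EE; set E1 := expR _ => EE.
  transitivity ((e * C) ^+ 2 * (64 * 4) * (E1 * E1)); first by ring.
  by rewrite EE; ring.
have iR : itg gam (fun x => 1 + e * X x + (K * e ^+ 2) * Y x).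
  by apply: itgD; [apply: itgD; [exact: itg_cst|exact: itgZ]|exact: itgZ].
have iL : itg gam (fun x : R => expR (e * X x)).
  apply: (@itg_le _ _ _ gam _ _ _ iR) => [|x].
    by apply: measurableT_comp => //; exact: measurable_funM.
  by rewrite ger0_norm ?expR_ge0.
split => //; apply: (le_trans (Ex_le iL iR pw)).
rewrite ExD ?ExD ?Ex_cst ?ExZ//; [|exact: itg_cst|exact: itgZ|idtac|exact: itgZ].
  by apply: le_trans (expR_ge1Dx _); rewrite addrA lerD2l mulrAC.
by apply: itgD; [exact: itg_cst|exact: itgZ].
Qed.

End gauss_moments.

(** * Gaussian vectors *)
Section ipow.
Context {R : realType} d (T : measurableType d) (mu : probability T R).

Definition tcons n (p : T * n.-tuple T) : n.+1.-tuple T := [tuple of p.1 :: p.2].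

Lemma measurable_tcons n : measurable_fun [set: T * n.-tuple T] (@tcons n).
Proof. exact: measurable_cons. Qed.

HB.instance Definition _ n :=
  isMeasurableFun.Build _ _ _ _ (@tcons n) (@measurable_tcons n).

(** The recursion through [tcons] lets Tonelli peel off one coordinate at a time. *)
Fixpoint ipow n : probability (n.-tuple T) R :=
  match n with
  | 0 => \d_([tuple] : 0.-tuple T)
  | n'.+1 => distribution (mu \x (ipow n'))%E (@tcons n')
  end.

Lemma ge0_integral_ipowS n (f : n.+1.-tuple T -> \bar R) :
  measurable_fun setT f -> (forall t, 0 <= f t)%E ->
  (\int[ipow n.+1]_t f t = \int[mu]_x \int[ipow n]_t f (tcons (x, t)))%E.
Proof.
move=> mf f0; rewrite /= ge0_integral_distribution//.
rewrite (fubini_tonelli1 (f \o @tcons n))//.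
  exact: (measurableT_comp mf (@measurable_tcons n)).
by move=> x; exact: f0.
Qed.

Definition box n (B : 'I_n -> set T) : set (n.-tuple T) :=
  [set t | forall i, B i (tnth t i)].

Lemma measurable_box n (B : 'I_n -> set T) :
  (forall i, measurable (B i)) -> measurable (box B).
Proof.
move=> mB; rewrite (_ : box B = \bigcap_(i in [set: 'I_n]) ((@tnth n T)^~ i @^-1` B i)).
  apply: fin_bigcap_measurable => // i _; rewrite -[X in measurable X]setTI.
  exact: measurable_tnth.
by apply/seteqP; split=> t h i; [move=> _|]; exact: h.
Qed.

Lemma ipow_box n (B : 'I_n -> set T) : (forall i, measurable (B i)) ->
  ipow n (box B) = (\prod_(i < n) mu (B i))%E.
Proof.
elim: n B => [B _|n ih B mB] /=.
  by rewrite big_ord0 diracE mem_set// => -[].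
rewrite /distribution /pushforward.
have -> : @tcons n @^-1` box B = B ord0 `*` box (fun i => B (lift ord0 i)).
  apply/seteqP; split=> [[x t] /= h|[x t] /= [h1 h2] i].
    split=> [|i]; first exact: (h ord0).
    by have := h (lift ord0 i); rewrite tnthS.
  case: (unliftP ord0 i) => [j ->|->]; first by rewrite tnthS; exact: h2.
  exact: h1.
rewrite /= product_measure1E//; last by exact: measurable_box.
by rewrite big_ord_recl; congr (_ * _)%E; exact: ih.
Qed.

(** Boxes are stable under intersection and generate the product sigma-algebra. This later turns the
    product rule assumed for the entries of A into the full law of the matrix. *)
Lemma ipow_unique n (Q : probability (n.-tuple T) R) :
  (forall B : 'I_n -> set T, (forall i, measurable (B i)) ->
    Q (box B) = (\prod_(i < n) mu (B i))%E) ->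
  forall A, measurable A -> Q A = ipow n A.
Proof.
move=> h; pose G := [set box B | B in [set B : 'I_n -> set T | forall i, measurable (B i)]].
apply: (@measure_unique _ R _ G (fun=> setT)).
- apply/seteqP; split.
      apply: smallest_sub; first exact: smallest_sigma_algebra.
    move=> A; rewrite -bigcup_seq/= => -[i _ [C mC <-]]; rewrite setTI.
    apply: sub_sigma_algebra; exists (fun j => if j == i then C else setT).
      by move=> j; case: ifP.
    apply/seteqP; split=> t /=.
      by move=> /(_ i); rewrite eqxx.
    by move=> h' j; case: eqP => [->|].
  apply: smallest_sub; first exact: sigma_algebra_measurable.
  by move=> _ [B mB <-]; exact: measurable_box.
- move=> _ _ [B mB <-] [C mC <-]; exists (fun i => B i `&` C i).
    by move=> i; exact: measurableI.
  apply/seteqP; split=> t /=; first by move=> h'; split=> i; have [] := h' i.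
  by move=> [h1 h2] i; split.
- move=> _; exists (fun=> setT) => //.
  by apply/seteqP; split=> t //.
- by apply: bigcup_const; exists 0%N.
- by move=> _ [B mB <-]; transitivity (\prod_(i < n) mu (B i))%E; [exact: h|exact/esym/ipow_box].
- by move=> _; rewrite (le_lt_trans (probability_le1 _ _))// ltry.
Qed.

Lemma ge0_integral_ipow_prod n (f : 'I_n -> T -> R) :
  (forall i, measurable_fun [set: T] (f i)) -> (forall i x, 0 <= f i x) ->
  (\int[ipow n]_t (\prod_(i < n) f i (tnth t i))%:E =
   \prod_(i < n) \int[mu]_x (f i x)%:E)%E.
Proof.
elim: n f => [f _ _|n ih f mf f0].
  under eq_integral do rewrite big_ord0.
  by rewrite big_ord0 integral_cst//= diracT mule1.
have mp k (g : 'I_k -> T -> R) : (forall i, measurable_fun [set: T] (g i)) ->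
    measurable_fun [set: k.-tuple T] (fun t => \prod_(i < k) g i (tnth t i)).
  move=> mg; apply: measurable_prod => i _.
  exact: (measurableT_comp (mg i) (@measurable_tnth _ _ _ i)).
rewrite (@ge0_integral_ipowS n (fun t => (\prod_(i < n.+1) f i (tnth t i))%:E)); last 2 first.
- by apply/measurable_EFinP; exact: mp.
- by move=> t; rewrite lee_fin prodr_ge0.
rewrite big_ord_recl -ih//.
rewrite -ge0_integralZr//; last 3 first.
- exact/measurable_EFinP.
- by move=> x _; rewrite lee_fin.
- by apply: integral_ge0 => t _; rewrite lee_fin prodr_ge0.
apply: eq_integral => x _.
rewrite -ge0_integralZl//; last 3 first.
- by apply/measurable_EFinP; apply: (mp n (fun i => f (lift ord0 i))) => i; exact: mf.
- by move=> t _; rewrite lee_fin prodr_ge0.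
- by rewrite lee_fin.
apply: eq_integral => t _; rewrite -EFinM big_ord_recl tnth0; congr (_ * _)%:E.
by apply: eq_bigr => i _; rewrite tnthS.
Qed.

End ipow.

Section gauss_tuple.
Context {R : realType}.
Local Notation gam := (@normal_prob R 0 1).
Local Notation RR := (measurableTypeR R).
Local Notation tpl n := (n.-tuple RR).

Definition gtup n : probability (tpl n) R := ipow gam n.

Definition tadd n (z : n.-tuple R) (r : R) (x : n.-tuple R) : n.-tuple R :=
  [tuple tnth z i + r * tnth x i | i < n].

Lemma tnth_tadd n (z : n.-tuple R) r x i : tnth (tadd z r x) i = tnth z i + r * tnth x i.
Proof. by rewrite tnth_mktuple. Qed.

Lemma tadd_cons n (z0 x0 r : R) (z x : n.-tuple R) :
  tadd (tcons (z0, z)) r (tcons (x0, x)) = tcons (z0 + r * x0, tadd z r x) :> n.+1.-tuple R.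
Proof.
apply: eq_from_tnth => i; rewrite tnth_tadd.
by case: (unliftP ord0 i) => [j ->|->] //; rewrite !tnthS /= tnth_tadd.
Qed.

Lemma measurable_tadd d (T : measurableType d) n (f g : T -> tpl n) (r : R) :
  measurable_fun [set: T] f -> measurable_fun [set: T] g ->
  measurable_fun [set: T] (fun t => tadd (f t) r (g t) : tpl n).
Proof.
move=> mf mg; apply/measurable_fun_tnthP => i.
rewrite (_ : _ \o _ = fun t => (tnth (f t) i : R) + r * (tnth (g t) i : R)); last first.
  by apply/funext => t /=; rewrite tnth_tadd.
have m1 : measurable_fun [set: T] (fun t => tnth (f t) i : R).
  exact: (measurableT_comp (@measurable_tnth _ RR n i) mf).
have m2 : measurable_fun [set: T] (fun t => tnth (g t) i : R).
  exact: (measurableT_comp (@measurable_tnth _ RR n i) mg).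
apply: measurable_funD => //; exact: measurable_funM.
Qed.

Lemma measurable_tcons_comp d (T : measurableType d) n (f : T -> R) (g : T -> tpl n) :
  measurable_fun [set: T] f -> measurable_fun [set: T] g ->
  measurable_fun [set: T] (fun t => tcons (f t, g t) : tpl n.+1).
Proof. by move=> mf mg; exact: measurable_cons. Qed.

Local Open Scope ereal_scope.

Lemma ge0_integral_gtupS n (f : tpl n.+1 -> \bar R) :
  measurable_fun [set: tpl n.+1] f -> (forall t, 0 <= f t) ->
  \int[gtup n.+1]_t f t = \int[gam]_x \int[gtup n]_t f (tcons (x, t)).
Proof. exact: ge0_integral_ipowS. Qed.

Lemma measurable_int_gtup d (T : measurableType d) n (f : T -> tpl n -> \bar R) :
  measurable_fun [set: T * tpl n] (fun p => f p.1 p.2) -> (forall a t, 0 <= f a t) ->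
  measurable_fun [set: T] (fun a => \int[gtup n]_t f a t).
Proof.
move=> mf f0.
exact: (measurable_fun_fubini_tonelli_F (m2 := gtup n) (fun p => f p.1 p.2) mf).
Qed.

(** Induction on the coordinates: the head is [normal_stable], after the head of one noise has been
    exchanged with the tail of the other. *)
Lemma gtup_stable n (F : tpl n -> \bar R) (z : n.-tuple R) (r : R) :
  measurable_fun [set: tpl n] F -> (forall t, 0 <= F t) ->
  \int[gtup n]_y \int[gtup n]_x F (tadd (tadd z r y) r x) =
  \int[gtup n]_w F (tadd z (r * Num.sqrt 2) w).
Proof.
elim: n F z => [|n ih] F z mF F0.
  have E t : F t = F [tuple] by rewrite tuple0.
  under eq_integral do (under eq_integral do rewrite E); under [RHS]eq_integral do rewrite E.
  have I (c : \bar R) : \int[gtup 0]_t c = c.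
    by rewrite integral_cst// [X in _ * X](probability_setT (gtup 0)) mule1.
  by rewrite !I.
case/tupleP: z => z0 z; rewrite -/(tcons (z0, z)).
have mFc d (T : measurableType d) (f : T -> R) (g : T -> tpl n) :
    measurable_fun [set: T] f -> measurable_fun [set: T] g ->
    measurable_fun [set: T] (fun t => F (tcons (f t, g t))).
  by move=> mf mg; apply: (measurableT_comp mF); exact: measurable_tcons_comp.
pose K u := \int[gtup n]_w F (tcons (u, tadd z (r * Num.sqrt 2) w)).
have mK : measurable_fun [set: R] K.
  apply: measurable_int_gtup => //; apply: mFc => //.
  exact: measurable_tadd.
have K0 u : 0 <= K u by exact: integral_ge0.
have mlin : measurable_fun [set: R] (fun u : R => z0 + r * u)%R.
  by apply: measurable_funD => //; exact: measurable_funM.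
transitivity (\int[gam]_y0 \int[gam]_x0 K (z0 + r * (x0 + y0))%R); last first.
  rewrite (@normal_stable R (fun u => K (z0 + r * u)%R)) => [|//|//]; last first.
    exact: measurableT_comp.
  rewrite ge0_integral_gtupS => [|//|//]; last first.
    by apply: (measurableT_comp mF); exact: measurable_tadd.
  apply: eq_integral => v _; apply: eq_integral => w _.
  by rewrite tadd_cons mulrA.
rewrite ge0_integral_gtupS; last 2 first.
- apply: measurable_int_gtup => //; apply: (measurableT_comp mF).
  by apply: measurable_tadd => //; exact: measurable_tadd.
- by move=> t; exact: integral_ge0.
apply: eq_integral => y0 _.
transitivity (\int[gtup n]_y \int[gam]_x0 \int[gtup n]_x
    F (tcons (z0 + r * (x0 + y0), tadd (tadd z r y) r x))%R).
  apply: eq_integral => y _.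
  rewrite ge0_integral_gtupS => [|//|//]; last first.
    by apply: (measurableT_comp mF); exact: measurable_tadd.
  apply: eq_integral => x0 _; apply: eq_integral => x _.
  by rewrite !tadd_cons mulrDr addrA [in RHS]addrAC.
rewrite (fubini_tonelli (m1 := gtup n) (m2 := gam) (fun p => \int[gtup n]_x
    F (tcons (z0 + r * ((p.2 : R) + y0), tadd (tadd z r p.1) r x))%R)) => [|//|//]; last 2 first.
- apply: measurable_int_gtup => //; apply: mFc.
    apply: (measurableT_comp mlin).
    apply: measurable_funD => //.
    exact: (measurableT_comp measurable_snd measurable_fst).
  apply: measurable_tadd => //; apply: measurable_tadd => //.
  exact: (measurableT_comp measurable_fst measurable_fst).
- by move=> p; exact: integral_ge0.
apply: eq_integral => x0 _.
rewrite /= (ih (fun t => F (tcons (z0 + r * (x0 + y0), t))%R))//.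
exact: mFc.
Qed.
End gauss_tuple.

Section gauss_tuple_moments.
Context {R : realType}.
Local Notation gam := (@normal_prob R 0 1).
Local Notation RR := (measurableTypeR R).
Local Notation tpl n := (n.-tuple RR).

Lemma itg_ge0_eq d (T : measurableType d) (P : probability T R) (f : T -> R) (k : R) :
  measurable_fun [set: T] f -> (forall x, 0 <= f x) ->
  (\int[P]_x (f x)%:E = k%:E)%E -> itg P f /\ Ex P f = k.
Proof.
move=> mf f0 E; have I : itg P f.
  apply/integrableP; split; first exact/measurable_EFinP.
  by under eq_integral do rewrite /= ger0_norm//; rewrite E ltry.
by split=> //; apply: EFin_inj; rewrite ExE.
Qed.

Lemma gtup_prod n (f : 'I_n -> R -> R) :
  (forall i, itg gam (f i)) -> (forall i x, 0 <= f i x) ->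
  itg (gtup n) (fun t : tpl n => \prod_(i < n) f i (tnth t i)) /\
  Ex (gtup n) (fun t : tpl n => \prod_(i < n) f i (tnth t i)) = \prod_(i < n) Ex gam (f i).
Proof.
move=> hf f0; have mf i : measurable_fun [set: R] (f i) := itg_meas (hf i).
apply: itg_ge0_eq.
- apply: measurable_prod => i _.
  exact: (measurableT_comp (mf i) (@measurable_tnth _ RR _ i)).
- by move=> t; rewrite prodr_ge0.
- rewrite (@ge0_integral_ipow_prod R _ RR gam n f)//.
  by rewrite -prodEFin; apply: eq_bigr => i _; rewrite ExE.
Qed.

Lemma gauss_itg_expabs (K : R) : itg gam (fun x : R => expR (K * `|x|)).
Proof.
apply: (@gauss_itg _ _ (expR (K ^+ 2))).
  by apply: measurableT_comp => //; apply: measurable_funM.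
move=> x; rewrite ger0_norm ?expR_ge0// -expRD ler_expR.
have := sqr_ge0 (`|x| / 2 - K); rewrite sqrrB expr_div_n real_normK ?num_real//.
by rewrite (_ : 2 ^+ 2 = 4 :> R); [lra|ring].
Qed.

Lemma gtup_itg_expabs n (K : R) :
  itg (gtup n) (fun t : tpl n => expR (K * \sum_(i < n) `|tnth t i : R|)).
Proof.
have [h _] := @gtup_prod n (fun _ x => expR (K * `|x|))
  (fun=> gauss_itg_expabs K) (fun _ _ => expR_ge0 _).
rewrite (_ : (fun t => _) =
  fun t : tpl n => \prod_(i < n) expR (K * `|tnth t i : R|))//.
by apply/funext => t; rewrite mulr_sumr expR_sum.
Qed.

Lemma measurable_lin n (c : 'I_n -> R) :
  measurable_fun [set: tpl n] (fun t : tpl n => \sum_(i < n) c i * (tnth t i : R)).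
Proof.
apply: measurable_sum => i; apply: measurable_funM => //.
exact: (@measurable_tnth _ RR n i).
Qed.

(** The shift [u] carries the induction, as it absorbs the head coordinate. It also gives access to
    the mean of a linear form later on. *)
Lemma gtup_lin_sqr n (c : 'I_n -> R) (u : R) :
  (\int[gtup n]_t ((u + \sum_(i < n) c i * (tnth t i : R)) ^+ 2)%:E =
   (u ^+ 2 + \sum_(i < n) c i ^+ 2)%:E)%E.
Proof.
elim: n c u => [|n ih] c u.
  under eq_integral do rewrite big_ord0 addr0.
  by rewrite big_ord0 addr0 integral_cst// [X in (_ * X)%E](probability_setT (gtup 0)) mule1.
rewrite (@ge0_integral_gtupS R n (fun t => ((u + \sum_(i < n.+1) c i * (tnth t i : R)) ^+ 2)%:E));
  last 2 first.
- by apply/measurable_EFinP; apply: measurable_funX; apply: measurable_funD => //;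
    exact: measurable_lin.
- by move=> t; rewrite lee_fin sqr_ge0.
pose s := \sum_(i < n) c (lift ord0 i) ^+ 2.
transitivity (\int[gam]_x ((u ^+ 2 + s) + (2 * u * c ord0 * x + c ord0 ^+ 2 * x ^+ 2))%:E)%E.
  apply: eq_integral => x _; transitivity (((u + c ord0 * x) ^+ 2 + s)%:E); last first.
    by congr (_%:E); rewrite -[in LHS]/(x : R); ring.
  rewrite -ih; apply: eq_integral => t _; rewrite big_ord_recl /= tnth0 addrA.
  by congr ((_ + _) ^+ 2)%:E; apply: eq_bigr => i _; rewrite tnthS.
have [i1 e1] := @gauss_mean R; have [i2 e2] := @gauss_var R.
have j1 := itgZ (2 * u * c ord0) i1; have j2 := itgZ (c ord0 ^+ 2) i2.
rewrite -(@ExE _ _ _ gam (fun x : R => (u ^+ 2 + s) +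
  (2 * u * c ord0 * x + c ord0 ^+ 2 * x ^+ 2))); last first.
  by apply: itgD; [exact: itg_cst|exact: itgD].
congr (_%:E); rewrite ExD ?Ex_cst ?ExD ?ExZ// ?e1 ?e2; last 2 first.
- exact: itg_cst.
- exact: itgD.
by rewrite big_ord_recl -/s; ring.
Qed.

End gauss_tuple_moments.

Section gauss_family.
Context {R : realType}.
Local Notation gam := (@normal_prob R 0 1).
Local Notation RR := (measurableTypeR R).
Variable I : finType.
Local Notation tI := (#|I|.-tuple RR).
Local Notation gI := (@gtup R #|I|).

(** Product measures live on tuples, whereas the noises are indexed by pairs and by sums of index
    types; [co] reads a tuple as a family over any finite type. *)
Definition co (x : #|I|.-tuple R) (i : I) : R := tnth x (enum_rank i).

Lemma co_big (S : Type) (idx : S) (op : Monoid.com_law idx) (F : I -> R -> S) (x : #|I|.-tuple R) :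
  \big[op/idx]_(i : I) F i (co x i) =
  \big[op/idx]_(k < #|I|) F (enum_val k) (tnth x k).
Proof.
rewrite (reindex_onto (@enum_val I I) enum_rank)/=; last by move=> i _; exact: enum_rankK.
apply: eq_big => [k|k _]; first by rewrite enum_valK eqxx.
by rewrite /co enum_valK.
Qed.

Lemma measurable_co i : measurable_fun [set: tI] (fun x : tI => co x i : R).
Proof. exact: (@measurable_tnth _ RR #|I|). Qed.

Lemma gtupI_expabs (K : R) : itg gI (fun x : tI => expR (K * \sum_i `|co x i|)).
Proof.
rewrite (_ : (fun x => _) = fun x : tI => expR (K * \sum_(k < #|I|) `|tnth x k : R|)).
  exact: gtup_itg_expabs.
by apply/funext => x; rewrite (co_big _ (fun _ t => `|t|)).
Qed.

Definition lin (c : I -> R) (x : #|I|.-tuple R) : R := \sum_i c i * co x i.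

Lemma linE c x : lin c x = \sum_(k < #|I|) c (enum_val k) * tnth x k.
Proof. exact: (co_big _ (fun i t => c i * t)). Qed.

Lemma measurable_linI c : measurable_fun [set: tI] (fun x : tI => lin c x).
Proof.
by apply: measurable_sum => i; apply: measurable_funM => //; exact: measurable_co.
Qed.

Lemma gtupI_lin_sqr c (u : R) :
  itg gI (fun x : tI => (u + lin c x) ^+ 2) /\
  Ex gI (fun x : tI => (u + lin c x) ^+ 2) = u ^+ 2 + \sum_i c i ^+ 2.
Proof.
apply: itg_ge0_eq.
- by apply: measurable_funX; apply: measurable_funD => //; exact: measurable_linI.
- by move=> x; exact: sqr_ge0.
under eq_integral do rewrite linE.
rewrite (@gtup_lin_sqr R _ (fun k => c (enum_val k)) u); congr ((_ + _)%:E).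
rewrite (reindex_onto (@enum_val I I) enum_rank)/=; last by move=> i _; exact: enum_rankK.
by apply: eq_bigl => k; rewrite enum_valK eqxx.
Qed.

Lemma gtupI_lin2 c : itg gI (fun x : tI => lin c x ^+ 2) /\
  Ex gI (fun x : tI => lin c x ^+ 2) = \sum_i c i ^+ 2.
Proof.
have [] := gtupI_lin_sqr c 0; rewrite expr0n/= add0r.
by rewrite (_ : (fun x : tI => (0 + lin c x) ^+ 2) = fun x : tI => lin c x ^+ 2)//;
  apply/funext => x; rewrite add0r.
Qed.

(** Polarization: a linear form l is ((1 + l)^2 - l^2 - 1) / 2, and both squares have known
    means. *)
Lemma gtupI_lin c : itg gI (fun x : tI => lin c x) /\ Ex gI (fun x : tI => lin c x) = 0.
Proof.
have [i1 e1] := gtupI_lin_sqr c 1; have [i0 e0] := gtupI_lin2 c.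
have E : (fun x : tI => lin c x) =
    (fun x : tI => 2^-1 * (((1 + lin c x) ^+ 2 - lin c x ^+ 2) - 1)).
  by apply/funext => x; field.
have i2 := itgB i1 i0.
rewrite E; split; first by apply: itgZ; apply: itgB => //; exact: itg_cst.
rewrite ExZ ?ExB ?Ex_cst ?e1 ?e0 ?expr1n//; last 2 first.
- exact: itg_cst.
- by apply: itgB => //; exact: itg_cst.
by field.
Qed.

Lemma gtupI_prod (f : I -> R -> R) :
  (forall i, itg gam (f i)) -> (forall i x, 0 <= f i x) ->
  itg gI (fun x : tI => \prod_i f i (co x i)) /\
  Ex gI (fun x : tI => \prod_i f i (co x i)) = \prod_i Ex gam (f i).
Proof.
move=> hf f0.
have [h1 h2] := @gtup_prod R #|I| (fun k => f (enum_val k)) (fun k => hf _) (fun k => f0 _).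
rewrite (_ : (fun x : tI => \prod_i f i (co x i)) =
  fun x : tI => \prod_(k < #|I|) f (enum_val k) (tnth x k)); last first.
  by apply/funext => x; rewrite (co_big _ f).
split=> //; rewrite h2.
rewrite [RHS](reindex_onto (@enum_val I I) enum_rank)/=; last by move=> i _; exact: enum_rankK.
by apply: eq_bigl => k; rewrite enum_valK eqxx.
Qed.

End gauss_family.

(** * Second-order expansion of a small noise step *)
Section calculus.
Context {R : realType}.
Implicit Types v e r : R.

Lemma expR_sub1D v : 0 <= expR v - 1 - v <= v ^+ 2 * expR `|v|.
Proof.
have := expR_ge1Dx v; have := expR_le1Dsqr v.
by move=> h1 h2; apply/andP; split; lra.
Qed.

Lemma expR_taylor2 v :
  `|expR v - 1 - v - v ^+ 2 / 2| <= `|v| ^+ 3 * expR `|v|.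
Proof.
pose g v : R := expR v - 1 - v - v ^+ 2 / 2.
have dg (x : R) : is_derive x 1 g (expR x - 1 - x).
  rewrite /g; apply: is_derive_eq; rewrite /GRing.scale/=.
  by field.
have cg : continuous g.
  by move=> x; apply/differentiable_continuous/derivable1_diffP; case: (dg x).
have g0 : g 0 = 0 by rewrite /g expR0 expr0n/= mul0r !subr0 subrr.
have bd c : `|c| <= `|v| -> `|(expR c - 1 - c) * v| <= `|v| ^+ 3 * expR `|v|.
  move=> cv; rewrite normrM.
  have -> : `|v| ^+ 3 * expR `|v| = `|v| ^+ 2 * expR `|v| * `|v| by ring.
  apply: ler_wpM2r => //.
  have /andP[h1 h2] := expR_sub1D c; rewrite ger0_norm// (le_trans h2)//.
  apply: ler_pM => //; rewrite ?expR_ge0 ?sqr_ge0 ?ler_expR//.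
  by rewrite -[leLHS]real_normK ?num_real// lerXn2r ?nnegrE.
rewrite -/(g v); have [v0|v0] := leP 0 v.
  have [c] := MVT_segment v0 (fun x _ => dg x) (continuous_subspaceT cg).
  rewrite g0 !subr0 in_itv/= => /andP[c0 cv] ->; apply: bd.
  by rewrite !ger0_norm.
have [c] := MVT_segment (ltW v0) (fun x _ => dg x) (continuous_subspaceT cg).
rewrite g0 !sub0r in_itv/= => /andP[c0 cv] E; rewrite -normrN E mulrN normrN; apply: bd.
by rewrite !ler0_norm ?lerN2// ltW.
Qed.

Definition rsqrt (j : nat) (x : R) : R := iter j Num.sqrt x.

(** With d = sqrt (1 + e) - 1 one has e = d^2 + 2 d and |d| <= |e|, so every remainder is an
    explicit polynomial in d. *)
Lemma sqrt_taylor e : -1 <= e ->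
  [/\ `|Num.sqrt (1 + e) - 1| <= `|e|,
      `|Num.sqrt (1 + e) - 1 - e / 2| <= e ^+ 2 / 2 &
      `|Num.sqrt (1 + e) - 1 - e / 2 + e ^+ 2 / 8| <= `|e| ^+ 3].
Proof.
move=> e1; have e0 : 0 <= 1 + e by lra.
set y := Num.sqrt (1 + e); pose d := y - 1.
have y0 : 0 <= y by exact: sqrtr_ge0.
have yy : y ^+ 2 = 1 + e by rewrite sqr_sqrtr.
have E : e = d ^+ 2 + 2 * d by rewrite /d; move: yy; clear; lra.
have d1 : -1 <= d by rewrite /d; lra.
have de : `|d| <= `|e|.
  rewrite E expr2 -mulrDl normrM ler_peMl// ger0_norm; lra.
have d2 : d ^+ 2 <= e ^+ 2.
  by rewrite -[leLHS]real_normK ?num_real// -[leRHS]real_normK ?num_real// lerXn2r ?nnegrE.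
have h2 : y - 1 - e / 2 = - (d ^+ 2 / 2) by rewrite -/d E; field.
split => //.
- by rewrite h2 normrN ger0_norm; have := sqr_ge0 d; lra.
- rewrite h2; have -> : - (d ^+ 2 / 2) + e ^+ 2 / 8 = - ((d - e / 2) * (d + e / 2)) / 2.
    by field.
  rewrite -/d in h2; rewrite h2 normrM normrN normrM normrN.
  have a1 : `|d ^+ 2 / 2| <= `|e| ^+ 2 / 2.
    by rewrite ger0_norm ?real_normK ?num_real//; have := sqr_ge0 d; lra.
  have a2 : `|d + e / 2| <= 2 * `|e|.
    apply: (le_trans (ler_normD _ _)); rewrite normrM (ger0_norm (x := 2^-1))//.
    by have := normr_ge0 e; lra.
  have := ler_pM (normr_ge0 _) (normr_ge0 _) a1 a2.
  rewrite (ger0_norm (x := 2^-1))// !exprS expr0.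
  have : 0 <= `|e| * (`|e| * (`|e| * 1)) by rewrite !mulr_ge0.
  lra.
Qed.

(** Binomial expansion of (1 + e)^p, by induction on the number of square roots. It holds on the
    whole half-line e >= -1, so the noise need not be bounded; the coefficient - p (1 - p) / 2 is
    where the concavity of the power enters. *)
Lemma rsqrt_taylor (j : nat) : exists2 C : R, 0 <= C & forall e, -1 <= e ->
  let p := 2^-1 ^+ j in let u := rsqrt j (1 + e) - 1 in
  [/\ -1 <= u, `|u| <= `|e|, `|u - p * e| <= e ^+ 2 &
   `|u - (p * e - p * (1 - p) / 2 * e ^+ 2)| <= C * `|e| ^+ 3].
Proof.
elim: j => [|j [C C0 ih]].
  exists 0 => // e e1 /=.
  have -> : 1 + e - 1 = e by ring.
  split=> //; rewrite ?expr0 ?mul1r ?subrr ?normr0 ?sqr_ge0 ?mul0r//.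
  by rewrite subr0 subrr normr0.
exists (C + 3) => [|e e1 /=]; first by rewrite addr_ge0.
have := ih e e1; rewrite /rsqrt; set u := iter j _ _ - 1; set p := 2^-1 ^+ j.
move=> [u1 ue up uC].
have -> : iter j (@Num.sqrt R) (1 + e) = 1 + u by rewrite /u; ring.
have [s1 s2 s3] := sqrt_taylor u1.
set w := Num.sqrt (1 + u) - 1 in s1 s2 s3 *.
have p0 : 0 <= p by rewrite exprn_ge0.
have p1 : p <= 1 by rewrite exprn_ile1//; lra.
have u2 : u ^+ 2 <= e ^+ 2.
  by rewrite -[leLHS]real_normK ?num_real// -[leRHS]real_normK ?num_real// lerXn2r ?nnegrE.
have u3 : `|u| ^+ 3 <= `|e| ^+ 3 by rewrite lerXn2r ?nnegrE.
have pe : 2^-1 ^+ j.+1 = p / 2 by rewrite exprSr.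
rewrite pe; split.
- by rewrite /w; have := sqrtr_ge0 (1 + u); lra.
- exact: le_trans s1 ue.
- have -> : w - p / 2 * e = (w - u / 2) + (u - p * e) / 2 by field.
  apply: (le_trans (ler_normD _ _)); rewrite normrM (ger0_norm (x := 2^-1))//; lra.
- have -> : w - (p / 2 * e - p / 2 * (1 - p / 2) / 2 * e ^+ 2) =
    (w - u / 2 + u ^+ 2 / 8) + (u - (p * e - p * (1 - p) / 2 * e ^+ 2)) / 2 -
    (u - p * e) * (u + p * e) / 8 by field.
  have b3 : `|(u - p * e) * (u + p * e) / 8| <= `|e| ^+ 3 / 4.
    have a2 : `|u + p * e| <= 2 * `|e|.
      apply: (le_trans (ler_normD _ _)); rewrite normrM (ger0_norm p0).
      by have := ler_wpM2r (normr_ge0 e) p1; lra.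
    rewrite !normrM (ger0_norm (x := 8^-1))//.
    have := ler_pM (normr_ge0 _) (normr_ge0 _) up a2.
    by rewrite -[e ^+ 2]real_normK ?num_real// mulrCA -exprSr; lra.
  have b2 : `|(u - (p * e - p * (1 - p) / 2 * e ^+ 2)) / 2| <= C * `|e| ^+ 3 / 2.
    by rewrite normrM (ger0_norm (x := 2^-1))// ler_pM2r.
  apply: (le_trans (ler_normB _ _)); apply: (le_trans (lerD (ler_normD _ _) (lexx _))).
  have e3 : 0 <= `|e| ^+ 3 by rewrite exprn_ge0.
  have Ce3 : 0 <= C * `|e| ^+ 3 by rewrite mulr_ge0.
  lra.
Qed.

Lemma rsqrtM (j : nat) (x y : R) : 0 <= x -> rsqrt j (x * y) = rsqrt j x * rsqrt j y.
Proof.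
rewrite /rsqrt; elim: j x y => [//|j ih] x y x0.
by rewrite !iterSr sqrtrM// ih// sqrtr_ge0.
Qed.

Lemma rsqrt_le (j : nat) (x y : R) : x <= y -> rsqrt j x <= rsqrt j y.
Proof. by move=> xy; elim: j => [//|j ih]; rewrite /rsqrt !iterS ler_wsqrtr. Qed.

Lemma rsqrt_expR (j : nat) (x : R) : rsqrt j (expR x) = expR (2^-1 ^+ j * x).
Proof.
elim: j => [|j ih]; first by rewrite expr0 mul1r.
rewrite /rsqrt iterS -/(rsqrt j _) ih.
have -> : expR (2^-1 ^+ j * x) = expR (2^-1 ^+ j.+1 * x) ^+ 2.
  by rewrite -expRM_natl -mulr_natl; congr expR; rewrite exprS; field.
by rewrite sqrtr_sqr ger0_norm ?expR_ge0.
Qed.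

Section second_order.
Variables (j : nat) (K : finType) (B : R).
Hypothesis B1 : 1 <= B.
Let p : R := 2^-1 ^+ j.

(* Second-order expansion of [(sum_k pi_k exp v_k)^p] when [v_k] is [r L_k + r^2 q_k]
   up to a cubic error. *)
Lemma second_order : exists2 C : R, 0 <= C &
  forall (w : K -> R) (v L q : K -> R) (r W : R),
  (forall k, 0 <= w k) -> \sum_k w k = 1 ->
  0 <= r <= 1 -> 1 <= W ->
  (forall k, `|v k| <= B * r * W) -> (forall k, expR `|v k| <= W) ->
  (forall k, `|L k| <= B * W) -> (forall k, `|q k| <= B * W ^+ 2) ->
  (forall k, `|v k - r * L k - r ^+ 2 * q k| <= B * r ^+ 3 * W ^+ 3) ->
  `|rsqrt j (\sum_k w k * expR (v k)) - 1 -
    (r * (p * \sum_k w k * L k) + r ^+ 2 * (p * \sum_k w k * (q k + L k ^+ 2 / 2) -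
      p * (1 - p) / 2 * (\sum_k w k * L k) ^+ 2))| <= C * r ^+ 3 * W ^+ 6.
Proof.
have [C C0 hC] := rsqrt_taylor j.
exists (4 * B ^+ 3 + 2 * B ^+ 4 + C * B ^+ 3) =>
  [|w v L q r W w0 w1 /andP[r0 r1] W1 bv ev bL bq bvq].
  have B0 : 0 <= B by exact: le_trans ler01 B1.
  by rewrite !addr_ge0// mulr_ge0// exprn_ge0.
have B0 : 0 <= B by exact: le_trans ler01 B1.
have W0 : 0 <= W by exact: le_trans ler01 W1.
have wavg (a : K -> R) M : (forall k, `|a k| <= M) -> `|\sum_k w k * a k| <= M.
  move=> aM; apply: (le_trans (ler_norm_sum _ _ _)).
  rewrite -[leRHS]mul1r -w1 mulr_suml; apply: ler_sum => k _.
  by rewrite normrM (ger0_norm (w0 k)) ler_wpM2l.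
have Wle a b : (a <= b)%N -> W ^+ a <= W ^+ b by move=> ab; rewrite ler_weXn2l.
have rle a b : (a <= b)%N -> r ^+ b <= r ^+ a by move=> ab; rewrite ler_wiXn2l.
have Ble a b : (a <= b)%N -> B ^+ a <= B ^+ b by move=> ab; rewrite ler_weXn2l.
(* Since B, W >= 1 and r <= 1, all errors are compared through monomials B^a r^b W^c, with at least
   the power 3 of [r] in the end. *)
have mon a a' b b' c c' : (a <= a')%N -> (b' <= b)%N -> (c <= c')%N ->
    B ^+ a * r ^+ b * W ^+ c <= B ^+ a' * r ^+ b' * W ^+ c'.
  move=> h1 h2 h3; apply: ler_pM; rewrite ?mulr_ge0 ?exprn_ge0//; last exact: Wle.
  by apply: ler_pM; rewrite ?exprn_ge0//; [exact: Ble|exact: rle].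
have mon0 a b c : 0 <= B ^+ a * r ^+ b * W ^+ c by rewrite !mulr_ge0 ?exprn_ge0.
pose ep k := expR (v k) - 1.
have bv' k : `|v k| <= B ^+ 1 * r ^+ 1 * W ^+ 1 by rewrite !expr1.
have bep k : `|ep k| <= B ^+ 1 * r ^+ 1 * W ^+ 2.
  apply: (le_trans (expR_sub1_le _)).
  rewrite (_ : B ^+ 1 * r ^+ 1 * W ^+ 2 = B ^+ 1 * r ^+ 1 * W ^+ 1 * W); last by ring.
  by apply: ler_pM => //; exact: expR_ge0.
have brL k : `|r * L k| <= B ^+ 1 * r ^+ 1 * W ^+ 1.
  by rewrite normrM (ger0_norm r0) !expr1 mulrAC mulrC ler_wpM2r.
have brq k : `|r ^+ 2 * q k| <= B ^+ 1 * r ^+ 2 * W ^+ 2.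
  rewrite normrM (ger0_norm (exprn_ge0 2 r0)) expr1.
  rewrite (_ : B * r ^+ 2 * W ^+ 2 = r ^+ 2 * (B * W ^+ 2)); last by ring.
  by rewrite ler_wpM2l ?exprn_ge0.
have bvL k : `|v k - r * L k| <= 2 * (B ^+ 1 * r ^+ 2 * W ^+ 3).
  rewrite (_ : v k - r * L k = (v k - r * L k - r ^+ 2 * q k) + r ^+ 2 * q k); last by ring.
  apply: (le_trans (ler_normD _ _)).
  have := bvq k; have := brq k; have := mon 1 1 2 2 2 3 isT isT isT.
  have := mon 1 1 3 2 3 3 isT isT isT.
  rewrite !expr1; lra.
have bv2 k : `|v k ^+ 2 - (r * L k) ^+ 2| <= 4 * (B ^+ 2 * r ^+ 3 * W ^+ 4).
  rewrite subr_sqr normrM.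
  have h : `|v k + r * L k| <= 2 * (B ^+ 1 * r ^+ 1 * W ^+ 1).
    by apply: (le_trans (ler_normD _ _)); have := bv' k; have := brL k; lra.
  apply: (le_trans (ler_pM (normr_ge0 _) (normr_ge0 _) (bvL k) h)).
  by rewrite le_eqVlt; apply/orP; left; apply/eqP; ring.
have ep3 k : `|ep k - (r * L k + r ^+ 2 * (q k + L k ^+ 2 / 2))| <= 4 * (B ^+ 3 * r ^+ 3 * W ^+ 4).
  rewrite (_ : _ - _ = (expR (v k) - 1 - v k - v k ^+ 2 / 2) +
    (v k - r * L k - r ^+ 2 * q k) + (v k ^+ 2 - (r * L k) ^+ 2) / 2); last by rewrite /ep; field.
  have h1 : `|expR (v k) - 1 - v k - v k ^+ 2 / 2| <= B ^+ 3 * r ^+ 3 * W ^+ 4.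
    apply: (le_trans (expR_taylor2 _)).
    rewrite (_ : B ^+ 3 * r ^+ 3 * W ^+ 4 = (B * r * W) ^+ 3 * W); last by ring.
    by apply: ler_pM; rewrite ?exprn_ge0 ?expR_ge0// lerXn2r ?nnegrE ?mulr_ge0.
  have h2 := bvq k.
  have h3 : `|(v k ^+ 2 - (r * L k) ^+ 2) / 2| <= 2 * (B ^+ 2 * r ^+ 3 * W ^+ 4).
    by rewrite normrM (ger0_norm (x := 2^-1))//; have := bv2 k; lra.
  apply: (le_trans (ler_normD _ _)); apply: (le_trans (lerD (ler_normD _ _) (lexx _))).
  have := mon 1 3 3 3 3 4 isT isT isT; have := mon 2 3 3 3 4 4 isT isT isT.
  rewrite !expr1; lra.
pose e := \sum_k w k * ep k.
pose Lb := \sum_k w k * L k.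
pose Qb := \sum_k w k * (q k + L k ^+ 2 / 2).
have eE : \sum_k w k * expR (v k) = 1 + e.
  rewrite /e -w1 -big_split; apply: eq_bigr => k _.
  by rewrite /ep/=; ring.
have e1 : -1 <= e.
  suff : 0 <= 1 + e by lra.
  by rewrite -eE sumr_ge0// => k _; rewrite mulr_ge0 ?expR_ge0.
have be : `|e| <= B ^+ 1 * r ^+ 1 * W ^+ 2 by exact: wavg.
have eL3 : `|e - (r * Lb + r ^+ 2 * Qb)| <= 4 * (B ^+ 3 * r ^+ 3 * W ^+ 4).
  rewrite (_ : _ - _ = \sum_k w k * (ep k - (r * L k + r ^+ 2 * (q k + L k ^+ 2 / 2)))).
    exact: wavg.
  rewrite /e /Lb /Qb !mulr_sumr -big_split -sumrB; apply: eq_bigr => k _ /=; ring.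
have eL2 : `|e - r * Lb| <= 6 * (B ^+ 3 * r ^+ 2 * W ^+ 4).
  rewrite (_ : e - r * Lb = (e - (r * Lb + r ^+ 2 * Qb)) + r ^+ 2 * Qb); last by ring.
  have hQ : `|r ^+ 2 * Qb| <= 2 * (B ^+ 2 * r ^+ 2 * W ^+ 2).
    rewrite /Qb mulr_sumr (eq_bigr (fun k => w k * (r ^+ 2 * (q k + L k ^+ 2 / 2)))); last first.
      by move=> k _; ring.
    apply: wavg => k; rewrite mulrDr; apply: (le_trans (ler_normD _ _)).
    have h1 : `|r ^+ 2 * (L k ^+ 2 / 2)| <= B ^+ 2 * r ^+ 2 * W ^+ 2.
      rewrite (_ : r ^+ 2 * _ = (r * L k) ^+ 2 / 2); last by field.
      rewrite normrM (ger0_norm (x := 2^-1))// ger0_norm ?sqr_ge0//.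
      have : (r * L k) ^+ 2 <= (B ^+ 1 * r ^+ 1 * W ^+ 1) ^+ 2.
        by rewrite -[leLHS]real_normK ?num_real// lerXn2r ?nnegrE.
      rewrite (_ : (B ^+ 1 * _ * _) ^+ 2 = B ^+ 2 * r ^+ 2 * W ^+ 2); last by ring.
      by have := mon0 2 2 2; lra.
    have := brq k; have := mon 1 2 2 2 2 2 isT isT isT; lra.
  apply: (le_trans (ler_normD _ _)).
  have := mon 3 3 3 2 4 4 isT isT isT; have := mon 2 3 2 2 2 4 isT isT isT; lra.
have bL' : `|r * Lb| <= B ^+ 1 * r ^+ 1 * W ^+ 1.
  rewrite /Lb mulr_sumr (eq_bigr (fun k => w k * (r * L k))); last by move=> k _; ring.
  exact: wavg.
have e2 : `|e ^+ 2 - (r * Lb) ^+ 2| <= 12 * (B ^+ 4 * r ^+ 3 * W ^+ 6).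
  rewrite subr_sqr normrM.
  have h : `|e + r * Lb| <= 2 * (B ^+ 1 * r ^+ 1 * W ^+ 2).
    apply: (le_trans (ler_normD _ _)); have := mon 1 1 1 1 1 2 isT isT isT; lra.
  apply: (le_trans (ler_pM (normr_ge0 _) (normr_ge0 _) eL2 h)).
  by rewrite le_eqVlt; apply/orP; left; apply/eqP; ring.
have e3 : `|e| ^+ 3 <= B ^+ 3 * r ^+ 3 * W ^+ 6.
  rewrite (_ : B ^+ 3 * _ * _ = (B ^+ 1 * r ^+ 1 * W ^+ 2) ^+ 3); last by ring.
  by rewrite lerXn2r ?nnegrE.
have p0 : 0 <= p by rewrite exprn_ge0.
have p1 : p <= 1 by rewrite exprn_ile1//; lra.
rewrite eE -/Lb -/Qb; have [_ _ _] := hC e e1.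
set u := rsqrt j (1 + e) - 1; rewrite -/p => hu.
rewrite (_ : u - _ = (u - (p * e - p * (1 - p) / 2 * e ^+ 2)) +
  p * (e - (r * Lb + r ^+ 2 * Qb)) - p * (1 - p) / 2 * (e ^+ 2 - (r * Lb) ^+ 2)); last by field.
have h1 : `|p * (e - (r * Lb + r ^+ 2 * Qb))| <= 4 * (B ^+ 3 * r ^+ 3 * W ^+ 6).
  rewrite normrM (ger0_norm p0); have := ler_pM p0 (normr_ge0 _) p1 eL3.
  have := mon 3 3 3 3 4 6 isT isT isT; lra.
have h2 : `|p * (1 - p) / 2 * (e ^+ 2 - (r * Lb) ^+ 2)| <= 2 * (B ^+ 4 * r ^+ 3 * W ^+ 6).
  have pp0 : 0 <= p * (1 - p) / 2 by rewrite mulr_ge0// mulr_ge0//; lra.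
  have pp1 : p * (1 - p) / 2 <= 8^-1 by have := sqr_ge0 (p - 2^-1); lra.
  rewrite normrM (ger0_norm pp0).
  have := ler_pM pp0 (normr_ge0 _) pp1 e2; have := mon0 4 3 6; lra.
have h3 := ler_wpM2l C0 e3.
apply: (le_trans (ler_normB _ _)); apply: (le_trans (lerD (ler_normD _ _) (lexx _))).
lra.
Qed.
End second_order.
End calculus.

(** * The smoothed Euclidean norm *)

Section smoothed_norm.
Context {R : realType} (m : nat).
Implicit Types x D : 'I_m -> R.

(** The 1 removes the singularity at the origin: the gradient [x / NN x] has length below 1, and the
    second-order error is uniform in [x]. *)
Definition NN x : R := Num.sqrt (1 + \sum_a x a ^+ 2).

Lemma NN_ge1 x : 1 <= NN x.
Proof.
rewrite -[leLHS](@sqrtr1 R) /NN ler_wsqrtr// lerDl.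
by apply: sumr_ge0 => a _; exact: sqr_ge0.
Qed.

Lemma NN_sqr x : NN x ^+ 2 = 1 + \sum_a x a ^+ 2.
Proof.
by rewrite sqr_sqrtr// addr_ge0// sumr_ge0// => a _; exact: sqr_ge0.
Qed.

Lemma NN_coord x a : `|x a| <= NN x.
Proof.
have N0 : 0 <= NN x := le_trans ler01 (NN_ge1 x).
rewrite -(@ler_pXn2r _ 2) ?nnegrE// NN_sqr real_normK ?num_real// (bigD1 a)//=.
rewrite addrCA lerDl addr_ge0// sumr_ge0// => b _; exact: sqr_ge0.
Qed.

(** Directional derivative of [NN] at [x] along [D]. *)
Definition ndot x D : R := \sum_a x a / NN x * D a.

Lemma ndot_le x D : `|ndot x D| <= \sum_a `|D a|.
Proof.
have N0 : 0 < NN x := lt_le_trans ltr01 (NN_ge1 x).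
apply: (le_trans (ler_norm_sum _ _ _)); apply: ler_sum => a _.
rewrite normrM ler_piMl// normrM normfV (gtr0_norm N0) ler_pdivrMr// mul1r.
exact: NN_coord.
Qed.

Lemma sum_sqr_le D : \sum_a D a ^+ 2 <= (\sum_a `|D a|) ^+ 2.
Proof.
rewrite [leRHS]expr2 mulr_suml; apply: ler_sum => a _.
rewrite -real_normK ?num_real// expr2 ler_wpM2l// (bigD1 a)//= lerDl sumr_ge0//.
Qed.

(** No calculus is involved. Let d = N' - N. Writing N'^2 - N^2 symmetrically and dividing by N + N'
    gives |d| <= r dl. Writing it at the base point and dividing by 2 N gives d = r u + (r^2 q -
    d^2) / (2 N). The remainder is then ((r u)^2 - d^2) / (2 N), where d - r u is quadratic and d +
    r u linear in [r]. *)
Lemma NN_expand x D (r : R) : 0 <= r ->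
  let N := NN x in let N' := NN (fun a => x a + r * D a) in let dl := \sum_a `|D a| in
  `|N' - N| <= r * dl /\
  `|N' - N - r * ndot x D - r ^+ 2 * ((\sum_a D a ^+ 2 - ndot x D ^+ 2) / (2 * N))|
     <= (r * dl) ^+ 3.
Proof.
move=> r0 N N' dl; pose x' a := x a + r * D a.
have N1 : 1 <= N := NN_ge1 x; have N'1 : 1 <= N' := NN_ge1 x'.
have N0 : 0 < N := lt_le_trans ltr01 N1.
have N'0 : 0 < N' := lt_le_trans ltr01 N'1.
have dl0 : 0 <= dl by rewrite sumr_ge0.
have nN : ndot x D * N = \sum_a x a * D a.
  by rewrite mulr_suml; apply: eq_bigr => a _; rewrite mulrAC divfK ?gt_eqF.
have nN' : ndot x' D * N' = \sum_a x' a * D a.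
  by rewrite mulr_suml; apply: eq_bigr => a _; rewrite mulrAC divfK ?gt_eqF.
have E1 : N' ^+ 2 - N ^+ 2 = r * (ndot x D * N + ndot x' D * N').
  rewrite nN nN' /N /N' !NN_sqr -big_split/= mulr_sumr.
  rewrite opprD addrACA subrr add0r -sumrB; apply: eq_bigr => a _.
  by rewrite /x'; ring.
have E2 : N' ^+ 2 - N ^+ 2 = 2 * r * (ndot x D * N) + r ^+ 2 * \sum_a D a ^+ 2.
  rewrite nN /N /N' !NN_sqr !mulr_sumr -big_split/=.
  rewrite opprD addrACA subrr add0r -sumrB; apply: eq_bigr => a _.
  by ring.
have nd := ndot_le x D; have nd' := ndot_le x' D; rewrite -/dl in nd nd'.
have s2 := sum_sqr_le D; rewrite -/dl in s2.
have s20 : 0 <= \sum_a D a ^+ 2 by rewrite sumr_ge0// => a _; exact: sqr_ge0.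
move: (ndot x D) (ndot x' D) (\sum_a D a ^+ 2) nd nd' s2 s20 E1 E2 {nN nN'} => u u' q.
move=> nd nd' s2 s20 E1 E2.
have d1 : `|N' - N| <= r * dl.
  have NN0 : 0 < N + N' by rewrite addr_gt0.
  rewrite -(ler_pM2r NN0) -[X in `|_| * X](gtr0_norm NN0) -normrM.
  rewrite (_ : (N' - N) * (N + N') = r * (u * N + u' * N')); last by rewrite -E1; ring.
  rewrite normrM (ger0_norm r0) -mulrA ler_wpM2l//.
  apply: (le_trans (ler_normD _ _)); rewrite !normrM (gtr0_norm N0) (gtr0_norm N'0) mulrDr.
  by apply: lerD; rewrite ler_pM2r.
split=> //.
move: E1 E2; set d := N' - N in d1 * => _ E2.
have E3 : d = r * u + (r ^+ 2 * q - d ^+ 2) / (2 * N).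
  have E4 : d ^+ 2 + 2 * N * d = 2 * r * (u * N) + r ^+ 2 * q by rewrite -E2 /d; ring.
  have -> : r ^+ 2 * q = d ^+ 2 + 2 * N * d - 2 * r * (u * N) by rewrite E4; ring.
  by field; rewrite gt_eqF.
have iN : 0 <= (2 * N)^-1 <= 2^-1.
  rewrite invr_ge0 mulr_ge0 ?(ltW N0)//= lef_pV2 ?posrE ?mulr_gt0//; lra.
have rd0 : 0 <= r * dl by rewrite mulr_ge0.
have d2 : d ^+ 2 <= (r * dl) ^+ 2.
  by rewrite -real_normK ?num_real// lerXn2r ?nnegrE.
have q2 : r ^+ 2 * q <= (r * dl) ^+ 2.
  by rewrite exprMn ler_wpM2l ?exprn_ge0.
have q20 : 0 <= r ^+ 2 * q by rewrite mulr_ge0 ?exprn_ge0.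
have dd0 := sqr_ge0 d.
have a1 : `|d - r * u| <= (r * dl) ^+ 2 / 2.
  rewrite {1}E3 addrC addKr normrM; have /andP[i0 i1] := iN.
  rewrite (ger0_norm i0); apply: ler_pM => //.
  rewrite ler_norml; apply/andP; split; lra.
have a2 : `|d + r * u| <= 2 * (r * dl).
  apply: (le_trans (ler_normD _ _)); rewrite normrM (ger0_norm r0).
  have := ler_wpM2l r0 nd; lra.
rewrite (_ : d - r * u - _ = ((r * u) ^+ 2 - d ^+ 2) / (2 * N)); last first.
  by rewrite {1}E3; field; rewrite gt_eqF.
have /andP[i0 i1] := iN.
rewrite normrM (ger0_norm i0) distrC subr_sqr normrM.
have := ler_pM (mulr_ge0 (normr_ge0 _) (normr_ge0 _)) i0
   (ler_pM (normr_ge0 _) (normr_ge0 _) a1 a2) i1.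
have : 0 <= (r * dl) ^+ 3 by rewrite exprn_ge0.
lra.
Qed.

End smoothed_norm.

(** * One small noise step from a fixed state *)

Section noise_step.
Context {R : realType} (m : nat) (K I : finType) (j : nat) (s : R).
Hypothesis s0 : 0 <= s.
Local Notation RR := (measurableTypeR R).
Local Notation tI := (#|I|.-tuple RR).
Local Notation gI := (@gtup R #|I|).
Let p : R := 2^-1 ^+ j.

Lemma measurable_NN d (T : measurableType d) (x : 'I_m -> T -> R) :
  (forall a, measurable_fun [set: T] (x a)) ->
  measurable_fun [set: T] (fun t => NN (fun a => x a t)).
Proof.
move=> mx; apply: (measurableT_comp (continuous_measurable_fun (@sqrt_continuous R))).
apply: measurable_funD => //; apply: measurable_sum => a; exact: measurable_funX.
Qed.

Lemma measurable_rsqrt d (T : measurableType d) (f : T -> R) :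
  measurable_fun [set: T] f -> measurable_fun [set: T] (fun t => rsqrt j (f t)).
Proof.
move=> mf; elim: j => [//|i ih].
exact: (measurableT_comp (continuous_measurable_fun (@sqrt_continuous R))).
Qed.

Section fixed_state.
Variables (x : K -> 'I_m -> R) (w : K -> R) (cD : K -> 'I_m -> I -> R) (cy : K -> I -> R).

(** First-order effect of the noise coordinate [i] on the smoothed norm; [cL] is the corresponding
    effect on the exponent. *)
Definition cn k (i : I) : R := \sum_a x k a / NN (x k) * cD k a i.
Definition cL k (i : I) : R := - s * (cn k i + cy k i).

Definition vexp (r : R) k (xi : #|I|.-tuple R) : R :=
  - s * (NN (fun a => x k a + r * lin (cD k a) xi) - NN (x k) + r * lin (cy k) xi).

(** Factor by which a noise [r xi] multiplies the p-th power of the sum, when [w] are the normalized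
    weights at the current state. *)
Definition phi (r : R) (xi : #|I|.-tuple R) : R :=
  rsqrt j (\sum_k w k * expR (vexp r k xi)).

(** Coefficient of r^2 in the mean of [phi]: second derivative of the norm, half the squared
    first-order term, and the correction from the concave outer power. *)
Definition drift : R :=
  p * \sum_k w k * (- s * ((\sum_a \sum_i cD k a i ^+ 2 - \sum_i cn k i ^+ 2) / (2 * NN (x k)))
      + (\sum_i cL k i ^+ 2) / 2)
  - p * (1 - p) / 2 * \sum_i (\sum_k w k * cL k i) ^+ 2.

Definition qexp k (xi : #|I|.-tuple R) : R :=
  - s * ((\sum_a lin (cD k a) xi ^+ 2 - lin (cn k) xi ^+ 2) / (2 * NN (x k))).

Definition Qexp (xi : #|I|.-tuple R) (r : R) : R :=
  r * (p * \sum_k w k * lin (cL k) xi) +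
  r ^+ 2 * (p * \sum_k w k * (qexp k xi + lin (cL k) xi ^+ 2 / 2) -
    p * (1 - p) / 2 * (\sum_k w k * lin (cL k) xi) ^+ 2).

Lemma lin_sum (A : finType) (b : A -> R) (c : A -> I -> R) xi :
  \sum_a b a * lin (c a) xi = lin (fun i => \sum_a b a * c a i) xi.
Proof.
rewrite /lin; under eq_bigr do rewrite mulr_sumr.
rewrite exchange_big; apply: eq_bigr => i _; rewrite mulr_suml.
by apply: eq_bigr => a _; rewrite mulrA.
Qed.

(** The term linear in [r] is a centred linear form, and the mean of the square of a linear form is
    the sum of the squares of its coefficients. *)
Lemma Ex_Qexp r : itg gI (fun xi : tI => Qexp xi r) /\
  Ex gI (fun xi : tI => Qexp xi r) = r ^+ 2 * drift.
Proof.
have i1 k : itg gI (fun xi : tI => qexp k xi) /\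
    Ex gI (fun xi : tI => qexp k xi) =
    - s * ((\sum_a \sum_i cD k a i ^+ 2 - \sum_i cn k i ^+ 2) / (2 * NN (x k))).
  have E : (fun xi : tI => qexp k xi) = (fun xi : tI => - s * ((2 * NN (x k))^-1 *
      (\sum_a lin (cD k a) xi ^+ 2 - lin (cn k) xi ^+ 2))).
    by apply/funext => xi; rewrite /qexp [_ / _]mulrC.
  have j1 : itg gI (fun xi : tI => \sum_a lin (cD k a) xi ^+ 2).
    by apply: itg_sum => a; exact: (gtupI_lin2 _).1.
  have [j2 e2] := gtupI_lin2 (cn k).
  have j3 := itgB j1 j2.
  rewrite E; split; first by do 2 apply: itgZ.
  rewrite ExZ ?ExZ//; last exact: itgZ.
  rewrite ExB// Ex_sum => [|a]; last exact: (gtupI_lin2 _).1.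
  rewrite e2; congr (_ * _); rewrite mulrC; congr ((_ - _) / _).
  by apply: eq_bigr => a _; exact: (gtupI_lin2 _).2.
pose l1 := fun xi : tI => \sum_k w k * lin (cL k) xi.
have El1 : l1 = fun xi : tI => lin (fun i => \sum_k w k * cL k i) xi.
  by apply/funext => xi; rewrite /l1 lin_sum.
pose q1 := fun xi : tI => \sum_k w k * (qexp k xi + 2^-1 * lin (cL k) xi ^+ 2).
have jq k : itg gI (fun xi : tI => qexp k xi + 2^-1 * lin (cL k) xi ^+ 2).
  by apply: itgD; [exact: (i1 k).1|apply: itgZ; exact: (gtupI_lin2 _).1].
have jq1 : itg gI q1 by apply: itg_sum => k; exact: itgZ.
have eq1 : Ex gI q1 = \sum_k w k * (- s * ((\sum_a \sum_i cD k a i ^+ 2 -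
    \sum_i cn k i ^+ 2) / (2 * NN (x k))) + (\sum_i cL k i ^+ 2) / 2).
  rewrite Ex_sum; last by move=> k; exact: itgZ.
  apply: eq_bigr => k _; rewrite ExZ// ExD; [|exact: (i1 k).1|apply: itgZ; exact: (gtupI_lin2 _).1].
  rewrite (i1 k).2 ExZ ?(gtupI_lin2 _).2; last exact: (gtupI_lin2 _).1.
  by rewrite [2^-1 * _]mulrC.
have [jl el] := gtupI_lin (fun i => \sum_k w k * cL k i).
have [jl2 el2] := gtupI_lin2 (fun i => \sum_k w k * cL k i).
have EQ : (fun xi : tI => Qexp xi r) = (fun xi : tI => r * p * l1 xi +
   (r ^+ 2 * p * q1 xi - r ^+ 2 * (p * (1 - p) / 2) * l1 xi ^+ 2)).
  apply/funext => xi; rewrite /Qexp -/(l1 xi).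
  rewrite (_ : \sum_k w k * (qexp k xi + lin (cL k) xi ^+ 2 / 2) = q1 xi); first by ring.
  by apply: eq_bigr => k _; rewrite [2^-1 * _]mulrC.
rewrite EQ El1.
have k1 := itgZ (r * p) jl; have k2 := itgZ (r ^+ 2 * p) jq1.
have k3 := itgZ (r ^+ 2 * (p * (1 - p) / 2)) jl2; have k4 := itgB k2 k3.
split; first exact: itgD.
rewrite ExD// ExB// !ExZ// el el2 eq1 /drift; ring.
Qed.

End fixed_state.

(** The constant comes before the state, which is what allows steps to be iterated. It depends only
    on the envelope exp ((1 + s) sum_i |xi_i|), whose sixth power, required by [second_order], is
    integrable. *)
Lemma noise_step : exists2 C : R, 0 <= C & forall x w cD cy,
  (forall k, 0 <= w k) -> \sum_k w k = 1 ->
  (forall k xi, \sum_a `|lin (cD k a) xi| + `|lin (cy k) xi| <= \sum_i `|co xi i|) ->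
  forall r, 0 <= r <= 1 ->
  itg gI (fun xi : tI => phi x w cD cy r xi) /\
  `|Ex gI (fun xi : tI => phi x w cD cy r xi) - 1 - r ^+ 2 * drift x w cD cy| <= C * r ^+ 3.
Proof.
pose B := 1 + s.
have B1 : 1 <= B by rewrite lerDl.
have B0 : 0 <= B := le_trans ler01 B1.
have [C C0 hC] := second_order j K B1.
pose S (xi : tI) : R := \sum_i `|co xi i|.
pose W (xi : tI) : R := expR (B * S xi).
pose W6 (xi : tI) : R := W xi ^+ 6.
have S0 xi : 0 <= S xi by rewrite sumr_ge0.
have iW6 : itg gI W6.
  rewrite (_ : W6 = fun xi : tI => expR ((6 * B) * S xi)); first exact: gtupI_expabs.
  by apply/funext => xi; rewrite /W6 /W -expRM_natl mulrA.
have e60 : 0 <= Ex gI W6 by apply: Ex_ge0 => xi; rewrite exprn_ge0 ?expR_ge0.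
exists (C * Ex gI W6) => [|x w cD cy w0 w1 hS r /andP[r0 r1]]; first exact: mulr_ge0.
have [iQ EQ] := Ex_Qexp x w cD cy r.
have pw xi : `|phi x w cD cy r xi - 1 - Qexp x w cD cy xi r| <= C * r ^+ 3 * W6 xi.
  have Sw : S xi <= W xi.
    rewrite /W; apply: (@le_trans _ _ (B * S xi)); first by rewrite ler_peMl.
    by have := expR_ge1Dx (B * S xi); lra.
  have W1 : 1 <= W xi by rewrite /W -[leLHS]expR0 ler_expR mulr_ge0.
  have cnE k : lin (cn x cD k) xi = ndot (x k) (fun a => lin (cD k a) xi).
    by rewrite /ndot lin_sum.
  have cLE k : lin (cL x cD cy k) xi =
      - s * (ndot (x k) (fun a => lin (cD k a) xi) + lin (cy k) xi).
    rewrite -cnE /lin -big_split mulr_sumr; apply: eq_bigr => i _.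
    by rewrite /cL/=; ring.
  have hD k := NN_expand (x k) (fun a => lin (cD k a) xi) r0.
  have hn k := ndot_le (x k) (fun a => lin (cD k a) xi).
  have hS' k := hS k xi.
  have D0 k : 0 <= \sum_a `|lin (cD k a) xi| by rewrite sumr_ge0.
  have y0 k : 0 <= `|lin (cy k) xi| by [].
  have bvk k : `|vexp x cD cy r k xi| <= s * (r * S xi).
    rewrite /vexp normrM normrN (ger0_norm s0) ler_wpM2l//.
    apply: (le_trans (ler_normD _ _)); rewrite normrM (ger0_norm r0).
    apply: (le_trans (lerD (hD k).1 (lexx _))); rewrite -mulrDr ler_wpM2l//.
  have sB : s <= B by rewrite lerDr.
  apply: hC => //; first by rewrite r0.
  - move=> k; apply: (le_trans (bvk k)); rewrite -mulrA; apply: ler_pM => //.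
      by rewrite mulr_ge0.
    by rewrite ler_wpM2l.
  - move=> k; rewrite ler_expR (le_trans (bvk k))//; apply: ler_pM => //.
      by rewrite mulr_ge0.
    by rewrite ler_piMl.
  - move=> k; rewrite cLE normrM normrN (ger0_norm s0); apply: ler_pM => //.
    apply: (le_trans (ler_normD _ _)); apply: le_trans Sw; apply: le_trans (hS' k).
    by rewrite lerD2r.
  - move=> k; rewrite /qexp normrM normrN (ger0_norm s0); apply: ler_pM => //.
    have N1 := NN_ge1 (x k).
    have iN : 0 <= (2 * NN (x k))^-1 <= 2^-1.
      have N0 : 0 < NN (x k) := lt_le_trans ltr01 N1.
      rewrite invr_ge0 mulr_ge0 ?(ltW N0)//= lef_pV2 ?posrE ?mulr_gt0//; lra.
    have /andP[iN0 iN1] := iN.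
    have S2 : (S xi) ^+ 2 <= W xi ^+ 2 by rewrite lerXn2r ?nnegrE ?expR_ge0.
    have b1 : \sum_a lin (cD k a) xi ^+ 2 <= S xi ^+ 2.
      apply: (le_trans (sum_sqr_le _)); rewrite lerXn2r ?nnegrE//.
      by move: (hS' k) (y0 k); rewrite -/(S xi); clear; lra.
    have b2 : lin (cn x cD k) xi ^+ 2 <= S xi ^+ 2.
      rewrite cnE -[leLHS]real_normK ?num_real// lerXn2r ?nnegrE//.
      apply: (le_trans (hn k)).
      by move: (hS' k) (y0 k); rewrite -/(S xi); clear; lra.
    have b3 : 0 <= \sum_a lin (cD k a) xi ^+ 2 by rewrite sumr_ge0// => a _; exact: sqr_ge0.
    have b4 := sqr_ge0 (lin (cn x cD k) xi).
    rewrite normrM (ger0_norm iN0).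
    have b5 : `|\sum_a lin (cD k a) xi ^+ 2 - lin (cn x cD k) xi ^+ 2| <= W xi ^+ 2.
      by rewrite ler_norml; move: b1 b2 b3 b4 S2; clear=> *; apply/andP; split; lra.
    have := ler_pM (normr_ge0 _) iN0 b5 iN1.
    by have := sqr_ge0 (W xi); clear; lra.
  - move=> k; rewrite cLE /qexp cnE /vexp.
    set N' := NN (fun a => _); set u := ndot _ _; set q := _ / _.
    rewrite (_ : _ - _ - _ = - s * (N' - NN (x k) - r * u - r ^+ 2 * q)); last by ring.
    rewrite normrM normrN (ger0_norm s0) -mulrA -exprMn.
    apply: ler_pM => //; apply: (le_trans (hD k).2).
    rewrite lerXn2r ?nnegrE ?mulr_ge0 ?expR_ge0// ler_wpM2l//.
    apply: le_trans Sw; apply: le_trans (hS' k); by rewrite lerDl.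
have mphi : measurable_fun [set: tI] (fun xi : tI => phi x w cD cy r xi).
  apply: measurable_rsqrt; apply: measurable_sum => k; apply: measurable_funM => //.
  apply: measurableT_comp => //; apply: measurable_funM => //.
  apply: measurable_funD; last first.
    by apply: measurable_funM => //; exact: measurable_linI.
  apply: measurable_funB => //; apply: measurable_NN => a.
  by apply: measurable_funD => //; apply: measurable_funM => //; exact: measurable_linI.
have iE : itg gI (fun xi : tI => phi x w cD cy r xi - 1 - Qexp x w cD cy xi r).
  apply: (@itg_le _ _ _ gI _ (fun xi => C * r ^+ 3 * W6 xi)) => //.
    by apply: measurable_funB; [exact: measurable_funB|exact: itg_meas iQ].
  exact: itgZ.
have i1Q : itg gI (fun xi : tI => 1 + Qexp x w cD cy xi r).
  by apply: itgD => //; exact: itg_cst.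
have iphi : itg gI (fun xi : tI => phi x w cD cy r xi).
  rewrite (_ : (fun xi : tI => _) = fun xi : tI =>
    (phi x w cD cy r xi - 1 - Qexp x w cD cy xi r) + (1 + Qexp x w cD cy xi r)); last first.
    by apply/funext => xi; ring.
  exact: itgD.
split => //.
have -> : Ex gI (fun xi : tI => phi x w cD cy r xi) - 1 - r ^+ 2 * drift x w cD cy =
  Ex gI (fun xi : tI => phi x w cD cy r xi - 1 - Qexp x w cD cy xi r).
  by rewrite ExB ?ExB ?Ex_cst ?EQ//; [exact: itg_cst|apply: itgB => //; exact: itg_cst].
rewrite mulrAC -ExZ//.
have jW := itgZ (C * r ^+ 3) iW6.
rewrite ler_norml; apply/andP; split.
  rewrite -[leLHS]mulN1r -ExZ//; apply: Ex_le => //; first exact: itgZ.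
  by move=> xi; have := pw xi; rewrite ler_norml => /andP[]; lra.
by apply: Ex_le => // xi; have := pw xi; rewrite ler_norml => /andP[].
Qed.

End noise_step.

(** * Gordon's comparison by noise replacement *)
Section doubling.
Context {R : realType} (NX NY : nat).
Local Notation RR := (measurableTypeR R).
Local Notation TX := (NX.-tuple RR).
Local Notation TY := (NY.-tuple RR).
Local Open Scope ereal_scope.
Variable F : NX.-tuple R -> NY.-tuple R -> \bar R.
Hypothesis mF : measurable_fun [set: TX * TY] (fun p : TX * TY => F p.1 p.2).
Hypothesis F0 : forall z e, 0 <= F z e.

Definition opX (r : R) z e := \int[gtup NX]_xi F (tadd z r xi) e.
Definition opY (r : R) z e := \int[gtup NY]_xi F z (tadd e r xi).

Lemma mF_comp d (T : measurableType d) (f : T -> TX) (g : T -> TY) :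
  measurable_fun [set: T] f -> measurable_fun [set: T] g ->
  measurable_fun [set: T] (fun t => F (f t) (g t)).
Proof.
by move=> mf mg; exact: (measurableT_comp mF (measurable_fun_pair mf mg)).
Qed.

(** By stability a noise of size r sqrt 2 is the sum of two independent noises of size r. One is
    replaced, the integrals are exchanged, then the other is replaced; each replacement costs [K],
    because the hypothesis holds at every state. *)
Lemma op_doubling (r K : R) : (0 <= K)%R ->
  (forall z e, opX r z e <= K%:E * opY r z e) ->
  forall z e, opX (r * Num.sqrt 2) z e <= (K ^+ 2)%:E * opY (r * Num.sqrt 2) z e.
Proof.
move=> K0 h z e.
have m1 : measurable_fun [set: TX * TY]
    (fun p : TX * TY => F (tadd z r p.1) (tadd e r p.2)).
  by apply: mF_comp; apply: measurable_tadd.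
rewrite /opX /opY -(gtup_stable (F := fun z => F z e)); last 2 first.
- exact: mF_comp.
- by move=> t.
rewrite -(gtup_stable (F := fun e => F z e)); last 2 first.
- exact: mF_comp.
- by move=> t.
apply: (@le_trans _ _ (\int[gtup NX]_y (K%:E * opY r (tadd z r y) e))).
  apply: ge0_le_integral => //.
  - by move=> y _; exact: integral_ge0.
  - apply: measurable_int_gtup => //; apply: mF_comp => //.
    by apply: measurable_tadd => //; apply: measurable_tadd.
  - apply: emeasurable_funM => //.
    apply: (@measurable_int_gtup R _ TX NY (fun a t => F (tadd z r a) (tadd e r t))) => //.
  - by move=> y _; exact: h.
rewrite ge0_integralZl//; last 2 first.
- by apply: (@measurable_int_gtup R _ TX NY (fun a t => F (tadd z r a) (tadd e r t))).
- by move=> y _; exact: integral_ge0.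
rewrite expr2 EFinM -muleA; apply: lee_wpmul2l => //.
rewrite (fubini_tonelli (m1 := gtup NX) (m2 := gtup NY)
  (fun p => F (tadd z r p.1) (tadd e r p.2)))//=.
rewrite -ge0_integralZl//; last 2 first.
- apply: (@measurable_int_gtup R _ TY NY (fun a t => F z (tadd (tadd e r a) r t))) => //.
  apply: mF_comp => //.
  by apply: measurable_tadd => //; apply: measurable_tadd.
- by move=> y _; exact: integral_ge0.
apply: ge0_le_integral => //.
- by move=> y _; exact: integral_ge0.
- apply: (@measurable_int_gtup R _ TY NX (fun a t => F (tadd z r t) (tadd e r a))) => //.
  by apply: mF_comp; apply: measurable_tadd.
- apply: emeasurable_funM => //.
  apply: (@measurable_int_gtup R _ TY NY (fun a t => F z (tadd (tadd e r a) r t))) => //.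
  apply: mF_comp => //.
  by apply: measurable_tadd => //; apply: measurable_tadd.
- by move=> y _; exact: h.
Qed.

Lemma op_doubling_iter (l : nat) (r K : R) : (0 <= K)%R ->
  (forall z e, opX r z e <= K%:E * opY r z e) ->
  forall z e, opX (r * Num.sqrt 2 ^+ l) z e <=
    (K ^+ (2 ^ l))%:E * opY (r * Num.sqrt 2 ^+ l) z e.
Proof.
elim: l r K => [|l ih] r K K0 h; first by rewrite expr0 mulr1 expn0 expr1.
move=> z e; rewrite exprS mulrA expnS exprM; apply: ih; first by rewrite exprn_ge0.
exact: op_doubling.
Qed.

(* The Lindeberg argument: replacing the noise step by step multiplies the
   expectation by at most (1 + C r^3)^(r^-2), with r as small as we like. *)
Lemma op_compare (C r0 : R) : (0 <= C)%R -> (0 < r0)%R ->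
  (forall r : R, (0 <= r <= r0)%R -> forall z e,
     opX r z e <= (1 + C * r ^+ 3)%:E * opY r z e) ->
  forall z e, opX 1 z e <= 2%:E * opY 1 z e.
Proof.
move=> C0 r00 h z e.
(* The second bound gives C r <= 1/2, so that the accumulated factor exp (C r) is at most 2. *)
have e0 : (0 < Num.min r0 (2 * (C + 1))^-1)%R.
  by rewrite lt_min r00 invr_gt0 mulr_gt0// ltr_wpDl.
set eps := Num.min _ _ in e0.
(* For r = 2^-k, 2 k doublings bring the noise to size 1 and raise the factor to the power 4^k =
   r^-2. *)
have [k hk] : exists k : nat, ((2 ^+ k)^-1 <= eps :> R)%R.
  exists (Num.truncn eps^-1).+1.
  rewrite -[leRHS]invrK lef_pV2 ?posrE ?exprn_gt0 ?invr_gt0//.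
  apply: (le_trans (ltW (truncnS_gt _))).
  by rewrite -natrX ler_nat; apply: ltnW; exact: ltn_expl.
have r1 : (0 <= (2 ^+ k)^-1 :> R)%R by rewrite invr_ge0 exprn_ge0.
have rr0 : (0 <= ((2 ^+ k)^-1 : R) <= r0)%R.
  by apply/andP; split => //; rewrite (le_trans hk)// ge_min lexx.
have rC : (((2 ^+ k)^-1 : R) <= (2 * (C + 1))^-1)%R by rewrite (le_trans hk)// ge_min lexx orbT.
set r : R := ((2 ^+ k)^-1)%R in r1 rr0 rC.
have K0 : (0 <= 1 + C * r ^+ 3)%R by rewrite addr_ge0// mulr_ge0// exprn_ge0.
have := op_doubling_iter (2 * k) K0 (h _ rr0) z e.
have -> : (r * Num.sqrt 2 ^+ (2 * k) = 1)%R.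
  by rewrite exprM sqr_sqrtr// /r mulVf// expf_neq0.
move=> /le_trans; apply; apply: lee_wpmul2r; first exact: integral_ge0.
rewrite lee_fin.
have r2 : ((2 ^ (2 * k))%:R * r ^+ 2 = 1 :> R)%R.
  rewrite natrX mulnC exprM /r exprVn mulfV// !expf_neq0//.
have h1 : (1 + C * r ^+ 3 <= expR (C * r ^+ 3))%R by exact: expR_ge1Dx.
apply: (@le_trans _ _ (expR (C * r ^+ 3) ^+ (2 ^ (2 * k)))%R).
  by rewrite lerXn2r ?nnegrE ?expR_ge0.
rewrite -expRM_natl (_ : _ * _ = C * r)%R; last first.
  transitivity (C * r * ((2 ^ (2 * k))%:R * r ^+ 2))%R; first by ring.
  by rewrite r2 mulr1.
have Cr : (C * r <= 2^-1)%R.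
  have C1 : (0 < C + 1)%R by rewrite ltr_wpDl.
  have := ler_wpM2l (ltW C1) rC.
  rewrite invfM mulrCA mulfV ?gt_eqF// mulr1 => h2.
  apply: le_trans h2; rewrite ler_wpM2r// lerDl//.
have := expR_ge1Dx (- (C * r)); rewrite expRN => h2.
have h3 : (2^-1 <= (expR (C * r))^-1)%R by lra.
by rewrite -[leRHS]invrK -[leLHS]invrK lef_pV2 ?posrE ?invr_gt0 ?expR_gt0.
Qed.

End doubling.

(** * Matrix noise against vector noise *)

Section gordon.
Context {R : realType} (m n j : nat) (K : finType) (s : R) (t : K -> 'I_n -> R) (k0 : K).
Hypothesis s0 : 0 <= s.
Hypothesis t1 : forall k, \sum_i t k i ^+ 2 = 1.
Local Notation RR := (measurableTypeR R).

Definition IX := ('I_m * 'I_n)%type.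
Definition IY := ('I_m + 'I_n)%type.
Let p : R := 2^-1 ^+ j.

Lemma sum_IX (F : IX -> R) : \sum_i F i = \sum_a \sum_b F (a, b).
Proof. by rewrite pair_bigA; apply: eq_bigr => -[]. Qed.

(** The state holds a matrix noise [z] and a vector noise [e = (g, h)] together, so that a partly
    replaced noise is again a state. With [z] alone this is A t_k, with [e] alone it is g. *)
Definition xk (z : #|{: IX}|.-tuple R) (e : #|{: IY}|.-tuple R) k a : R :=
  \sum_i t k i * co z ((a, i) : IX) + co e (inl a : IY).
Definition yk (e : #|{: IY}|.-tuple R) k : R := \sum_i t k i * co e (inr i : IY).
Definition wt z e k : R := expR (- s * (NN (xk z e k) + yk e k)).
Definition fG z e : R := rsqrt j (\sum_k wt z e k).

Definition cDX k (a : 'I_m) (i : IX) : R := (i.1 == a)%:R * t k i.2.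
Definition cDY (k : K) (a : 'I_m) (i : IY) : R := if i is inl b then (b == a)%:R else 0.
Definition cyY k (i : IY) : R := if i is inr b then t k b else 0.
Definition cyX (k : K) (i : IX) : R := 0.

Lemma lin_cDX k a xi : lin (cDX k a) xi = \sum_i t k i * co xi ((a, i) : IX).
Proof.
rewrite /lin /cDX.
rewrite sum_IX/=.
rewrite (bigD1 a)//= [X in _ + X]big1 ?addr0.
  by apply: eq_bigr => i _; rewrite eqxx mul1r.
by move=> b /negPf ba; rewrite big1// => i _; rewrite ba !mul0r.
Qed.

Lemma lin_cyX k xi : lin (cyX k) xi = 0.
Proof. by rewrite /lin big1// => i _; rewrite mul0r. Qed.

Lemma lin_cDY k a xi : lin (cDY k a) xi = co xi (inl a : IY).
Proof.
rewrite /lin big_sumType/= [X in _ + X]big1 => [|i _]; last by rewrite mul0r.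
rewrite addr0 (bigD1 a)//= eqxx mul1r big1 ?addr0// => b /negPf ->.
by rewrite mul0r.
Qed.

Lemma lin_cyY k xi : lin (cyY k) xi = yk xi k.
Proof.
by rewrite /lin big_sumType/= [X in X + _]big1 ?add0r// => i _; rewrite mul0r.
Qed.

Lemma t_le1 k i : `|t k i| <= 1.
Proof.
rewrite -(@ler_pXn2r _ 2) ?nnegrE// expr1n real_normK ?num_real// -(t1 k) (bigD1 i)//=.
by rewrite lerDl sumr_ge0// => b _; exact: sqr_ge0.
Qed.

Lemma noise_boundX k xi :
  \sum_a `|lin (cDX k a) xi| + `|lin (cyX k) xi| <= \sum_i `|co xi i|.
Proof.
rewrite lin_cyX normr0 addr0.
rewrite sum_IX/=.
apply: ler_sum => a _; rewrite lin_cDX; apply: (le_trans (ler_norm_sum _ _ _)).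
by apply: ler_sum => i _; rewrite normrM ler_piMl// t_le1.
Qed.

Lemma noise_boundY k xi :
  \sum_a `|lin (cDY k a) xi| + `|lin (cyY k) xi| <= \sum_i `|co xi i|.
Proof.
rewrite big_sumType/=; apply: lerD.
  by apply: ler_sum => a _; rewrite lin_cDY.
rewrite lin_cyY; apply: (le_trans (ler_norm_sum _ _ _)).
by apply: ler_sum => i _; rewrite normrM ler_piMl// t_le1.
Qed.

Lemma sum_sqr_mix (J : finType) (w : K -> R) (c : K -> J -> R) :
  \sum_i (\sum_k w k * c k i) ^+ 2 = \sum_k \sum_l w k * w l * (\sum_i c k i * c l i).
Proof.
under eq_bigr do rewrite expr2 mulr_suml.
rewrite exchange_big; apply: eq_bigr => k _.
under eq_bigr do rewrite mulr_sumr.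
rewrite exchange_big; apply: eq_bigr => l _; rewrite mulr_sumr.
by apply: eq_bigr => i _; ring.
Qed.

Section drift.
Variables (x : K -> 'I_m -> R) (w : K -> R).
Hypotheses (w0 : forall k, 0 <= w k) (w1 : \sum_k w k = 1).
Let nn k l := \sum_a x k a / NN (x k) * (x l a / NN (x l)).
Let tt k l := \sum_i t k i * t l i.

Lemma dot_le1 (J : finType) (a b : J -> R) :
  \sum_i a i ^+ 2 <= 1 -> \sum_i b i ^+ 2 <= 1 -> `|\sum_i a i * b i| <= 1.
Proof.
move=> ha hb.
have h (u : R) : u ^+ 2 = 1 -> u * \sum_i a i * b i <= 1.
  move=> u1; apply: (@le_trans _ _ (\sum_i (a i ^+ 2 + b i ^+ 2) / 2)).
    rewrite mulr_sumr; apply: ler_sum => i _.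
    by have := sqr_ge0 (u * a i - b i); rewrite sqrrB exprMn u1; lra.
  by rewrite -mulr_suml big_split/=; lra.
rewrite ler_norml; apply/andP; split.
  have := h (-1); rewrite sqrrN expr1n => /(_ erefl); lra.
have := h 1; rewrite expr1n => /(_ erefl); lra.
Qed.

Lemma nn_self k : nn k k <= 1.
Proof.
have N1 := NN_ge1 (x k); have N0 : 0 < NN (x k) := lt_le_trans ltr01 N1.
rewrite /nn (eq_bigr (fun a => x k a ^+ 2 / NN (x k) ^+ 2)); last first.
  by move=> a _; field; rewrite gt_eqF.
by rewrite -mulr_suml ler_pdivrMr ?exprn_gt0// mul1r NN_sqr lerDr.
Qed.

Lemma nn_le1 k l : `|nn k l| <= 1.
Proof.
have h i : \sum_a (x i a / NN (x i)) ^+ 2 <= 1.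
  by apply: le_trans (nn_self i); rewrite le_eqVlt; apply/orP; left; apply/eqP;
    apply: eq_bigr => a _; rewrite expr2.
exact: dot_le1.
Qed.

Lemma tt_le1 k l : `|tt k l| <= 1.
Proof. by apply: dot_le1; rewrite t1. Qed.

Lemma tt_self k : tt k k = 1.
Proof. by rewrite -[RHS](t1 k); apply: eq_bigr => i _; rewrite expr2. Qed.

Lemma cnX k a i : cn x cDX k ((a, i) : IX) = x k a / NN (x k) * t k i.
Proof.
rewrite /cn /cDX/= (bigD1 a)//= eqxx mul1r big1 ?addr0// => b /negPf ba.
by rewrite eq_sym ba mul0r mulr0.
Qed.

Lemma cnYl k a : cn x cDY k (inl a : IY) = x k a / NN (x k).
Proof.
rewrite /cn /cDY/= (bigD1 a)//= eqxx mulr1 big1 ?addr0// => b /negPf ba.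
by rewrite eq_sym ba mulr0.
Qed.

Lemma cnYr k i : cn x cDY k (inr i : IY) = 0.
Proof. by rewrite /cn big1// => a _; rewrite mulr0. Qed.

(** Matrix noise couples k and l through the product of the two inner products, vector noise
    ([dotY]) through their sum; the comparison rests on this difference. *)
Lemma dotX k l : \sum_i cL s x cDX cyX k i * cL s x cDX cyX l i = s ^+ 2 * (nn k l * tt k l).
Proof.
rewrite sum_IX/=.
rewrite /nn mulr_suml mulr_sumr; apply: eq_bigr => a _.
rewrite /tt !mulr_sumr; apply: eq_bigr => i _.
by rewrite /cL !cnX /cyX; ring.
Qed.

Lemma dotY k l : \sum_i cL s x cDY cyY k i * cL s x cDY cyY l i = s ^+ 2 * (nn k l + tt k l).
Proof.
rewrite big_sumType/= mulrDr /nn /tt !mulr_sumr; congr (_ + _); apply: eq_bigr => a _.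
  by rewrite /cL !cnYl /cyY; ring.
by rewrite /cL !cnYr /cyY; ring.
Qed.

Lemma cnX2 k : \sum_i cn x cDX k i ^+ 2 = nn k k.
Proof.
rewrite sum_IX/= /nn.
apply: eq_bigr => a _.
under eq_bigr do rewrite cnX exprMn.
by rewrite -mulr_sumr t1 mulr1 expr2.
Qed.

Lemma cnY2 k : \sum_i cn x cDY k i ^+ 2 = nn k k.
Proof.
rewrite big_sumType/= [X in _ + X]big1 ?addr0 => [|i _]; last by rewrite cnYr expr0n.
by apply: eq_bigr => a _; rewrite cnYl expr2.
Qed.

Lemma cDX2 k : \sum_a \sum_i cDX k a i ^+ 2 = m%:R.
Proof.
rewrite (eq_bigr (fun=> 1)) ?sumr_const ?card_ord// => a _.
rewrite sum_IX/=.
rewrite (bigD1 a)//= [X in _ + X]big1 ?addr0.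
  by rewrite -[RHS](t1 k); apply: eq_bigr => i _; rewrite /cDX eqxx mul1r.
by move=> b /negPf ba; rewrite big1// => i _; rewrite /cDX/= ba mul0r expr0n.
Qed.

Lemma cDY2 k : \sum_a \sum_i cDY k a i ^+ 2 = m%:R.
Proof.
rewrite (eq_bigr (fun=> 1)) ?sumr_const ?card_ord// => a _.
rewrite big_sumType/= [X in _ + X]big1 ?addr0 => [|i _]; last by rewrite expr0n.
rewrite (bigD1 a)//= eqxx expr1n big1 ?addr0// => b /negPf ->.
by rewrite expr0n.
Qed.

Let p0 : 0 <= p. Proof. by rewrite exprn_ge0. Qed.
Let p1 : p <= 1. Proof. by rewrite exprn_ile1//; lra. Qed.

Lemma sum_ww : \sum_k \sum_l w k * w l = 1.
Proof. by under eq_bigr do rewrite -mulr_sumr w1 mulr1. Qed.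

(* The sign condition of Gordon's comparison: (1 - n.n')(1 - t.t') >= 0. *)
Lemma drift_le : drift j s x w cDX cyX <= drift j s x w cDY cyY.
Proof.
rewrite /drift -/p !sum_sqr_mix; have hp0 := p0; have hp1 := p1.
have pp : 0 <= p * (1 - p) / 2 by rewrite divr_ge0// mulr_ge0//; lra.
under eq_bigr do rewrite cDX2 cnX2.
under [in leRHS]eq_bigr do rewrite cDY2 cnY2.
have H : \sum_k \sum_l w k * w l * (\sum_i cL s x cDY cyY k i * cL s x cDY cyY l i) -
  \sum_k \sum_l w k * w l * (\sum_i cL s x cDX cyX k i * cL s x cDX cyX l i) <= s ^+ 2.
  rewrite -[leRHS]mulr1 -[X in _ * X]sum_ww -sumrB mulr_sumr; apply: ler_sum => k _.
  rewrite -sumrB mulr_sumr; apply: ler_sum => l _.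
  rewrite dotX dotY.
  have ww : 0 <= s ^+ 2 * (w k * w l) by rewrite mulr_ge0 ?sqr_ge0// mulr_ge0.
  have h : nn k l + tt k l - nn k l * tt k l <= 1.
    have := nn_le1 k l; have := tt_le1 k l; rewrite !ler_norml => /andP[_ a1] /andP[_ a2].
    have : 0 <= (1 - nn k l) * (1 - tt k l) by rewrite mulr_ge0//; lra.
    lra.
  have := ler_wpM2l ww h; lra.
have L2 (c : IX -> R) : \sum_i c i ^+ 2 = \sum_i c i * c i by apply: eq_bigr.
have L2' (c : IY -> R) : \sum_i c i ^+ 2 = \sum_i c i * c i by apply: eq_bigr.
(* As |t_k| = 1, the diagonal covariances are s^2 nn for the matrix and s^2 (nn + 1) for the
   vectors, a surplus of s^2 / 2. Weighted by [p], it covers the loss p (1 - p) / 2 * s^2 that [H]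
   allows. *)
have E : \sum_k w k * (- s * ((m%:R - nn k k) / (2 * NN (x k))) +
      (\sum_i cL s x cDY cyY k i ^+ 2) / 2) =
   \sum_k w k * (- s * ((m%:R - nn k k) / (2 * NN (x k))) +
      (\sum_i cL s x cDX cyX k i ^+ 2) / 2) + s ^+ 2 / 2.
  rewrite [X in _ + X](_ : _ = \sum_k w k * (s ^+ 2 / 2)); last first.
    by rewrite -mulr_suml w1 mul1r.
  rewrite -big_split/=; apply: eq_bigr => k _.
  rewrite L2 L2' dotX dotY tt_self.
  have Nk : NN (x k) != 0 by rewrite gt_eqF// (lt_le_trans ltr01 (NN_ge1 _)).
  by field; rewrite ?Nk.
rewrite E; move: H; set S1 := \sum_k _ ; set S2 := \sum_k _; set S3 := \sum_k _ => H.
have := ler_wpM2l pp H.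
have s2 := sqr_ge0 s.
have : p * (1 - p) / 2 * s ^+ 2 <= p * s ^+ 2 / 2.
  have : p * (1 - p) <= p by rewrite ler_piMr//; lra.
  by move=> /(ler_wpM2r s2); lra.
lra.
Qed.

(** A bound free of the state: it keeps the mean factor of a short vector step above 1/2, so that an
    additive comparison becomes a multiplicative one. *)
Lemma driftY_ge : - (s * m%:R + s ^+ 2) <= drift j s x w cDY cyY.
Proof.
rewrite /drift -/p !sum_sqr_mix; have hp0 := p0; have hp1 := p1.
have pp : 0 <= p * (1 - p) / 2 <= 2^-1.
  apply/andP; split; first by rewrite divr_ge0// mulr_ge0//; lra.
  have : p * (1 - p) <= p by rewrite ler_piMr//; lra.
  lra.
under eq_bigr do rewrite cDY2 cnY2.
have H1 : - (s * m%:R) <= \sum_k w k * (- s * ((m%:R - nn k k) / (2 * NN (x k))) +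
      (\sum_i cL s x cDY cyY k i ^+ 2) / 2).
  rewrite -[leLHS]mul1r -[X in X * _]w1 mulr_suml; apply: ler_sum => k _; apply: ler_wpM2l => //.
  have sq : 0 <= \sum_i cL s x cDY cyY k i ^+ 2 by rewrite sumr_ge0// => i _; exact: sqr_ge0.
  have N1 := NN_ge1 (x k); have N0 : 0 < NN (x k) := lt_le_trans ltr01 N1.
  have nk : 0 <= nn k k by rewrite sumr_ge0// => a _; rewrite -expr2 sqr_ge0.
  have : (m%:R - nn k k) / (2 * NN (x k)) <= m%:R.
    rewrite ler_pdivrMr ?mulr_gt0//.
    have m0 : 0 <= m%:R :> R by [].
    by have := ler_wpM2l m0 N1; lra.
  move=> /(ler_wpM2l s0); lra.
have H2 : \sum_k \sum_l w k * w l * (\sum_i cL s x cDY cyY k i * cL s x cDY cyY l i) <= 2 * s ^+ 2.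
  rewrite -[leRHS]mulr1 -[X in _ * X]sum_ww mulr_sumr; apply: ler_sum => k _.
  rewrite mulr_sumr; apply: ler_sum => l _; rewrite dotY.
  have ww : 0 <= s ^+ 2 * (w k * w l) by rewrite mulr_ge0 ?sqr_ge0// mulr_ge0.
  have h : nn k l + tt k l <= 2.
    have := nn_le1 k l; have := tt_le1 k l; rewrite !ler_norml => /andP[_ a1] /andP[_ a2].
    lra.
  have := ler_wpM2l ww h; lra.
suff A (S1 S2 : R) : - (s * m%:R) <= S1 -> S2 <= 2 * s ^+ 2 ->
    - (s * m%:R + s ^+ 2) <= p * S1 - p * (1 - p) / 2 * S2 by exact: A H1 H2.
move=> {}H1 {}H2; have m0 : 0 <= s * m%:R by rewrite mulr_ge0.
have /andP[pp0 pp1] := pp; have s2 := sqr_ge0 s.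
have h1 : - (s * m%:R) <= p * S1.
  by apply: le_trans (ler_wpM2l hp0 H1); rewrite mulrN lerN2 ler_piMl.
have h2 : p * (1 - p) / 2 * S2 <= s ^+ 2.
  have := ler_wpM2l pp0 H2; have := ler_wpM2r s2 pp1; lra.
lra.
Qed.

End drift.
End gordon.

(** * From drifts to a comparison of expectations *)

Section gordon_compare.
Context {R : realType} (m n j : nat) (K : finType) (s : R) (t : K -> 'I_n -> R) (k0 : K).
Hypothesis s0 : 0 <= s.
Hypothesis t1 : forall k, \sum_i t k i ^+ 2 = 1.
Local Notation RR := (measurableTypeR R).
Local Notation IX := (IX m n).
Local Notation IY := (IY m n).
Local Notation TX := (#|{: IX}|.-tuple RR).
Local Notation TY := (#|{: IY}|.-tuple RR).
Local Notation fG := (@fG R m n j K s t).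
Local Notation wt := (@wt R m n K s t).
Local Notation xk := (@xk R m n K t).
Local Notation yk := (@yk R m n K t).

Definition Zs (z : #|{: IX}|.-tuple R) (e : #|{: IY}|.-tuple R) : R := \sum_k wt z e k.

Lemma wt_gt0 (z : #|{: IX}|.-tuple R) (e : #|{: IY}|.-tuple R) k : 0 < wt z e k.
Proof. exact: expR_gt0. Qed.

Lemma Zs_gt0 (z : #|{: IX}|.-tuple R) (e : #|{: IY}|.-tuple R) : 0 < Zs z e.
Proof.
rewrite /Zs (bigD1 k0)//= ltr_pwDl ?wt_gt0// sumr_ge0// => k _; exact/ltW/wt_gt0.
Qed.

Lemma co_tadd (I : finType) (z : #|I|.-tuple R) r xi i : co (tadd z r xi) i = co z i + r * co xi i.
Proof. by rewrite /co tnth_tadd. Qed.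

Lemma lin_tadd (I J : finType) (c : J -> R) (g : J -> I) (z : #|I|.-tuple R) r xi :
  \sum_i c i * co (tadd z r xi) (g i) =
  \sum_i c i * co z (g i) + r * \sum_i c i * co xi (g i).
Proof.
rewrite mulr_sumr -big_split/=; apply: eq_bigr => i _; rewrite co_tadd; ring.
Qed.

(** Taking the old value out of the power leaves a mean under the Gibbs weights [wt / Zs], the form
    that [noise_step] expects. *)
Lemma fG_ratio (z z' : #|{: IX}|.-tuple R) (e e' : #|{: IY}|.-tuple R) (v : K -> R) :
  (forall k, wt z' e' k = wt z e k * expR (v k)) ->
  fG z' e' = fG z e * rsqrt j (\sum_k (wt z e k / Zs z e) * expR (v k)).
Proof.
move=> h; rewrite /fG -rsqrtM ?(ltW (Zs_gt0 _ _))//; congr rsqrt.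
rewrite -/(Zs z e) mulr_sumr; apply: eq_bigr => k _; rewrite h.
by field; rewrite gt_eqF// Zs_gt0.
Qed.

Lemma fG_stepX z e r xi : fG (tadd z r xi) e =
  fG z e * phi j s (xk z e) (fun k => wt z e k / Zs z e) (cDX t) (@cyX R m n K) r xi.
Proof.
apply: fG_ratio => k; rewrite /wt -expRD; congr expR; rewrite /vexp lin_cyX.
rewrite (_ : (fun a => _ + r * lin (cDX t k a) xi) = xk (tadd z r xi) e k); first by ring.
by apply/funext => a; rewrite lin_cDX /xk lin_tadd; ring.
Qed.

Lemma fG_stepY z e r xi : fG z (tadd e r xi) =
  fG z e * phi j s (xk z e) (fun k => wt z e k / Zs z e) (@cDY R m n K) (cyY t) r xi.
Proof.
apply: fG_ratio => k; rewrite /wt -expRD; congr expR; rewrite /vexp lin_cyY.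
rewrite (_ : (fun a => _ + r * lin (cDY k a) xi) = xk z (tadd e r xi) k).
  have -> : yk (tadd e r xi) k = yk e k + r * yk xi k.
    exact: (lin_tadd _ (fun i => inr i : IY)).
  by ring.
by apply/funext => a; rewrite lin_cDY /xk co_tadd; ring.
Qed.

Lemma rsqrt_gt0 (i : nat) (x : R) : 0 < x -> 0 < rsqrt i x.
Proof. by move=> x0; elim: i => [//|i ih]; rewrite /rsqrt iterS sqrtr_gt0. Qed.

Lemma fG_gt0 z e : 0 < fG z e.
Proof. exact: rsqrt_gt0 (Zs_gt0 z e). Qed.

Lemma measurable_fG : measurable_fun [set: TX * TY] (fun q : TX * TY => (fG q.1 q.2)%:E).
Proof.
have mz (i : IX) : measurable_fun [set: TX * TY] (fun q : TX * TY => co q.1 i).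
  exact: (measurableT_comp (measurable_co i) measurable_fst).
have me (i : IY) : measurable_fun [set: TX * TY] (fun q : TX * TY => co q.2 i).
  exact: (measurableT_comp (measurable_co i) measurable_snd).
apply/measurable_EFinP; apply: measurable_rsqrt; apply: measurable_sum => k.
apply: measurableT_comp => //; apply: measurable_funM => //; apply: measurable_funD.
  apply: measurable_NN => a; apply: measurable_funD => //.
  by apply: measurable_sum => i; apply: measurable_funM.
by apply: measurable_sum => i; apply: measurable_funM.
Qed.

(** By [drift_le] the mean factors satisfy EX <= EY + (CX + CY) r^3, and EY >= 1/2 turns this into
    EX <= (1 + 2 (CX + CY) r^3) EY. The radius [c^-1] is what ensures EY >= 1/2. *)
Lemma gordon_step : exists2 C : R, 0 <= C & exists2 r0 : R, 0 < r0 &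
  forall r : R, 0 <= r <= r0 -> forall z e,
  (opX (fun z e => (fG z e)%:E) r z e <=
   (1 + C * r ^+ 3)%:E * opY (fun z e => (fG z e)%:E) r z e)%E.
Proof.
have [CX CX0 hX] := @noise_step R m K {: IX} j s s0.
have [CY CY0 hY] := @noise_step R m K {: IY} j s s0.
pose B := s * m%:R + s ^+ 2.
have B0 : 0 <= B by rewrite addr_ge0 ?sqr_ge0// mulr_ge0.
pose c := 2 * (B + CY + 1).
have c0 : 0 < c by rewrite mulr_gt0// ltr_wpDl// addr_ge0.
exists (2 * (CX + CY)); first by rewrite mulr_ge0// addr_ge0.
exists (Num.min 1 c^-1) => [|r /andP[r0]]; first by rewrite lt_min ltr01 invr_gt0.
rewrite le_min => /andP[r1 rc] z e.
pose w k := wt z e k / Zs z e.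
have w0 k : 0 <= w k by rewrite divr_ge0// ltW ?wt_gt0 ?Zs_gt0.
have w1 : \sum_k w k = 1 by rewrite -mulr_suml mulfV// gt_eqF// Zs_gt0.
have r01 : 0 <= r <= 1 by rewrite r0.
have [iX eX] := hX (xk z e) w (cDX t) (@cyX R m n K) w0 w1 (noise_boundX t1) r r01.
have [iY eY] := hY (xk z e) w (@cDY R m n K) (cyY t) w0 w1 (noise_boundY t1) r r01.
have dle : drift j s (xk z e) w (cDX t) (@cyX R m n K) <=
    drift j s (xk z e) w (@cDY R m n K) (cyY t) by apply: drift_le.
have dge : - B <= drift j s (xk z e) w (@cDY R m n K) (cyY t) by apply: driftY_ge.
rewrite /opX /opY.
under eq_integral do rewrite fG_stepX EFinM.
under [in leRHS]eq_integral do rewrite fG_stepY EFinM.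
have f0 := ltW (fG_gt0 z e).
rewrite integralZl//.
rewrite integralZl//.
rewrite -(ExE iX) -(ExE iY) muleCA; apply: lee_wpmul2l => //.
rewrite -EFinM lee_fin.
move: dle dge eX eY; set dX := drift _ _ _ _ _ _; set dY := drift _ _ _ _ _ _ => dle dge.
set EX := Ex _ _; set EY := Ex _ _.
rewrite !ler_norml => /andP[_ a1] /andP[a2 _].
move: dX dY EX EY {iX iY f0} dle dge a1 a2 => dX dY EX EY dle dge a1 a2.
clear hX hY w0 w1 w r01.
have r2 : 0 <= r ^+ 2 by exact: sqr_ge0.
have r3 : 0 <= r ^+ 3 by rewrite exprn_ge0.
have r21 : r ^+ 2 <= r by rewrite expr2 ler_piMl.
have r31 : r ^+ 3 <= r by rewrite exprS ler_piMr// (le_trans r21).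
have b1 : r ^+ 2 * dX <= r ^+ 2 * dY by rewrite ler_wpM2l.
have b2 : - (r * B) <= r ^+ 2 * dY.
  apply: le_trans (ler_wpM2l r2 dge); rewrite mulrN lerN2 ler_wpM2r//.
have b3 : CY * r ^+ 3 <= r * CY by rewrite mulrC ler_wpM2r.
have b4 : r * (B + CY + 1) <= 2^-1.
  have := ler_wpM2r (ltW c0) rc; rewrite mulVf ?gt_eqF// /c; lra.
have EY2 : 2^-1 <= EY by lra.
have : 0 <= (CX + CY) * r ^+ 3 * (2 * EY - 1).
  by rewrite mulr_ge0//; [rewrite mulr_ge0// addr_ge0|lra].
lra.
Qed.

Lemma gordon_compare z e :
  (opX (fun z e => (fG z e)%:E) 1 z e <= 2%:E * opY (fun z e => (fG z e)%:E) 1 z e)%E.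
Proof.
have [C C0 [r0 r00 h]] := gordon_step.
apply: op_compare h z e => //; first exact: measurable_fG.
by move=> z e; rewrite lee_fin ltW// fG_gt0.
Qed.

End gordon_compare.

(** * Probability that some net point has a small image *)

Section gordon_bound.
Context {R : realType} (m n : nat) (K : finType) (t : K -> 'I_n -> R) (k0 : K).
Hypothesis t1 : forall k, \sum_i t k i ^+ 2 = 1.
Local Notation gam := (@normal_prob R 0 1).
Local Notation RR := (measurableTypeR R).
Local Notation IX := (IX m n).
Local Notation IY := (IY m n).
Local Notation TX := (#|{: IX}|.-tuple RR).
Local Notation TY := (#|{: IY}|.-tuple RR).

Definition small_image : set TX :=
  [set xi | exists k, \sum_a (\sum_i t k i * co xi ((a, i) : IX)) ^+ 2 < 1].

Lemma measurable_small_image : measurable small_image.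
Proof.
rewrite (_ : small_image = \bigcup_(k in [set: K])
    [set xi | \sum_a (\sum_i t k i * co xi ((a, i) : IX)) ^+ 2 < 1]).
  apply: fin_bigcup_measurable => // k _.
  rewrite -[X in measurable X]setTI.
  have mq : measurable_fun [set: TX]
      (fun xi : TX => \sum_a (\sum_i t k i * co xi ((a, i) : IX)) ^+ 2 : R).
    apply: measurable_sum => a; apply: measurable_funX; apply: measurable_sum => i.
    by apply: measurable_funM => //; exact: measurable_co.
  rewrite [X in setT `&` X](_ : _ = (fun xi : TX => \sum_a (\sum_i t k i *
    co xi ((a, i) : IX)) ^+ 2 : R) @^-1` `]-oo, 1%R[%classic).
    exact: mq.
  by apply/seteqP; split => xi /=; rewrite in_itv.
by apply/seteqP; split=> xi [k]; [move=> h; exists k|move=> _ h; exists k].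
Qed.

(** [sg] is the rate sigma, [b] the level at which |g| is split, [lam] the Chernoff parameter below
    that level; [c0] and [Fe] bound the width by a sum over coordinates. *)
Variables (sg lam b c0 : R) (Fe : R -> R).
Hypotheses (sg0 : 0 <= sg) (lam0 : 0 <= lam) (b0 : 0 <= b).
Hypothesis iFe : itg gam (fun x : R => expR (Fe x)).
Hypothesis hFe : forall (h : 'I_n -> R) k, - sg * \sum_i t k i * h i <= c0 + \sum_i Fe (h i).

(** As #|K| <= 2^#|K| = 1 / p <= exp (1 / p), the p-th power of the number of terms is at most e.
    [s] is set so that p s = sg. *)
Let j := #|K|.
Let p : R := 2^-1 ^+ j.
Let s : R := sg / p.

Let z0 N : N.-tuple R := [tuple 0 | i < N].

Let p_gt0 : 0 < p. Proof. by rewrite exprn_gt0. Qed.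
Let s0 : 0 <= s. Proof. by rewrite divr_ge0// ltW. Qed.
Let ps : p * s = sg. Proof. by rewrite /s mulrC divfK// gt_eqF. Qed.

Lemma co_z0 (I : finType) (i : I) : co (z0 #|I|) i = 0.
Proof. by rewrite /co tnth_mktuple. Qed.

Lemma co_shift0 (I : finType) (xi : #|I|.-tuple R) i : co (tadd (z0 #|I|) 1 xi) i = co xi i.
Proof. by rewrite co_tadd co_z0 add0r mul1r. Qed.

(** A net point with |A t_k| < 1 has smoothed norm at most 2, and its term alone contributes exp (-
    2 sg). *)
Lemma fG_lower (xi : TX) : small_image xi ->
  expR (- (2 * sg)) <= fG j s t (tadd (z0 _) 1 xi) (z0 #|{: IY}|).
Proof.
move=> [k hk].
apply: (@le_trans _ _ (rsqrt j (wt s t (tadd (z0 _) 1 xi) (z0 #|{: IY}|) k))); last first.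
  by apply: rsqrt_le; rewrite (bigD1 k)//= lerDl sumr_ge0// => l _; exact: expR_ge0.
rewrite /wt rsqrt_expR ler_expR -/p mulrA mulrN ps.
have -> : yk t (z0 #|{: IY}|) k = 0.
  by rewrite /yk big1// => i _; rewrite co_z0 mulr0.
rewrite addr0 mulNr lerN2 mulrC ler_wpM2r//.
rewrite -(@ler_pXn2r _ 2) ?nnegrE ?(le_trans ler01 (NN_ge1 _))// NN_sqr.
apply: (@le_trans _ _ (1 + 1)); last by lra.
rewrite lerD2l; apply: le_trans (ltW hk); rewrite le_eqVlt; apply/orP; left; apply/eqP.
apply: eq_bigr => a _; congr (_ ^+ 2); rewrite /xk co_z0 addr0.
by apply: eq_bigr => i _; rewrite co_shift0.
Qed.

(** The first factor bounds exp (- sg |g|), with |g| smoothed: by exp (- sg b) above the level [b],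
    and by exp (lam (b^2 - |g|^2)) >= 1 below it. Everything is a sum of products over coordinates,
    so expectations factor. *)
Definition Ybound (xi : #|{: IY}|.-tuple R) : R :=
  (expR (- (sg * b)) + expR (lam * b ^+ 2) *
     \prod_(a < m) expR (- lam * co xi (inl a : IY) ^+ 2)) *
  (expR c0 * \prod_(i < n) expR (Fe (co xi (inr i : IY)))).

Lemma fG_upper (xi : TY) :
  fG j s t (z0 #|{: IX}|) (tadd (z0 _) 1 xi) <= expR 1 * Ybound xi.
Proof.
set e := tadd _ _ _.
pose G := NN (fun a : 'I_m => co xi (inl a : IY)).
have xkE k : NN (xk t (z0 #|{: IX}|) e k) = G.
  congr NN; apply/funext => a; rewrite /xk big1 ?add0r ?co_shift0// => i _.
  by rewrite co_z0 mulr0.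
have ykE k : yk t e k = \sum_i t k i * co xi (inr i : IY).
  by apply: eq_bigr => i _; rewrite co_shift0.
pose U := c0 + \sum_i Fe (co xi (inr i : IY)).
have wle k : wt s t (z0 _) e k <= expR (- s * G + U / p).
  rewrite /wt ler_expR xkE ykE mulrDr lerD2l.
  rewrite ler_pdivlMr// mulrAC mulNr [s * p]mulrC ps.
  exact: (hFe (fun i => co xi (inr i : IY))).
have jK : #|K|%:R <= expR (p^-1) :> R.
  apply: (@le_trans _ _ p^-1).
    by rewrite /p exprVn invrK -natrX ler_nat; apply: ltnW; exact: ltn_expl.
  by have := expR_ge1Dx p^-1; lra.
apply: (@le_trans _ _ (rsqrt j (expR (p^-1 + (- s * G + U / p))))).
  apply: rsqrt_le; apply: (@le_trans _ _ (\sum_(k : K) expR (- s * G + U / p))).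
    by apply: ler_sum => k _; exact: wle.
  by rewrite sumr_const -mulr_natl [leRHS]expRD ler_wpM2r ?expR_ge0.
rewrite rsqrt_expR -/p !mulrDr mulfV ?gt_eqF// expRD ler_wpM2l ?expR_ge0//.
rewrite mulrA mulrN ps mulrCA mulfV ?gt_eqF// mulr1 expRD /Ybound.
apply: ler_pM; rewrite ?expR_ge0//; last by rewrite /U expRD expR_sum.
have [bG|Gb] := leP b G.
  apply: (@le_trans _ _ (expR (- (sg * b)))).
    by rewrite ler_expR mulNr lerN2 ler_wpM2l.
  by rewrite lerDl mulr_ge0 ?expR_ge0// prodr_ge0// => a _; exact: expR_ge0.
apply: (@le_trans _ _ 1).
  by rewrite -expR0 ler_expR mulNr oppr_le0 mulr_ge0// (le_trans ler01 (NN_ge1 _)).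
rewrite -expR_sum -expRD -[leLHS]add0r lerD ?expR_ge0// -expR0 ler_expR.
rewrite -mulr_sumr mulNr -mulrBr mulr_ge0// subr_ge0.
have : G ^+ 2 <= b ^+ 2 by rewrite lerXn2r ?nnegrE ?(ltW Gb)// (le_trans ler01 (NN_ge1 _)).
rewrite NN_sqr; lra.
Qed.

Lemma gtupI_prodY (phi : R -> R) (psi : R -> R) :
  itg gam phi -> itg gam psi -> (forall x, 0 <= phi x) -> (forall x, 0 <= psi x) ->
  let H (xi : TY) := \prod_(a < m) phi (co xi (inl a : IY)) *
    \prod_(i < n) psi (co xi (inr i : IY)) in
  itg (gtup #|{: IY}|) H /\ Ex (gtup #|{: IY}|) H = Ex gam phi ^+ m * Ex gam psi ^+ n.
Proof.
move=> iphi ipsi phi0 psi0 H.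
pose f (i : IY) : R -> R := if i is inl _ then phi else psi.
have [] := @gtupI_prod R {: IY} f.
- by case.
- by case.
rewrite (_ : (fun x => _) = H); last first.
  by apply/funext => xi; rewrite /H big_sumType.
by rewrite big_sumType/= !prodr_const !card_ord.
Qed.

Lemma Ex_Ybound :
  let M1 := Ex gam (fun x : R => expR (- lam * x ^+ 2)) in
  let M2 := Ex gam (fun x : R => expR (Fe x)) in
  itg (gtup #|{: IY}|) (fun xi : TY => Ybound xi) /\
  Ex (gtup #|{: IY}|) (fun xi : TY => Ybound xi) =
    expR c0 * (expR (- (sg * b)) + expR (lam * b ^+ 2) * M1 ^+ m) * M2 ^+ n.
Proof.
move=> M1 M2.
have i1 : itg gam (fun x : R => expR (- lam * x ^+ 2)).
  by apply: (gauss_exp_sqr _).1; apply: (@le_lt_trans _ _ 0); rewrite ?oppr_le0// invr_gt0.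
have [j1 e1] := gtupI_prodY i1 iFe (fun x => expR_ge0 _) (fun x => expR_ge0 _).
have [j2 e2] := gtupI_prodY (itg_cst gam 1) iFe (fun x => ler01) (fun x => expR_ge0 _).
rewrite (_ : (fun xi : TY => Ybound xi) = (fun xi : TY =>
  expR c0 * expR (- (sg * b)) * (\prod_(a < m) 1 * \prod_(i < n) expR (Fe (co xi (inr i : IY)))) +
  expR c0 * expR (lam * b ^+ 2) * (\prod_(a < m) expR (- lam * co xi (inl a : IY) ^+ 2) *
    \prod_(i < n) expR (Fe (co xi (inr i : IY)))))); last first.
  apply/funext => xi; have P1 : \prod_(a < m) 1 = 1 :> R by rewrite big1.
  by rewrite /Ybound P1; ring.
have k1 := itgZ (expR c0 * expR (- (sg * b))) j2.
have k2 := itgZ (expR c0 * expR (lam * b ^+ 2)) j1.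
split; first exact: itgD.
have E2 := ExZ (expR c0 * expR (- (sg * b))) j2.
have E1 := ExZ (expR c0 * expR (lam * b ^+ 2)) j1.
rewrite e2 Ex_cst expr1n mul1r in E2; rewrite e1 in E1.
by rewrite ExD// [X in X + _]E2 [X in _ + X]E1 -/M1 -/M2; ring.
Qed.

(** Markov's inequality between [fG_lower] and [fG_upper]: the 2 comes from the comparison, [expR 1]
    from the size of the net, [expR (2 * sg)] from the threshold 1. *)
Lemma gordon_bound :
  (gtup #|{: IX}| small_image <=
   (2 * expR 1 * expR (2 * sg) * (expR c0 *
     (expR (- (sg * b)) + expR (lam * b ^+ 2) *
       Ex gam (fun x : R => expR (- lam * x ^+ 2)) ^+ m) *
     Ex gam (fun x : R => expR (Fe x)) ^+ n))%:E)%E.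
Proof.
set M1 := Ex gam _; set M2 := Ex gam _.
have [iY eY] := Ex_Ybound.
have mB := measurable_small_image.
have gc := @gordon_compare R m n j K s t k0 s0 t1 (z0 #|{: IX}|) (z0 #|{: IY}|).
have mf := @measurable_fG R m n j K s t.
have f0 := @fG_gt0 R m n j K s t k0.
have mX : measurable_fun [set: TX] (fun xi : TX => (fG j s t (tadd (z0 _) 1 xi) (z0 #|{: IY}|))%:E).
  by apply: (@mF_comp R _ _ (fun z e => (fG j s t z e)%:E) mf _ _
    (fun xi => tadd (z0 _) 1 xi)) => //; apply: measurable_tadd.
have mY : measurable_fun [set: TY] (fun xi : TY => (fG j s t (z0 #|{: IX}|) (tadd (z0 _) 1 xi))%:E).
  by apply: (@mF_comp R _ _ (fun z e => (fG j s t z e)%:E) mf _ _ (fun=> z0 _)) => //;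
    apply: measurable_tadd.
have lo : ((expR (- (2 * sg)))%:E * gtup #|{: IX}| small_image <=
    opX (fun z e => (fG j s t z e)%:E) 1 (z0 #|{: IX}|) (z0 #|{: IY}|))%E.
  have -> : gtup #|{: IX}| small_image = (\int[gtup #|{: IX}|]_x (\1_small_image x)%:E)%E.
    by rewrite integral_indic// setIT.
  have mi : measurable_fun [set: TX] (fun x : TX => (\1_small_image x)%:E : \bar R).
    by apply/measurable_EFinP; exact: measurable_indic.
  rewrite -ge0_integralZl//.
  apply: ge0_le_integral => //.
  - by apply: emeasurable_funM => //.
  - move=> xi _; rewrite indicE -EFinM lee_fin.
    have [/set_mem h|h] := boolP (xi \in small_image).
      by rewrite mulr1; exact: fG_lower.
    by rewrite mulr0 ltW.
have up : (opY (fun z e => (fG j s t z e)%:E) 1 (z0 #|{: IX}|) (z0 #|{: IY}|) <=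
    (expR 1 * Ex (gtup #|{: IY}|) (fun xi : TY => Ybound xi))%:E)%E.
  rewrite -ExZ// ExE; last exact: itgZ.
  apply: ge0_le_integral => //.
  - by move=> xi _; rewrite lee_fin ltW.
  - by apply/measurable_EFinP; exact: (itg_meas (itgZ (expR 1) iY)).
  - by move=> xi _; rewrite lee_fin; exact: fG_upper.
have fB : gtup #|{: IX}| small_image \is a fin_num by exact: fin_num_measure.
have two0 : (0 <= 2%:E :> \bar R)%E by rewrite lee_fin.
have := le_trans lo (le_trans gc (lee_wpmul2l two0 up)).
rewrite -(fineK fB) eY -!EFinM !lee_fin; set u := fine _ => h.
have := ler_wpM2l (expR_ge0 (2 * sg)) h.
rewrite mulrA -expRD addrN expR0 mul1r => /le_trans; apply.
by rewrite le_eqVlt; apply/orP; left; apply/eqP; rewrite -/M1 -/M2; ring.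
Qed.

End gordon_bound.

(** * The Gaussian width of the bad directions *)
Section absq_theory.
Context {R : realType} (q : R).
Hypothesis q01 : 0 <= q <= 1.

Lemma absq_ge0 (w : R) : 0 <= absq q w.
Proof. by rewrite /absq; case: ifP => // _; exact: powR_ge0. Qed.

Lemma absq_le (w : R) : absq q w <= 1 + `|w|.
Proof.
have /andP[q0 q1] := q01; rewrite /absq; case: ifPn => [_|w0]; first by rewrite addr_ge0.
have w0' : 0 < `|w| by rewrite normr_gt0.
have [w1|w1] := leP 1 `|w|.
  by apply: (le_trans (ler1_powR w1 q1)); rewrite lerDr.
have : `|w| `^ q <= 1 by rewrite -(powRr0 `|w|) ger_powR// w0' ltW.
by move=> /le_trans; apply; rewrite lerDl.
Qed.

Lemma absqN (w : R) : absq q (- w) = absq q w.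
Proof. by rewrite /absq oppr_eq0 normrN. Qed.

Lemma absq_norm (w : R) : absq q `|w| = absq q w.
Proof. by rewrite /absq normr_eq0 normr_id. Qed.

Lemma absqM (a w : R) : 0 < a -> absq q (a * w) = a `^ q * absq q w.
Proof.
move=> a0; rewrite /absq mulf_eq0 (gt_eqF a0)/=; case: ifP => _; first by rewrite mulr0.
by rewrite normrM (gtr0_norm a0) powRM// ltW.
Qed.

Lemma absq_homo (v w : R) : `|v| <= `|w| -> absq q v <= absq q w.
Proof.
have /andP[q0 q1] := q01; move=> vw; rewrite /absq.
case: (eqVneq v 0) => [_|v0]; first by case: ifP => // _; exact: powR_ge0.
have [w0|w0] := eqVneq w 0.
  by move: vw; rewrite w0 normr0 normr_le0 (negPf v0).
by apply: ge0_ler_powR; rewrite ?nnegrE.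
Qed.

Lemma absq_subadd (v w : R) : absq q (v + w) <= absq q v + absq q w.
Proof.
have /andP[q0 q1] := q01.
have [->|v0] := eqVneq v 0; first by rewrite add0r lerDr absq_ge0.
have [->|w0] := eqVneq w 0; first by rewrite addr0 lerDl absq_ge0.
apply: (@le_trans _ _ (absq q (`|v| + `|w|))).
  by apply: absq_homo; rewrite [leRHS]ger0_norm ?addr_ge0// ler_normD.
have a0 : 0 < `|v| by rewrite normr_gt0.
have b0 : 0 < `|w| by rewrite normr_gt0.
have ab0 : 0 < `|v| + `|w| by rewrite addr_gt0.
(* x <= x^q on (0,1] applied to the ratios |v|/(|v|+|w|) and |w|/(|v|+|w|) *)
have h (x y : R) : 0 < x -> 0 < y -> x <= y -> x / y * absq q y <= absq q x.
  move=> x0 y0 xy; have r0 : 0 < x / y by rewrite divr_gt0.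
  have r1 : x / y <= 1 by rewrite ler_pdivrMr// mul1r.
  rewrite -[in leRHS](divfK (lt0r_neq0 y0) x) absqM// ler_wpM2r ?absq_ge0//.
  by apply: ger1_powR; rewrite ?r0.
have h1 := h _ _ a0 ab0 (ltac:(by rewrite lerDl) : `|v| <= `|v| + `|w|).
have h2 := h _ _ b0 ab0 (ltac:(by rewrite lerDr) : `|w| <= `|v| + `|w|).
rewrite !absq_norm in h1 h2.
apply: le_trans (lerD h1 h2); rewrite -mulrDl -mulrDl divff ?mul1r//.
by rewrite gt_eqF.
Qed.

End absq_theory.

Section wmax_theory.
Context {R : realType} (q nu gamma : R).
Hypotheses (q01 : 0 <= q <= 1) (nu0 : 0 <= nu) (g0 : 0 < gamma).
Implicit Types (s h w : R).

Definition obj s h w : R := `|h| * `|w| + s * nu * absq q w - gamma * w ^+ 2.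
Definition fw s h : R := fine (wmax q s nu gamma h).
Definition Cw : R := (1 + nu) ^+ 2 / gamma + nu.

Lemma Cw_gt0 : 0 < Cw.
Proof. by rewrite /Cw ltr_wpDr// divr_gt0// exprn_gt0// ltr_wpDr. Qed.

Lemma obj_le s h w : `|s| <= 1 -> obj s h w <= Cw * (1 + h ^+ 2).
Proof.
move=> s1; rewrite /obj.
have h1 : s * nu * absq q w <= nu * (1 + `|w|).
  rewrite mulrAC mulrC; apply: ler_wpM2l => //.
  apply: (le_trans (ler_norm _)); rewrite normrM [`|absq _ _|]ger0_norm ?absq_ge0//.
  apply: (@le_trans _ _ (1 * absq q w)); first by rewrite ler_wpM2r// absq_ge0.
  by rewrite mul1r absq_le.
have h2 : (`|h| + nu) * `|w| - gamma * w ^+ 2 <= (`|h| + nu) ^+ 2 / gamma.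
  rewrite ler_pdivlMr// -[w ^+ 2]real_normK ?num_real//.
  by have := sqr_ge0 ((`|h| + nu) - gamma * `|w|); have := sqr_ge0 (gamma * `|w|);
     have := sqr_ge0 (`|h| + nu); lra.
have h3 : (`|h| + nu) ^+ 2 <= (1 + nu) ^+ 2 * (1 + h ^+ 2).
  rewrite -[h ^+ 2]real_normK ?num_real//.
  have a0 : 0 <= `|h| by []. move: (`|h|) a0 => a a0.
  have := sqr_ge0 (a - 1); have := sqr_ge0 (a * nu); have := mulr_ge0 nu0 (sqr_ge0 (a - 1)).
  have := sqr_ge0 (1 - a * nu); have := mulr_ge0 nu0 (sqr_ge0 a); nra.
have h4 : (`|h| + nu) ^+ 2 / gamma <= (1 + nu) ^+ 2 / gamma * (1 + h ^+ 2).
  by rewrite [leRHS]mulrAC ler_pM2r ?invr_gt0.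
have h5 : nu <= nu * (1 + h ^+ 2) by rewrite ler_peMr// lerDl sqr_ge0.
rewrite /Cw mulrDl; lra.
Qed.

Lemma wmaxE s h : `|s| <= 1 -> wmax q s nu gamma h = (fw s h)%:E.
Proof.
move=> s1; rewrite /fw fineK//; apply/fin_numPlt/andP; split.
  apply: (@lt_le_trans _ _ (obj s h 0)%:E); first by rewrite ltNyr.
  by apply: ereal_sup_ubound; exists 0.
apply: (@le_lt_trans _ _ (Cw * (1 + h ^+ 2))%:E); last by rewrite ltry.
by apply: ge_ereal_sup => _ [w _ <-]; rewrite lee_fin obj_le.
Qed.

Lemma fw_ub s h w : `|s| <= 1 -> obj s h w <= fw s h.
Proof.
by move=> s1; rewrite -lee_fin -wmaxE//; apply: ereal_sup_ubound; exists w.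
Qed.

(** For q = 0, s = 1, h = 0 and nu > 0 the supremum is not attained, so comparisons go through
    near-maximizers. *)
Lemma fw_adherent s h e : `|s| <= 1 -> 0 < e -> exists w, fw s h - e < obj s h w.
Proof.
move=> s1 e0; have fin : wmax q s nu gamma h \is a fin_num by rewrite wmaxE.
have [_ [w _ <-]] := ub_ereal_sup_adherent e0 fin.
by rewrite -[ereal_sup _]/(wmax q s nu gamma h) wmaxE// -EFinB lte_fin => hw; exists w.
Qed.

Lemma obj0 s h : obj s h 0 = 0.
Proof. by rewrite /obj /absq eqxx normr0 expr0n/=; ring. Qed.

Lemma fw_ge0 s h : `|s| <= 1 -> 0 <= fw s h.
Proof. by move=> s1; rewrite -(obj0 s h) fw_ub. Qed.

Lemma fw_le s h : `|s| <= 1 -> fw s h <= Cw * (1 + h ^+ 2).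
Proof.
move=> s1; apply/ler_addgt0Pr => e e0; have [w hw] := fw_adherent h s1 e0.
by have := obj_le h w s1; lra.
Qed.

Lemma fw_homo s h h' : `|s| <= 1 -> `|h| <= `|h'| -> fw s h <= fw s h'.
Proof.
move=> s1 hh; apply/ler_addgt0Pr => e e0; have [w hw] := fw_adherent h s1 e0.
have := fw_ub h' w s1; rewrite /obj in hw *.
by have := ler_wpM2r (normr_ge0 w) hh; lra.
Qed.

Let s1 : `|1 : R| <= 1. Proof. by rewrite normr1. Qed.
Let sN1 : `|-1 : R| <= 1. Proof. by rewrite normrN1. Qed.

(** Gain of a coordinate when it enters [S], where |w|^q is rewarded instead of penalized. *)
Definition Dw h : R := fw 1 h - fw (-1) h.

Lemma Dw_ge0 h : 0 <= Dw h.
Proof.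
rewrite subr_ge0; apply/ler_addgt0Pr => e e0; have [w hw] := fw_adherent h sN1 e0.
have := fw_ub h w s1; rewrite /obj in hw *.
by have := mulr_ge0 nu0 (absq_ge0 q w); lra.
Qed.

(* Exchanging the two near-maximizers when they are in the wrong order: the
   maximizer with the reward term nu|w|^q dominates the one with the penalty. *)
Lemma Dw_homo h h' : `|h| <= `|h'| -> Dw h <= Dw h'.
Proof.
move=> hh; rewrite /Dw lerBlDr addrAC lerBrDr.
apply/ler_addgt0Pr => e e0; have e2 : 0 < e / 2 by rewrite divr_gt0.
have [w hw] := fw_adherent h s1 e2; have [v hv] := fw_adherent h' sN1 e2.
have [vw|wv] := leP `|v| `|w|.
  have h1 := fw_ub h' w s1; have h2 := fw_ub h v sN1; rewrite /obj in hw hv h1 h2.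
  have : 0 <= (`|h'| - `|h|) * (`|w| - `|v|) by rewrite mulr_ge0// subr_ge0.
  lra.
have h1 := fw_ub h' v s1; have h2 := fw_ub h w sN1; rewrite /obj in hw hv h1 h2.
have := ler_wpM2l nu0 (absq_homo q01 (ltW wv)); lra.
Qed.

(** [fw s] is a nondecreasing function of |h|; the truncation at 0 extends that function
    monotonically to the line. *)
Lemma measurable_fw s : `|s| <= 1 -> measurable_fun [set: R] (fw s).
Proof.
move=> ss; rewrite (_ : fw s = (fun x : R => fw s (Num.max x 0)) \o Num.norm).
  apply: measurableT_comp => //.
  apply: nondecreasing_measurable => // x y xy; apply: fw_homo => //.
  have m0 (u : R) : 0 <= Num.max u 0 by rewrite le_max lexx orbT.
  by rewrite (ger0_norm (m0 x)) (ger0_norm (m0 y)) ge_max !le_max xy lexx !orbT.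
apply/funext => h /=; rewrite (_ : Num.max `|h| 0 = `|h|); last first.
  by apply/max_idPl.
by apply/le_anti; rewrite !fw_homo// normr_id.
Qed.

End wmax_theory.

(** * The two integrals as means, and weak duality *)

Section str_integrals.
Context {R : realType} (q nu gamma c : R).
Hypotheses (q01 : 0 <= q <= 1) (nu0 : 0 <= nu) (g0 : 0 < gamma) (c0 : 0 <= c).
Local Notation gam := (@normal_prob R 0 1).
Local Notation mu := (@lebesgue_measure R).
Local Notation RR := (measurableTypeR R).
Local Notation fw := (fw q nu gamma).
Local Notation Dw := (Dw q nu gamma).
Local Notation Cw := (Cw nu gamma).

Let s1 : `|1 : R| <= 1. Proof. by rewrite normr1. Qed.
Let sN1 : `|-1 : R| <= 1. Proof. by rewrite normrN1. Qed.

Definition outer : set RR := [set h : R | c <= `|h|].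
Definition inner : set RR := [set h : R | `|h| <= c].

Lemma measurable_outer : measurable outer.
Proof.
rewrite /outer (_ : [set h | _] = (@Num.norm _ R) @^-1` `[c, +oo[%classic); last first.
  by apply/seteqP; split => h /=; rewrite in_itv/= andbT.
rewrite -[X in measurable X]setTI.
exact: (normr_measurable measurableT).
Qed.

Lemma measurable_inner : measurable inner.
Proof.
rewrite /inner (_ : [set h | _] = (@Num.norm _ R) @^-1` `]-oo, c]%classic); last first.
  by apply/seteqP; split => h /=; rewrite in_itv/=.
rewrite -[X in measurable X]setTI.
exact: (normr_measurable measurableT).
Qed.

Lemma itg_restrict (f : R -> R) (D : set RR) : measurable D -> itg gam f ->
  itg gam (fun h : R => f h * \1_D h).
Proof.
move=> mD If; apply: (@itg_le _ _ _ gam _ (fun h => `|f h|)).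
- apply: measurable_funM; first exact: itg_meas If.
  exact: (measurable_indic mD).
- exact: itg_norm.
- move=> x; rewrite normrM ler_piMr// indicE; case: (_ \in _); rewrite ?normr1 ?normr0//.
Qed.

Lemma normal_integral_restrict (f : R -> R) (D : set RR) : measurable D -> itg gam f ->
  (forall h, 0 <= f h) ->
  (\int[mu]_(h in D) ((normal_pdf 0 1 h)%:E * (f h)%:E) =
   (Ex gam (fun h : R => f h * \1_D h))%:E)%E.
Proof.
move=> mD If f0; have Ir := itg_restrict mD If; rewrite ExE// ge0_integral_normal.
- rewrite integral_mkcond; apply: eq_integral => h _.
  rewrite patchE indicE; case: (_ \in _); rewrite ?mulr1 ?mulr0 ?mul0e//.
  by rewrite muleC.
- by apply/measurable_EFinP; exact: itg_meas Ir.
- by move=> h; rewrite lee_fin mulr_ge0.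
Qed.

Lemma fw_itg s : `|s| <= 1 -> itg gam (fw s).
Proof.
move=> ss; apply: (gauss_itg_quad (C := Cw)); first exact: measurable_fw.
by move=> x; rewrite ger0_norm ?fw_ge0// fw_le.
Qed.

Lemma I1strE : I1str q c nu gamma = (Ex gam (fun h : R => fw 1 h * \1_outer h))%:E.
Proof.
rewrite -(normal_integral_restrict measurable_outer (fw_itg s1)); last first.
  by move=> h; exact: fw_ge0.
by apply: eq_integral => h _; rewrite wmaxE.
Qed.

Lemma I2strE : I2str q c nu gamma = (Ex gam (fun h : R => fw (-1) h * \1_inner h))%:E.
Proof.
rewrite -(normal_integral_restrict measurable_inner (fw_itg sN1)); last first.
  by move=> h; exact: fw_ge0.
by apply: eq_integral => h _; rewrite wmaxE.
Qed.

(* A decoupled upper bound for choosing the k best coordinates: the excess of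
   the gain [Dw h] over the threshold value [Dw c] is kept only when |h| >= c. *)
Definition Ft (h : R) : R := fw (-1) h + (Dw h - Dw c) * \1_outer h.

Lemma Ft_quad h : `|Ft h| <= (2 * Cw) * (1 + h ^+ 2).
Proof.
have h1 := fw_ge0 q01 nu0 g0 h sN1; have h2 := fw_le q01 nu0 g0 h sN1.
have h3 := Dw_ge0 q01 nu0 g0 c; have h4 := fw_le q01 nu0 g0 h s1.
have h5 : 0 <= Cw * (1 + h ^+ 2) := le_trans h1 h2.
rewrite /Ft indicE; have [/set_mem/= ch|_] := boolP (h \in outer).
  have h6 : Dw c <= Dw h by apply: Dw_homo => //; rewrite (ger0_norm c0).
  rewrite mulr1 ger0_norm; first by rewrite /Dw in h3 *; lra.
  by rewrite addr_ge0// subr_ge0.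
rewrite mulr0 addr0 ger0_norm//; lra.
Qed.

Lemma measurable_Ft : measurable_fun [set: R] Ft.
Proof.
apply: measurable_funD; first exact: measurable_fw.
apply: measurable_funM; last exact: (measurable_indic measurable_outer).
by apply: measurable_funB => //; apply: measurable_funB; exact: measurable_fw.
Qed.

(** [Ft] plus [Dw c] on [outer] is [fw 1] on [outer] and [fw (-1)] elsewhere, and [outer] has mass
    [beta]. Only an inequality results, because [inner] and [outer] share the points |h| = c. *)
Lemma Ft_mean (beta : R) : gam outer = beta%:E ->
  ((Ex gam Ft + beta * Dw c)%:E <= I1str q c nu gamma + I2str q c nu gamma)%E.
Proof.
move=> hb; rewrite I1strE I2strE -EFinD lee_fin.
have iF : itg gam Ft by exact: (gauss_itg_quad measurable_Ft Ft_quad).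
have i1 := itg_restrict measurable_outer (fw_itg s1).
have i2 := itg_restrict measurable_inner (fw_itg sN1).
have io : itg gam (\1_outer : R -> R).
  rewrite (_ : \1_outer = (fun h : R => 1 * \1_outer h)).
    exact: (itg_restrict measurable_outer (itg_cst gam 1)).
  by apply/funext => h; rewrite mul1r.
have eo : Ex gam (\1_outer : R -> R) = beta.
  apply: EFin_inj; rewrite ExE// integral_indic ?setIT//.
  exact: measurable_outer.
rewrite -ExD// -[X in _ + X * _]eo mulrC -ExZ// -ExD//; last exact: itgZ.
apply: Ex_le => [||h].
- by apply: itgD => //; exact: itgZ.
- exact: itgD.
rewrite /Ft !indicE.
have [ho|ho] := boolP (h \in outer).
  have := fw_ge0 q01 nu0 g0 h sN1; rewrite /Dw.
  case: (h \in inner); rewrite /= ?mulr1n ?mulr0n; lra.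
have -> : h \in inner.
  by rewrite inE /inner/= ltW// ltNge; apply: contra ho => ho; rewrite inE.
rewrite /= ?mulr1n ?mulr0n; lra.
Qed.

Section deterministic.
Variables (n k : nat) (S : {set 'I_n}) (v h : 'I_n -> R).
Hypotheses (Sk : (#|S| <= k)%N) (v2 : \sum_i v i ^+ 2 <= n%:R).
Hypothesis vS : \sum_(i in ~: S) absq q (v i) <= \sum_(i in S) absq q (v i).

(** [nu] is the multiplier of the constraint [vS], [gamma] that of [v2]. A coordinate in [S] is
    worth [fw 1 <= Ft + Dw c], one outside [fw (-1) <= Ft], both by monotonicity of [Dw]; hence [S]
    enters only through its size. *)
Lemma linear_form_bound :
  \sum_i v i * h i <= \sum_i Ft (h i) + k%:R * Dw c + gamma * n%:R.
Proof.
pose ind (i : 'I_n) : R := (i \in S)%:R.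
pose sgn (i : 'I_n) : R := if i \in S then 1 else -1.
have sgn1 i : `|sgn i| <= 1 by rewrite /sgn; case: ifP.
have A i : v i * h i <= fw (sgn i) (h i) - sgn i * nu * absq q (v i) + gamma * v i ^+ 2.
  have := fw_ub q01 nu0 g0 (h i) (v i) (sgn1 i); rewrite /obj.
  have : v i * h i <= `|h i| * `|v i|.
    by rewrite mulrC -normrM ler_norm.
  lra.
have B i : fw (sgn i) (h i) <= Ft (h i) + ind i * Dw c.
  have D0 := Dw_ge0 q01 nu0 g0 c.
  rewrite /sgn /ind /Ft indicE; case: ifP => iS.
    have [ho|ho] := boolP (h i \in outer); first by rewrite /= !mulr1n /Dw; lra.
    have : Dw (h i) <= Dw c.
      apply: Dw_homo => //; rewrite (ger0_norm c0) ltW// ltNge.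
      by apply: contra ho => ho; rewrite inE.
    by rewrite /= !mulr1n mulr0n /Dw; lra.
  have [/set_mem/= ho|ho] := boolP (h i \in outer); last by rewrite /= !mulr0n; lra.
  have : Dw c <= Dw (h i) by apply: Dw_homo => //; rewrite (ger0_norm c0).
  rewrite /= mulr1n mulr0n; lra.
have C0 : 0 <= \sum_i sgn i * nu * absq q (v i).
  rewrite (eq_bigr (fun i => nu * (sgn i * absq q (v i)))); last by move=> i _; ring.
  rewrite -mulr_sumr mulr_ge0// (bigID (mem S))/=.
  rewrite (eq_bigr (fun i => absq q (v i))); last by move=> i iS; rewrite /sgn iS mul1r.
  rewrite [X in _ + X](eq_bigr (fun i => - absq q (v i))); last first.
    by move=> i /negPf iS; rewrite /sgn iS mulN1r.
  rewrite sumrN subr_ge0; apply: le_trans vS; rewrite le_eqVlt; apply/orP; left; apply/eqP.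
  by apply: eq_bigl => i; rewrite inE.
have D : \sum_i ind i * Dw c <= k%:R * Dw c.
  rewrite -mulr_suml ler_wpM2r ?Dw_ge0//.
  rewrite /ind -natr_sum ler_nat (leq_trans _ Sk)//.
  have -> : (\sum_i (i \in S : nat) = #|S|)%N.
    by rewrite -sum1_card [RHS]big_mkcond/=; apply: eq_bigr => i _; case: (_ \in _).
  exact: leqnn.
apply: (@le_trans _ _ (\sum_i (Ft (h i) + ind i * Dw c - sgn i * nu * absq q (v i) +
    gamma * v i ^+ 2))).
  by apply: ler_sum => i _; apply: le_trans (A i) _; rewrite lerD2r lerD2r.
rewrite !big_split/= sumrN -mulr_sumr.
have := ler_wpM2l (ltW g0) v2; lra.
Qed.

End deterministic.
End str_integrals.

(** * Exclusion of gamma = 0 *)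

Section gamma0.
Context {R : realType} (q nu c beta : R).
Hypotheses (c0 : 0 < c) (b0 : 0 < beta).
Hypothesis hb : normal_prob 0 1 (outer c) = beta%:E.
Hypothesis nu0 : 0 <= nu.

Lemma wmax_ge0 (s gamma h : R) : (0 <= wmax q s nu gamma h)%E.
Proof.
apply: ereal_sup_ubound; exists 0 => //.
by rewrite /absq eqxx normr0 expr0n/= !mulr0 addr0 subr0.
Qed.

Lemma I2str_ge0 (gamma : R) : (0 <= I2str q c nu gamma)%E.
Proof.
apply: integral_ge0 => h _; rewrite mule_ge0 ?wmax_ge0// lee_fin; exact: normal_pdf_ge0.
Qed.

Lemma wmax_gamma0 (h : R) : h != 0 -> wmax q 1 nu 0 h = +oo%E.
Proof.
move=> h0; apply/eqyP => A A0.
apply: (@le_trans _ _ (`|h| * `|A / h| + 1 * nu * absq q (A / h) - 0 * (A / h) ^+ 2)%:E);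
  last by apply: ereal_sup_ubound; exists (A / h).
rewrite lee_fin mul0r subr0 normrM normfV mulrCA divff ?normr_eq0// mulr1 (gtr0_norm A0).
by rewrite lerDl mul1r mulr_ge0// /absq; case: ifP => // _; exact: powR_ge0.
Qed.

(** Without the quadratic term the objective is unbounded for h <> 0. The set |h| >= c is not
    Lebesgue null, as its normal probability is beta > 0. So the strict inequality of the theorem
    forces gamma > 0. *)
Lemma I1str_gamma0 : I1str q c nu 0 = +oo%E.
Proof.
have mO := @measurable_outer R c.
rewrite /I1str (eq_integral (cst +oo%E)).
  rewrite integral_cst//.
  rewrite gt0_mulye// lt_neqAle measure_ge0 andbT eq_sym; apply/eqP => m0.
  have := @normal_prob_dominates R 0 1 => /null_content_dominatesP /(_ _ mO m0).
  by rewrite hb => -[] b0'; move: b0; rewrite b0' ltxx.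
move=> h; rewrite inE /= => ch; rewrite wmax_gamma0.
  by rewrite gt0_muley// lte_fin normal_pdfE ?oner_eq0//
    mulr_gt0 ?normal_peak_gt0 ?oner_eq0// expR_gt0.
by rewrite -normr_gt0 (lt_le_trans c0).
Qed.

End gamma0.

(** * Bad directions, recovery and a finite net *)
Section recovery.
Context {R : realType} (q : R) (n k : nat).
Hypothesis q01 : 0 <= q <= 1.

Definition bad (u : 'I_n -> R) : Prop :=
  \sum_i u i ^+ 2 = 1 /\ exists2 S : {set 'I_n}, (#|S| <= k)%N &
    \sum_(i in ~: S) absq q (u i) <= \sum_(i in S) absq q (u i).

(** Let [x] do at least as well as [xt], v = x - xt and S the support of [xt]. Off S, v is x; on S,
    subadditivity bounds |xt|^q by |x|^q + |v|^q. Homogeneity then allows v to be normalized. Ties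
    count as failures, which gives uniqueness. *)
Lemma recovery_of_bad m (M : 'M[R]_(m, n)) :
  (forall u, bad u -> exists a, \sum_i M a i * u i != 0) -> strong_recovery q k M.
Proof.
move=> hM xt hxt x Mx xxt; rewrite ltNge; apply/negP => hle.
pose v i := x i ord0 - xt i ord0.
have Mv a : \sum_i M a i * v i = 0.
  have /matrixP/(_ a ord0) := Mx; rewrite !mxE => h.
  rewrite /v; under eq_bigr do rewrite mulrBr.
  by rewrite sumrB h subrr.
pose S : {set 'I_n} := finset.finset (fun i : 'I_n => xt i ord0 != 0).
have inS i : (i \in S) = (xt i ord0 != 0) by rewrite finset.in_set.
have Sk : (#|S| <= k)%N.
  apply: leq_trans hxt; rewrite /nnz; apply: eq_leq; apply: eq_card => i.
  by rewrite inS; apply/idP/idP => h; [rewrite inE|move: h; rewrite inE].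
have hS : \sum_(i in ~: S) absq q (v i) <= \sum_(i in S) absq q (v i).
  move: hle; rewrite /lqq (bigID (mem S))/= [X in _ <= X](bigID (mem S))/=.
  rewrite [X in _ <= _ + X]big1; last first.
    by move=> i; rewrite inS negbK => /eqP ->; rewrite /absq eqxx.
  rewrite addr0 => hle.
  have h1 : \sum_(i in S) absq q (xt i ord0) <=
      \sum_(i in S) absq q (x i ord0) + \sum_(i in S) absq q (v i).
    rewrite -big_split/=; apply: ler_sum => i _.
    have := absq_subadd q01 (x i ord0) (- v i); rewrite absqN.
    by rewrite (_ : x i ord0 + - v i = xt i ord0)// /v; ring.
  have h2 : \sum_(i in ~: S) absq q (v i) = \sum_(i | i \notin S) absq q (x i ord0).
    apply: eq_big => i; first by rewrite finset.in_setC.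
    by rewrite finset.in_setC inS negbK => /eqP xi; rewrite /v xi subr0.
  by rewrite h2; lra.
pose nv := \sum_i v i ^+ 2.
have nv0 : 0 < nv.
  rewrite lt_neqAle sumr_ge0 ?andbT => [|i _]; last exact: sqr_ge0.
  apply: contra xxt => /eqP nv0; apply/eqP/matrixP => i o.
  have /eqP := esym nv0; rewrite psumr_eq0 => [/allP/(_ i)|j _]; last exact: sqr_ge0.
  rewrite mem_index_enum sqrf_eq0 /= => /(_ isT); rewrite /v subr_eq0 => /eqP.
  by move=> h; rewrite (ord1 o) h.
pose r := (Num.sqrt nv)^-1.
have r0 : 0 < r by rewrite invr_gt0 sqrtr_gt0.
have [] := hM (fun i => r * v i).
  split.
    under eq_bigr do rewrite exprMn.
    by rewrite -mulr_sumr exprVn sqr_sqrtr ?(ltW nv0)// mulVf// gt_eqF.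
  exists S => //; under eq_bigr do rewrite absqM//; under [leRHS]eq_bigr do rewrite absqM//.
  by rewrite -!mulr_sumr ler_wpM2l// powR_ge0.
move=> a /eqP; apply; under eq_bigr do rewrite mulrCA.
by rewrite -mulr_sumr Mv mulr0.
Qed.

(** The net has to lie inside the bad set, which rounding to a grid would leave (for q = 0 it may
    change the number of nonzero entries). So each cell of side 1 / L that meets the bad set
    contributes one of its bad points. *)
Lemma bad_net (L : nat) (u0 : 'I_n -> R) : (0 < L)%N -> bad u0 ->
  exists (K : finType) (t : K -> 'I_n -> R), inhabited K /\ (forall k, bad (t k)) /\
    forall u, bad u -> exists k, forall i, `|t k i - u i| <= L%:R^-1.
Proof.
move=> L0 bu0.
have LR0 : 0 < L%:R :> R by rewrite ltr0n.
(* The coordinates lie in [-1, 1], so (u_i + 1) L has integer part between 0 and 2 L. Cells without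
   bad points get the default [u0]. *)
pose cell (u : 'I_n -> R) : {ffun 'I_n -> 'I_(L + L).+1} :=
  [ffun i => inord (Num.truncn ((u i + 1) * L%:R))].
have [t ht] : {t : {ffun 'I_n -> 'I_(L + L).+1} -> 'I_n -> R &
    forall x, bad (t x) /\ forall u, bad u -> cell u = x -> cell (t x) = x}.
  apply: (@choice _ _ (fun x tx => bad tx /\ forall u, bad u -> cell u = x -> cell tx = x)) => x.
  have [[u [bu cu]]|h] := pselect (exists u, bad u /\ cell u = x).
    by exists u; split.
  by exists u0; split=> // u bu cu; exfalso; apply: h; exists u.
exists {ffun 'I_n -> 'I_(L + L).+1}, t; split.
  by constructor; exact: (cell u0).
split => [x|u bu]; first exact: (ht x).1.
exists (cell u) => i.
have E := (ht (cell u)).2 u bu erefl; have bt := (ht (cell u)).1.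
move: (t (cell u)) E bt => w /ffunP/(_ i); rewrite !ffunE => E bw.
have bnd (y : 'I_n -> R) : bad y -> 0 <= (y i + 1) * L%:R /\
    (Num.truncn ((y i + 1) * L%:R) < (L + L).+1)%N.
  move=> [y1 _]; have : `|y i| <= 1.
    rewrite -(@ler_pXn2r _ 2) ?nnegrE// expr1n real_normK ?num_real// -y1 (bigD1 i)//=.
    by rewrite lerDl sumr_ge0// => b _; exact: sqr_ge0.
  rewrite ler_norml => /andP[a1 a2].
  have p0 : 0 <= (y i + 1) * L%:R by rewrite mulr_ge0//; lra.
  split => //; have pl := p0; rewrite -truncn_le in pl.
  rewrite ltnS -(ler_nat R) (le_trans pl)//.
  by rewrite natrD; have := ler_wpM2r (ltW LR0) a2; lra.
have [w0 wl] := bnd w bw; have [u0' ul] := bnd u bu.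
have /(congr1 val) /= := E; rewrite !inordK// => E'.
have /andP[w1 w2] := truncn_itv w0; have /andP[u1 u2] := truncn_itv u0'.
rewrite E' in w1 w2.
rewrite -(ler_pM2r LR0) mulVf ?gt_eqF// -[X in _ * X <= _](gtr0_norm LR0) -normrM.
rewrite -natr1 in w2 u2; rewrite ler_norml; apply/andP; split; lra.
Qed.

End recovery.

(** * Probability of failure *)
Section numeric.
Context {R : realType}.

(** Exponent for |g| above the level [b]. The leading terms cancel up to the gap, - e th N; [kap]
    and the e^2 term each cost at most a quarter of it, and 2 e sqrt n at most an eighth up to a
    constant. *)
Lemma exponent1 (e th rho kap N sn sm c0 eD u x : R) :
  0 < e -> 0 < th -> 0 < rho <= 1 -> 0 < kap <= 1 -> kap <= th / 4 -> 0 <= N ->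
  rho * N - rho^-1 <= sn * sm -> 2 * sn <= N * (th / 8) + (th / 8)^-1 ->
  c0 + u <= e * N * (rho - th) + eD -> x <= e * N * (th / 4) ->
  2 * (e * sn) + c0 - e * sn * ((1 - kap) * sm) + (u + x) <=
    eD + e / rho + 8 * e / th - e * th / 4 * N.
Proof.
move=> e0 th0 /andP[rho0 rho1] /andP[kap0 kap1] kapt n0 snm h5 c0le hx.
have ht : e * (2 * sn) <= e * (N * (th / 8) + (th / 8)^-1) by rewrite ler_pM2l.
have ht' : e * (th / 8)^-1 = 8 * e / th by rewrite invf_div; ring.
have k1 : 0 <= 1 - kap by rewrite subr_ge0.
have h1 := ler_wpM2l k1 snm.
have h2 : (1 - kap) * rho^-1 <= rho^-1.
  by rewrite ler_piMl ?invr_ge0 ?(ltW rho0)// lerBlDr lerDl ltW.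
have h3 : N * (kap * rho) <= N * (th / 4).
  apply: ler_wpM2l => //; rewrite -[leRHS]mulr1.
  by apply: ler_pM => //; exact: ltW.
have h4 : e * (rho * N - N * (th / 4) - rho^-1) <= e * ((1 - kap) * (sn * sm)).
  by apply: ler_wpM2l; [exact: ltW|lra].
have h8 : 0 <= e * N * th by rewrite !mulr_ge0// ltW.
clear h1 h2 h3 h5 snm kapt k1 rho0 rho1 kap0 kap1 e0 th0 n0.
lra.
Qed.

(** Exponent for |g| below [b]. The Chernoff bound gains lam kap M / 2, which does not involve [e];
    the smallness of [e] makes the positive terms negligible beside it. *)
Lemma exponent2 (al e th rho kap lam C1 N M sn c0 eD u x : R) :
  0 < al -> 0 < e -> 0 < th -> 0 < rho <= 1 -> 0 < kap <= 1 -> 0 < lam ->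
  C1 * lam <= kap / 2 -> e <= al * lam * kap / 16 -> 0 <= N -> 0 <= M ->
  al * N - 1 <= M -> 2 * sn <= N + 1 ->
  c0 + u <= e * N * (rho - th) + eD -> x <= e * N * (th / 4) ->
  2 * (e * sn) + c0 + lam * ((1 - kap) ^+ 2 * M) + M * (- lam + C1 * lam ^+ 2) + (u + x) <=
    eD + e + lam - al * lam * kap / 8 * N.
Proof.
move=> al0 e0 th0 /andP[rho0 rho1] /andP[kap0 kap1] lam0 lamC el n0 m0 hm h5 c0le hx.
have lM : 0 <= lam * M by rewrite mulr_ge0// ltW.
have k1 : 0 <= 1 - kap by rewrite subr_ge0.
have h2 : lam * M * (1 - kap) ^+ 2 <= lam * M * (1 - kap).
  by apply: ler_wpM2l => //; rewrite expr2 ler_piMr// lerBlDr lerDl ltW.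
have h3 := ler_wpM2l lM lamC.
have lk0 : 0 <= lam * kap / 2 by rewrite divr_ge0// mulr_ge0// ltW.
have h4 := ler_wpM2r lk0 hm.
have lk1 : lam * kap <= lam by rewrite ler_piMr// ltW.
have h6 : e * (2 * sn) <= e * (N + 1) by rewrite ler_pM2l.
have h8 : e * N <= al * lam * kap / 16 * N by rewrite ler_wpM2r.
have h9 : e * N * rho <= e * N by rewrite ler_piMr// mulr_ge0// ltW.
have h10 : 0 <= e * N * th by rewrite !mulr_ge0// ltW.
have h11 : 0 <= al * lam * kap * N by rewrite !mulr_ge0// ltW.
have l0 := ltW lam0; have e0' := ltW e0.
clear lk0 hm h5 lM k1 lamC el m0 n0 rho0 rho1 kap0 kap1 al0 th0 lam0 e0.
lra.
Qed.

(** The order of choice matters: [kap] from the gap [th], then [lam] from [kap], and [e] last, small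
    against both. [B] caps [lam] and [e] where the moment bounds are valid. *)
Lemma exponent_bounds (al be mean D g C1 C2 : R) :
  0 < al <= 1 -> 0 <= be -> 0 <= D -> 0 <= g -> 0 <= C1 -> 0 <= C2 ->
  mean + be * D + g < Num.sqrt al ->
  forall B : R, 0 < B ->
  exists kap lam e a Cst : R, [/\ 0 < kap <= 1, 0 < lam <= B, 0 < e <= B, 0 < a &
   forall (n m k : nat), `|m%:R - al * n%:R| < 1 -> `|k%:R - be * n%:R| < 1 -> al^-1 <= n%:R ->
    let sg := e * Num.sqrt n%:R in let b := (1 - kap) * Num.sqrt m%:R in
    let c0 := e * (k%:R * D + g * n%:R) in
    2 * sg + c0 - sg * b + n%:R * (e * mean + C2 * e ^+ 2) <= Cst - a * n%:R /\
    2 * sg + c0 + lam * b ^+ 2 + m%:R * (- lam + C1 * lam ^+ 2) +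
      n%:R * (e * mean + C2 * e ^+ 2) <= Cst - a * n%:R].
Proof.
move=> /andP[al0 al1] be0 D0 g0 C10 C20 hJ B B0.
pose rho := Num.sqrt al; rewrite -/rho in hJ.
have rho0 : 0 < rho by rewrite sqrtr_gt0.
have rho2 : rho ^+ 2 = al by rewrite sqr_sqrtr// ltW.
have rho1 : rho <= 1 by rewrite -(@ler_pXn2r _ 2) ?nnegrE ?(ltW rho0)// rho2 expr1n.
pose J := mean + be * D + g; pose th := rho - J.
have th0 : 0 < th by rewrite subr_gt0.
pose kap := Num.min 1 (th / 4).
have kap0 : 0 < kap by rewrite lt_min ltr01 divr_gt0.
have kap1 : kap <= 1 by rewrite ge_min lexx.
have kapt : kap <= th / 4 by rewrite ge_min lexx orbT.
pose lam := Num.min B (kap / (2 * (C1 + 1))).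
have C11 : 0 < C1 + 1 by rewrite ltr_wpDl.
have C21 : 0 < C2 + 1 by rewrite ltr_wpDl.
have lam0 : 0 < lam by rewrite lt_min B0 divr_gt0// mulr_gt0.
have lamB : lam <= B by rewrite ge_min lexx.
have lamC : C1 * lam <= kap / 2.
  have : lam <= kap / (2 * (C1 + 1)) by rewrite ge_min lexx orbT.
  rewrite ler_pdivlMr ?mulr_gt0//; lra.
pose e := Num.min (Num.min B (th / (4 * (C2 + 1)))) (al * lam * kap / 16).
have e0 : 0 < e by rewrite !lt_min B0 !divr_gt0 ?mulr_gt0.
have eB : e <= B by rewrite !ge_min lexx.
have eC : C2 * e <= th / 4.
  have : e <= th / (4 * (C2 + 1)) by rewrite !ge_min lexx orbT.
  rewrite ler_pdivlMr ?mulr_gt0//; lra.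
have el : e <= al * lam * kap / 16 by rewrite !ge_min lexx orbT.
pose a := Num.min (e * th / 4) (al * lam * kap / 8).
have a0 : 0 < a by rewrite lt_min !divr_gt0 ?mulr_gt0.
have a1 : a <= e * th / 4 by rewrite ge_min lexx.
have a2 : a <= al * lam * kap / 8 by rewrite ge_min lexx orbT.
(* [e * D] pays for rounding [k], [e / rho] and [lam] for rounding [m], [8 * e / th] for the
   arithmetic-geometric mean step. *)
pose Cst := e * D + e / rho + 8 * e / th + lam + 16 * e.
exists kap, lam, e, a, Cst; split => //; try by apply/andP.
move=> n m k hm hk hn sg b c0.
have n0 : 0 <= n%:R :> R by [].
have m0 : 0 <= m%:R :> R by [].
move: (n%:R : R) (m%:R : R) (k%:R : R) n0 m0 hm hk hn @sg @b @c0 => N M k' n0 m0 hm hk hn sg b c0.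
rewrite ltr_norml in hm; rewrite ltr_norml in hk.
have /andP[hm1 hm2] := hm; have /andP[hk1 hk2] := hk.
pose sn := Num.sqrt N; pose sm := Num.sqrt M.
have sn0 : 0 <= sn by exact: sqrtr_ge0.
have sm0 : 0 <= sm by exact: sqrtr_ge0.
have sn2 : sn ^+ 2 = N by rewrite sqr_sqrtr.
have sm2 : sm ^+ 2 = M by rewrite sqr_sqrtr.
have i0 : 0 < rho^-1 by rewrite invr_gt0.
have ir : rho * rho^-1 = 1 by rewrite mulfV// gt_eqF.
(* After squaring this compares rho^2 N^2 - 2 N + rho^-2 with N (al N - 1), which is where n >= 1 /
   alpha enters. *)
have snm : rho * N - rho^-1 <= sn * sm.
  have nn0 : 0 <= sn * sm by rewrite mulr_ge0.
  have [h|h] := leP (rho * N - rho^-1) 0; first exact: le_trans h nn0.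
  rewrite -(@ler_pXn2r _ 2) ?nnegrE ?(ltW h)// exprMn sn2 sm2.
  have hn' : rho^-1 ^+ 2 <= N by rewrite exprVn rho2.
  have : N * (al * N - 1) <= N * M by rewrite ler_wpM2l//; lra.
  rewrite -rho2; have -> : (rho * N - rho^-1) ^+ 2 =
    rho ^+ 2 * N ^+ 2 - 2 * (rho * rho^-1) * N + rho^-1 ^+ 2 by ring.
  by rewrite ir; move: hn'; clear; lra.
have amgm d : 0 < d -> 2 * sn <= N * d + d^-1.
  move=> d0; have := sqr_ge0 (sn * d - 1) => h.
  rewrite -(ler_pM2r d0) [leRHS]mulrDl mulVf ?gt_eqF// -sn2; move: h; clear; lra.
have eN0 : 0 <= e * N by rewrite mulr_ge0// ltW.
have c0le : c0 <= e * (be * D + g) * N + e * D.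
  have : k' * D <= (be * N + 1) * D by rewrite ler_wpM2r//; lra.
  by move=> /(ler_wpM2l (ltW e0)); rewrite /c0; clear; lra.
have eC2 : N * (C2 * e ^+ 2) <= e * N * (th / 4).
  by have := ler_wpM2l eN0 eC; clear; lra.
have fin1 : 0 <= e * D by rewrite mulr_ge0// ltW.
have fin2 : 0 <= e / rho by rewrite mulr_ge0// ltW.
have fin3 : 0 <= 8 * e / th by rewrite divr_ge0 ?mulr_ge0// ltW.
have JE : e * (be * D + g) * N + N * (e * mean) = e * N * (rho - th).
  by rewrite /th /J; ring.
have c0u : c0 + N * (e * mean) <= e * N * (rho - th) + e * D.
  by move: c0le JE; clear; lra.
have aN1 : a * N <= e * th / 4 * N by rewrite ler_wpM2r.
have aN2 : a * N <= al * lam * kap / 8 * N by rewrite ler_wpM2r.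
have th8 : 0 < th / 8 by rewrite divr_gt0.
have rho01 : 0 < rho <= 1 by apply/andP.
have kap01 : 0 < kap <= 1 by apply/andP.
have e16 := ltW e0; have l0 := ltW lam0.
have h1 := exponent1 e0 th0 rho01 kap01 kapt n0 snm (amgm _ th8) c0u eC2.
have h5 := amgm 1 ltr01; rewrite invr1 mulr1 in h5.
have hm' : al * N - 1 <= M by move: hm1; clear; lra.
have h2 := exponent2 al0 e0 th0 rho01 kap01 lam0 lamC el n0 m0 hm' h5 c0u eC2.
have bE : b ^+ 2 = (1 - kap) ^+ 2 * M by rewrite /b -/sm exprMn sm2.
rewrite bE mulrDr /sg /b -/sn -/sm /Cst.
move: h1 h2 aN1 aN2 fin1 fin2 fin3 e16 l0; clear => h1 h2 aN1 aN2 f1 f2 f3 e16 l0.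
by split; lra.
Qed.

End numeric.

Section bad_prob.
Context {R : realType} (q alpha beta c nu gamma : R).
Hypotheses (q01 : 0 <= q <= 1) (al01 : 0 < alpha <= 1) (be0 : 0 <= beta) (c0 : 0 <= c).
Hypotheses (nu0 : 0 <= nu) (g0 : 0 < gamma).
Local Notation gam := (@normal_prob R 0 1).
Hypothesis hbeta : gam (outer c) = beta%:E.
Hypothesis hI : (I1str q c nu gamma + I2str q c nu gamma + gamma%:E < (Num.sqrt alpha)%:E)%E.
Local Notation F := (Ft q nu gamma c).
Local Notation D := (Dw q nu gamma c).

Lemma mean_gap : Ex gam F + beta * D + gamma < Num.sqrt alpha.
Proof.
rewrite -lte_fin; apply: le_lt_trans hI; rewrite EFinD leeD2r//.
exact: Ft_mean.
Qed.

Lemma bad_unit n k (u : 'I_n -> R) : bad q k u -> \sum_i u i ^+ 2 = 1.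
Proof. by case. Qed.

(** The vector v = - sqrt n u has squared length n, the scale at which [gamma] is charged once per
    coordinate; the bad condition survives by homogeneity and symmetry of [absq]. *)
Lemma bad_width n k (u h : 'I_n -> R) (e : R) : 0 < e -> (0 < n)%N -> bad q k u ->
  - (e * Num.sqrt n%:R) * \sum_i u i * h i <=
  e * (k%:R * D + gamma * n%:R) + \sum_i e * F (h i).
Proof.
move=> e0 n0 [u1 [S Sk hS]].
have sn0 : 0 < Num.sqrt n%:R :> R by rewrite sqrtr_gt0 ltr0n.
pose v i := Num.sqrt n%:R * - u i.
have v2 : \sum_i v i ^+ 2 <= n%:R.
  rewrite (eq_bigr (fun i => Num.sqrt n%:R ^+ 2 * u i ^+ 2)).
    by rewrite -mulr_sumr u1 mulr1 sqr_sqrtr.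
  by move=> i _; rewrite /v exprMn sqrrN.
have vS : \sum_(i in ~: S) absq q (v i) <= \sum_(i in S) absq q (v i).
  rewrite /v; under eq_bigr do rewrite absqM// absqN.
  under [leRHS]eq_bigr do rewrite absqM// absqN.
  by rewrite -!mulr_sumr ler_wpM2l// powR_ge0.
have := linear_form_bound q01 nu0 g0 c0 h Sk v2 vS.
move=> /(ler_wpM2l (ltW e0)).
rewrite (_ : e * \sum_i v i * h i = - (e * Num.sqrt n%:R) * \sum_i u i * h i); last first.
  by rewrite !mulr_sumr; apply: eq_bigr => i _; rewrite /v; ring.
by rewrite -mulr_sumr; lra.
Qed.

Lemma bad_prob : exists a Cst : R, 0 < a /\ 0 <= Cst /\
  forall (n m k : nat), `|m%:R - alpha * n%:R| < 1 -> `|k%:R - beta * n%:R| < 1 ->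
    alpha^-1 <= n%:R ->
  forall (K : finType) (t : K -> 'I_n -> R), K -> (forall x, bad q k (t x)) ->
  (gtup #|{: IX m n}| (small_image (m := m) t) <= (Cst * expR (- (a * n%:R)))%:E)%E.
Proof.
have mX2 : measurable_fun [set: R] (fun x : R => - x ^+ 2).
  by apply: measurableT_comp => //; exact: measurable_funX.
have [C1 [C10 hC1]] := @gauss_mgf_quad R (fun x => - x ^+ 2) 1 ltr01 mX2
  (fun x => ltac:(by rewrite normrN ger0_norm ?sqr_ge0// mul1r lerDr)).
have CF0 : 0 < 2 * Cw nu gamma by rewrite mulr_gt0// Cw_gt0.
have mF : measurable_fun [set: R] F by exact: measurable_Ft.
have qF h : `|F h| <= (2 * Cw nu gamma) * (1 + h ^+ 2) by exact: Ft_quad.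
have [C2 [C20 hC2]] := gauss_mgf_quad CF0 mF qF.
(* Both uses of [gauss_mgf_quad] ask for parameter times growth constant at most 1/8: the constant
   is 1 for - x^2 and 2 Cw for [Ft]. *)
pose B := Num.min 8^-1 (8^-1 / (2 * Cw nu gamma)).
have B0 : 0 < B by rewrite lt_min invr_gt0 divr_gt0 ?invr_gt0 ?andbT.
have D0 : 0 <= D by exact: Dw_ge0.
have [kap [lam [e [a [Cst [kap01 lam0B e0B a0 hE]]]]]] :=
  exponent_bounds al01 be0 D0 (ltW g0) C10 C20 mean_gap B0.
(* The 4 is the 2 of [gordon_bound] times the two cases for |g|. *)
exists a, (4 * expR 1 * expR Cst); split=> //; split.
  by rewrite !mulr_ge0 ?expR_ge0.
move=> n m k hm hk hn K t k0 bt.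
have /andP[al0 al1] := al01.
have /andP[kap0 kap1] := kap01; have /andP[lam0 lamB] := lam0B; have /andP[e0 eB] := e0B.
have n0 : (0 < n)%N by rewrite -(ltr_nat R) (lt_le_trans _ hn)// invr_gt0.
have e18 : e * (2 * Cw nu gamma) <= 8^-1.
  by rewrite -ler_pdivlMr// (le_trans eB)// ge_min lexx orbT.
have l18 : lam * 1 <= 8^-1 by rewrite mulr1 (le_trans lamB)// ge_min lexx.
have [i1 h1] := hC1 lam (ltW lam0) l18.
have [i2 h2] := hC2 e (ltW e0) e18.
have eX2 : Ex gam (fun x : R => - x ^+ 2) = -1.
  have [j1 j2] := @gauss_var R.
  rewrite (_ : (fun x : R => - x ^+ 2) = (fun x : R => -1 * x ^+ 2)).
    by rewrite (ExZ (-1) j1) j2 mulr1.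
  by apply/funext => x; rewrite mulN1r.
rewrite eX2 mulrN1 in h1.
have M1E : (fun x : R => expR (- lam * x ^+ 2)) = (fun x : R => expR (lam * - x ^+ 2)).
  by apply/funext => x; rewrite mulNr mulrN.
have sg0 : 0 <= e * Num.sqrt n%:R by rewrite mulr_ge0// ltW.
have b0 : 0 <= (1 - kap) * Num.sqrt m%:R by rewrite mulr_ge0// subr_ge0.
have := @gordon_bound R m n K t k0 (fun x => bad_unit (bt x)) _ lam _
  (e * (k%:R * D + gamma * n%:R)) (fun x => e * F x) sg0 (ltW lam0) b0 i2
  (fun h x => bad_width h e0 n0 (bt x)).
move=> /le_trans; apply; rewrite lee_fin M1E.
have [] := hE n m k hm hk hn.
set sg := e * Num.sqrt n%:R; set b := (1 - kap) * Num.sqrt m%:R; set cc := e * _.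
set M1 := Ex gam _ in h1 *; set M2 := Ex gam _ in h2 *; set mn := Ex gam F in h2 *.
move=> x1 x2.
have M10 : 0 <= M1 by apply: Ex_ge0 => x; exact: expR_ge0.
have M20 : 0 <= M2 by apply: Ex_ge0 => x; exact: expR_ge0.
have hM1 : M1 ^+ m <= expR (m%:R * (- lam + C1 * lam ^+ 2)).
  by rewrite expRM_natl lerXn2r ?nnegrE ?expR_ge0.
have hM2 : M2 ^+ n <= expR (n%:R * (e * mn + C2 * e ^+ 2)).
  by rewrite expRM_natl lerXn2r ?nnegrE ?expR_ge0.
set y1 := m%:R * _ in x2 hM1; set y2 := n%:R * _ in x1 x2 hM2.
have p1 : expR (2 * sg) * (expR cc * (expR (- (sg * b)) + expR (lam * b ^+ 2) * M1 ^+ m) * M2 ^+ n)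
   <= expR (Cst - a * n%:R) + expR (Cst - a * n%:R).
  apply: (@le_trans _ _ (expR (2 * sg) * (expR cc * (expR (- (sg * b)) +
      expR (lam * b ^+ 2) * expR y1) * expR y2))).
    apply: ler_wpM2l; first exact: expR_ge0.
    apply: ler_pM => //.
    - by rewrite mulr_ge0 ?expR_ge0// addr_ge0 ?expR_ge0// mulr_ge0 ?expR_ge0 ?exprn_ge0.
    - by rewrite exprn_ge0.
    - by rewrite ler_wpM2l ?expR_ge0// lerD2l ler_wpM2l ?expR_ge0.
  have -> : expR (2 * sg) * (expR cc *
      (expR (- (sg * b)) + expR (lam * b ^+ 2) * expR y1) * expR y2) =
     expR (2 * sg + cc - sg * b + y2) + expR (2 * sg + cc + lam * b ^+ 2 + y1 + y2).
    by rewrite !expRD; ring.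
  by apply: lerD; rewrite ler_expR.
rewrite -[leLHS]mulrA -[leRHS]mulrA -expRD.
have e1 : 0 <= 2 * expR 1 :> R by rewrite mulr_ge0 ?expR_ge0.
apply: (le_trans (ler_wpM2l e1 p1)).
by rewrite le_eqVlt; apply/orP; left; apply/eqP; ring.
Qed.

End bad_prob.

(** * The law of the random matrix *)

Section gauss_law.
Context {R : realType} d (T : measurableType d) (P : probability T R) (m n : nat).
Variable A : 'I_m -> 'I_n -> T -> R.
Hypothesis iidA : gauss_iid P A.
Local Notation gam := (@normal_prob R 0 1).
Local Notation RR := (measurableTypeR R).
Local Notation IX := (IX m n).
Local Notation TX := (#|{: IX}|.-tuple RR).

Definition entries (w : T) : TX :=
  [tuple (A (enum_val i).1 (enum_val i).2 w : RR) | i < #|{: IX}|].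

Lemma co_entries w i l : co (entries w) ((i, l) : IX) = A i l w.
Proof. by rewrite /co /entries tnth_mktuple enum_rankK. Qed.

Lemma measurable_entries : measurable_fun [set: T] entries.
Proof.
have [mA _] := iidA.
apply/measurable_fun_tnthP => i.
rewrite (_ : _ \o _ = A (enum_val i).1 (enum_val i).2); first exact: mA.
by apply/funext => w /=; rewrite tnth_mktuple.
Qed.

HB.instance Definition _ := isMeasurableFun.Build _ _ _ _ entries measurable_entries.

Lemma entries_law (B : set TX) : measurable B ->
  P (entries @^-1` B) = gtup #|{: IX}| B.
Proof.
have [mA [lawA indA]] := iidA.
move=> mB; apply: (@ipow_unique R _ RR gam _ (distribution P entries)) => // C mC.
rewrite /distribution /pushforward.
pose C' i l := C (enum_rank ((i, l) : IX)).
transitivity (P [set w | forall i l, C' i l (A i l w)]).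
  congr (P _); apply/seteqP; split => w /= h.
    by move=> i l; have := h (enum_rank ((i, l) : IX)); rewrite tnth_mktuple enum_rankK.
  by move=> k; rewrite tnth_mktuple; have := h (enum_val k).1 (enum_val k).2;
    rewrite /C' -surjective_pairing enum_valK.
rewrite indA; last by move=> i l; exact: mC.
rewrite pair_bigA/= (reindex_onto (@enum_val {: IX} {: IX}) enum_rank)/=; last first.
  by move=> i _; exact: enum_rankK.
apply: eq_big => [k|k _]; first by rewrite enum_valK eqxx.
by rewrite lawA; [rewrite /C' -surjective_pairing enum_valK|exact: mC].
Qed.

End gauss_law.

(** * Markov bound for the entries *)

Section large_entries.
Context {R : realType} (I : finType).
Local Notation RR := (measurableTypeR R).
Local Notation tI := (#|I|.-tuple RR).

Definition large_entries (L : R) : set tI := [set xi | L <= \sum_i `|co xi i|].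

Lemma measurable_sum_norm : measurable_fun [set: tI] (fun xi : tI => \sum_i `|co xi i| : R).
Proof.
apply: measurable_sum => i; apply: measurableT_comp => //; exact: measurable_co.
Qed.

Lemma measurable_large_entries L : measurable (large_entries L).
Proof.
rewrite -[X in measurable X]setTI.
rewrite (_ : large_entries L = (fun xi : tI => \sum_i `|co xi i| : R) @^-1` `[L, +oo[%classic).
  exact: measurable_sum_norm.
by apply/seteqP; split => xi /=; rewrite in_itv/= andbT.
Qed.

(** Markov's inequality through |x| <= (1 + x^2) / 2, whose right side has mean one. *)
Lemma large_entries_prob (L : R) : 0 < L ->
  (gtup #|I| (large_entries L) <= (#|I|%:R / L)%:E)%E.
Proof.
move=> L0.
have ico i : itg (gtup #|I|) (fun xi : tI => 1 + co xi i ^+ 2) /\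
    Ex (gtup #|I|) (fun xi : tI => 1 + co xi i ^+ 2) = 2.
  pose c (l : I) : R := (l == i)%:R.
  have cE (xi : tI) : lin c xi = co xi i.
    by rewrite /lin (bigD1 i)//= big1 => [|l /negPf li]; rewrite /c ?eqxx ?li ?mul1r ?mul0r ?addr0.
  have [i2 e2] := gtupI_lin2 c.
  have E : (fun xi : tI => lin c xi ^+ 2) = (fun xi : tI => co xi i ^+ 2).
    by apply/funext => xi; rewrite cE.
  rewrite E in i2 e2; split; first by apply: itgD => //; exact: itg_cst.
  rewrite ExD//; last exact: itg_cst.
  rewrite Ex_cst e2 (bigD1 i)//= big1 => [|l /negPf li].
    by rewrite /c eqxx expr1n addr0.
  by rewrite /c li expr0n.
pose S (xi : tI) : R := \sum_i 2^-1 * (1 + co xi i ^+ 2).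
have iS : itg (gtup #|I|) S.
  by apply: itg_sum => i; apply: itgZ; exact: (ico i).1.
have eS : Ex (gtup #|I|) S = #|I|%:R.
  rewrite Ex_sum => [|i]; last by apply: itgZ; exact: (ico i).1.
  rewrite (eq_bigr (fun=> 1)) ?sumr_const// => i _.
  by rewrite ExZ ?(ico i).2 ?mulVf//; exact: (ico i).1.
have mL := measurable_large_entries L.
have iL : itg (gtup #|I|) (fun xi : tI => \1_(large_entries L) xi * L).
  apply: (@itg_le _ _ _ (gtup #|I|) _ (fun=> L)); last 2 first.
  - exact: itg_cst.
  - move=> xi; rewrite indicE normrM (gtr0_norm L0) ler_piMl ?(ltW L0)//.
    by case: (_ \in _); rewrite ?normr1 ?normr0.
  - by apply: measurable_funM => //; exact: measurable_indic.
have le : Ex (gtup #|I|) (fun xi : tI => \1_(large_entries L) xi * L) <= #|I|%:R.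
  rewrite -eS; apply: Ex_le => // xi; rewrite indicE.
  have S0 : \sum_i `|co xi i| <= S xi.
    apply: ler_sum => i _; rewrite -[co xi i ^+ 2]real_normK ?num_real//.
    by have := sqr_ge0 (`|co xi i| - 1); lra.
  have [/set_mem/= h|_] := boolP (xi \in _).
    by rewrite mul1r (le_trans h).
  by rewrite mul0r (le_trans _ S0)// sumr_ge0.
have fL : gtup #|I| (large_entries L) \is a fin_num by exact: fin_num_measure.
have e : Ex (gtup #|I|) (fun xi : tI => \1_(large_entries L) xi * L) =
    fine (gtup #|I| (large_entries L)) * L.
  apply: EFin_inj; rewrite ExE// EFinM fineK//.
  under eq_integral do rewrite EFinM.
  rewrite ge0_integralZr//; last 2 first.
  - by apply/measurable_EFinP; exact: measurable_indic.
  - by rewrite lee_fin ltW.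
  by rewrite integral_indic// setIT.
by rewrite -(fineK fL) lee_fin ler_pdivlMr// -e.
Qed.

End large_entries.

(** * From the net to exact recovery *)

Section final_step.
Context {R : realType} (q : R) (m n k : nat) d (T : measurableType d) (P : probability T R)
  (A : 'I_m -> 'I_n -> T -> R).
Hypothesis q01 : 0 <= q <= 1.
Hypothesis iidA : gauss_iid P A.
Local Notation IX := (IX m n).

(** [F] is the complement of two measurable events, a small image on the net and large entries, so
    measurability of the recovery event itself is never at issue. *)
Lemma recovery_event (p1 p2 : R) : 0 <= p1 -> 0 < p2 ->
  (forall (K : finType) (t : K -> 'I_n -> R), K -> (forall x, bad q k (t x)) ->
    (gtup #|{: IX}| (small_image (m := m) t) <= p1%:E)%E) ->
  exists F : set T, measurable F /\
    F `<=` [set w | strong_recovery q k (\matrix_(i, j) A i j w)] /\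
    ((1 - (p1 + p2))%:E <= P F)%E.
Proof.
move=> p10 p20 hsmall.
have [[u0 bu0]|nobad] := pselect (exists u, bad q k (u : 'I_n -> R)); last first.
  exists setT; split; first exact: measurableT.
  split; last by rewrite probability_setT lee_fin; lra.
  move=> w _; apply: recovery_of_bad => // u bu.
  by exfalso; apply: nobad; exists u.
(* Fine enough for the m n entries to have absolute sum [L] or more with probability at most
   [p2]. *)
pose L := (Num.truncn (#|{: IX}|%:R / p2)).+1.
have L0 : 0 < L%:R :> R by rewrite ltr0n.
have hL : #|{: IX}|%:R / L%:R <= p2.
  rewrite ler_pdivrMr// mulrC -ler_pdivrMr//.
  by apply: ltW; exact: truncnS_gt.
have [K [t [[k0] [bt net]]]] := bad_net (ltn0Sn _ : (0 < L)%N) bu0.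
pose E := small_image (m := m) t `|` large_entries (I := {: IX}) (L%:R : R).
have t1 x : \sum_i t x i ^+ 2 = 1 by case: (bt x).
have mS := @measurable_small_image R m n K t.
have mL := @measurable_large_entries R {: IX} L%:R.
have mE : measurable E by exact: measurableU.
have PE : P (entries A @^-1` E) = gtup #|{: IX}| E by exact: entries_law.
have mPE : measurable (entries A @^-1` E).
  by rewrite -[X in measurable X]setTI; exact: (measurable_entries iidA).
exists (~` (entries A @^-1` E)); split; first exact: measurableC.
split; last first.
  rewrite probability_setC// PE EFinB; apply: leeB => //; rewrite EFinD.
  apply: (le_trans (measureU2 _ mS mL)); apply: leeD; first exact: hsmall.
  by apply: (le_trans (large_entries_prob _ L0)); rewrite lee_fin.
move=> w hw; apply: recovery_of_bad => // u bu.
apply: contrapT => hu; apply: hw.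
have Au a : \sum_i A a i w * u i = 0.
  apply/eqP; apply: contrapT => h; apply: hu; exists a; apply/negP.
  by under eq_bigr do rewrite mxE.
(* Otherwise the absolute sum S is below L; as A u = 0, the nearby net point t satisfies |A t| = |A
   (t - u)| <= S / L < 1. *)
have [hS|hS] := leP (L%:R : R) (\sum_i `|co (entries A w) i|); first by right.
left; have [x hx] := net u bu; exists x.
have ES : \sum_(i : IX) `|co (entries A w) i| = \sum_a \sum_i `|A a i w|.
  by rewrite sum_IX; apply: eq_bigr => a _; apply: eq_bigr => i _; rewrite co_entries.
rewrite ES in hS; set S := \sum_a _ in hS.
have S0 : 0 <= S by rewrite sumr_ge0// => a _; rewrite sumr_ge0.
have SL1 : (S / L%:R) ^+ 2 < 1.
  have r0 : 0 <= S / L%:R by rewrite divr_ge0// ltW.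
  have r1 : S / L%:R < 1 by rewrite ltr_pdivrMr// mul1r.
  by apply: (le_lt_trans _ r1); rewrite expr2; apply: ler_piMr => //; exact: ltW.
apply: le_lt_trans SL1.
have SL0 : 0 <= S / L%:R by rewrite divr_ge0// ltW.
apply: (le_trans (sum_sqr_le _)); rewrite lerXn2r// ?nnegrE; first by rewrite sumr_ge0.
rewrite /S mulr_suml; apply: ler_sum => a _.
rewrite (_ : \sum_i t x i * co (entries A w) ((a, i) : IX) =
  \sum_i (t x i - u i) * A a i w); last first.
  transitivity (\sum_i t x i * co (entries A w) ((a, i) : IX) - \sum_i A a i w * u i).
    by rewrite Au subr0.
  rewrite -sumrB; apply: eq_bigr => i _.
  by rewrite co_entries; ring.
apply: (le_trans (ler_norm_sum _ _ _)); rewrite mulr_suml; apply: ler_sum => i _.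
by rewrite normrM mulrC ler_wpM2l.
Qed.

End final_step.

Theorem theorem5 (R : realType) (q alpha beta c : R) (m k : nat -> nat) :
  0 <= q <= 1 -> 0 < alpha <= 1 -> 0 < beta < 1 ->
  (forall n, `|(m n)%:R - alpha * n%:R| < 1) ->
  (forall n, `|(k n)%:R - beta * n%:R| < 1) ->
  0 <= c -> normal_prob 0 1 [set h : R | c <= `|h|] = beta%:E ->
  (exists nu gamma : R, 0 <= nu /\ 0 <= gamma /\
     (I1str q c nu gamma + I2str q c nu gamma + gamma%:E < (Num.sqrt alpha)%:E)%E) ->
  exists a : R, 0 < a /\ exists N : nat, forall n : nat, (N <= n)%N ->
    forall (d : measure_display) (T : measurableType d) (P : probability T R)
           (A : 'I_(m n) -> 'I_n -> T -> R),
      gauss_iid P A ->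
      exists F : set T, measurable F /\
        F `<=` [set w | strong_recovery q (k n) (\matrix_(i, j) A i j w)] /\
        ((1 - expR (- (a * n%:R)))%:E <= P F)%E.
Proof.
move=> q01 al01 /andP[be0 be1] hm hk c0 hbeta [nu [gamma [nu0 [g0 hI]]]].
(* For c = 0 the event would have probability 1, against beta < 1. *)
have cp : 0 < c.
  rewrite lt_neqAle c0 andbT; apply/eqP => cE; move: hbeta; rewrite -cE.
  rewrite (_ : [set h : R | _] = setT); last by apply/seteqP; split=> h //= _; exact: normr_ge0.
  by rewrite (probability_setT (normal_prob 0 1)) => -[] b1; move: be1; rewrite -b1 ltxx.
have gp : 0 < gamma.
  rewrite lt_neqAle g0 andbT; apply/eqP => gE; move: hI; rewrite -gE.
  rewrite (I1str_gamma0 q cp be0 hbeta nu0) adde0 addye//.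
  by rewrite gt_eqF// (lt_le_trans _ (I2str_ge0 q nu c 0)).
have [a [Cst [a0 [C0 hB]]]] := bad_prob q01 al01 (ltW be0) c0 nu0 gp hbeta hI.
(* The total failure probability is at most (Cst + 1) exp (- 2 b n); half of the rate absorbs the
   constant, since Cst + 1 <= 1 + b n <= exp (b n) for large n. *)
pose b := Num.min a 1 / 2.
have ab : 2 * b <= a by rewrite /b mulrC divfK// ge_min lexx.
have b1 : 2 * b <= 1 by rewrite /b mulrC divfK// ge_min lexx orbT.
have b0 : 0 < b by rewrite divr_gt0// lt_min a0 ltr01.
exists b; split=> //.
exists (maxn (Num.truncn alpha^-1).+1 (Num.truncn (Cst / b)).+1) => n.
rewrite geq_max => /andP[n1 n2] d T P A iidA.
have hn1 : alpha^-1 <= n%:R by rewrite (le_trans (ltW (truncnS_gt _)))// ler_nat.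
have hn2 : Cst <= b * n%:R.
  rewrite mulrC -ler_pdivrMr// (le_trans (ltW (truncnS_gt _)))// ler_nat//.
have p10 : 0 <= Cst * expR (- (a * n%:R)) by rewrite mulr_ge0// expR_ge0.
(* Large entries are allowed probability exp (- n), which makes the mesh exponentially fine. *)
have [F [mF [Fr PF]]] := recovery_event q01 iidA p10 (expR_gt0 (- n%:R))
  (fun K t x bt => hB n (m n) (k n) (hm n) (hk n) hn1 K t x bt).
exists F; split => //; split => //; apply: le_trans PF; rewrite lee_fin lerD2l lerN2.
have e2 : expR (- (a * n%:R)) <= expR (- (2 * (b * n%:R))).
  by rewrite ler_expR lerN2 mulrA ler_wpM2r.
have e3 : expR (- n%:R) <= expR (- (2 * (b * n%:R))).
  by rewrite ler_expR lerN2 mulrA ler_piMl.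
have := ler_wpM2l C0 e2.
have eE : expR (- (2 * (b * n%:R))) = expR (- (b * n%:R)) * expR (- (b * n%:R)).
  by rewrite -expRD; congr expR; ring.
have : (Cst + 1) * expR (- (b * n%:R)) <= 1.
  rewrite expRN ler_pdivrMr ?expR_gt0// mul1r.
  by apply: le_trans (expR_ge1Dx _); lra.
move=> /(ler_wpM2r (expR_ge0 (- (b * n%:R)))); rewrite -mulrA -eE mul1r; lra.
Qed.
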